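(* Let $n=\dim M>2$ and let $L\to\widetilde L$ be a projective change of Finsler structures on $M$ with projective factor $\lambda$ ($\widetilde G=G-2\lambda\,\mathcal C$) satisfying $$\stackrel{2}{D^\circ}\alpha=-\frac1{n+1}\,p\qquad\text{and}\qquad Q(\overline X)=\frac1{n+1}R_1(\overline X)\ \text{ for all }\overline X.$$ Then $(M,L)$ is projectively flat under this change (i.e. both the $hv$-curvature tensor $\widetilde P^\circ$ and the $h$-curvature tensor $\widetilde R^\circ$ of the Berwald connection of $(M,\widetilde L)$ vanish) if, and only if, the Weyl torsion tensor $W_2$ and the Douglas tensor $\mathbb P$ of $(M,L)$ vanish.
   Context: $M$ is a real paracompact $C^\infty$ manifold of dimension $n$; $\pi:\mathcal TM\to M$ is the bundle of nonzero tangent vectors; $\pi^{-1}(TM)\to\mathcal TM$ is the pullback of $TM$ by $\pi$. Sections of $\pi^{-1}(TM)$ are called $\pi$-vector fields and written $\overline X$; tensor fields on $\pi^{-1}(TM)$ are called $\pi$-tensor fields (scalar-valued covariant ones: $\pi$-forms). $\overline\eta$ is the $\pi$-vector field $\overline\eta(u)=(u,u)$. There is an exact sequence $0\to\pi^{-1}(TM)\xrightarrow{\gamma}T(\mathcal TM)\xrightarrow{\rho}\pi^{-1}(TM)\to0$, where $\gamma$ is the vertical lift $\gamma(u,w)=\frac{d}{dt}\big|_{t=0}(u+tw)$ and $\rho$ sends $X\in T_u(\mathcal TM)$ to $(u,d\pi(X))$. Put $J:=\gamma\circ\rho$ and $\mathcal C:=\gamma\circ\overline\eta$. For a function $f$,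 $d_Jf(X)=(JX)\cdot f$. For a Finsler manifold $(M,L)$ with $E=\frac12L^2$: the canonical spray $G$ is the vector field with $i_G\,dd_JE=-dE$; the Barthel connection is $\Gamma=[J,G]$, i.e. $\Gamma(X)=[JX,G]-J[X,G]$; $h=\frac12(I+\Gamma)$, $v=\frac12(I-\Gamma)$. The horizontal map $\beta:\pi^{-1}(TM)\to T(\mathcal TM)$ sends $\overline X$ to the unique vector in the image of $h$ with $\rho(\beta\overline X)=\overline X$; $K:T(\mathcal TM)\to\pi^{-1}(TM)$ is determined by $\gamma\circ K=v$. The Berwald connection $D^\circ$ is the linear connection on $\pi^{-1}(TM)$ with $D^\circ_{\gamma\overline X}\overline Y=\rho[\gamma\overline X,\beta\overline Y]$ and $D^\circ_{\beta\overline X}\overline Y=K[\beta\overline X,\gamma\overline Y]$. For a $\pi$-tensor field $A$, $(\stackrel{2}{D^\circ}A)(\overline X,\overline Y,\dots):=(D^\circ_{\gamma\overline X}A)(\overline Y,\dots)$. Curvature: $\mathbf K(X,Y)\overline Z=-D^\circ_XD^\circ_Y\overline Z+D^\circ_YD^\circ_X\overline Z+D^\circ_{[X,Y]}\overline Z$; $R^\circ(\overline X,\overline Y)\overline Z=\mathbf K(\beta\overline X,\beta\overline Y)\overline Z$; $P^\circ(\overline X,\overline Y)\overline Z=\mathbf K(\beta\overline X,\gamma\overline Y)\overline Z$; $\widehat R^\circ(\overline X,\overline Y)=R^\circ(\overline X,\overline Y)\overline\eta$. Traces: $p(\overline X,\overline Y):=\mathrm{Tr}\{\overline Z\mapsto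 P^\circ(\overline X,\overline Y)\overline Z\}$, $R_2(\overline X,\overline Y):=\mathrm{Tr}\{\overline Z\mapsto R^\circ(\overline X,\overline Z)\overline Y\}$, $R_1(\overline X):=\frac1{n-1}\{nR_2(\overline X,\overline\eta)+R_2(\overline\eta,\overline X)\}$. Weyl torsion tensor: $W_2(\overline X,\overline Y):=\widehat R^\circ(\overline X,\overline Y)+\frac1{n+1}\mathfrak U_{\overline X,\overline Y}\{R_1(\overline Y)\overline X+(D^\circ_{\gamma\overline X}R_1)(\overline Y)\overline\eta\}$, with $\mathfrak U_{\overline X,\overline Y}\{A(\overline X,\overline Y)\}:=A(\overline X,\overline Y)-A(\overline Y,\overline X)$. Douglas tensor: $\mathbb P(\overline X,\overline Y)\overline Z:=P^\circ(\overline X,\overline Y)\overline Z-\frac1{n+1}\mathfrak S_{\overline X,\overline Y,\overline Z}\{p(\overline X,\overline Y)\overline Z\}-\frac1{n+1}(D^\circ_{\gamma\overline Y}p)(\overline X,\overline Z)\,\overline\eta$, with $\mathfrak S$ the cyclic sum. Projective change: a change $L\to\widetilde L$ of Finsler structures on $M$ whose canonical sprays satisfy $\widetilde G=G-2\lambda\mathcal C$ for a function $\lambda$ on $TM$ (smooth on $\mathcal TM$) positively homogeneous of degree 1 in $y$. Put $\alpha(\overline X):=d_J\lambda(\beta\overline X)$ and $Q(\overline X):=\beta\overline X\cdot\lambda-\lambda\,\alpha(\overline X)$. Tilded objects are those of $(M,\widetilde L)$, untilded ones those of $(M,L)$. *)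

(* Defs.v *)
From HB Require Import structures.
From mathcomp Require Import all_boot all_order all_algebra.
From mathcomp Require Import all_classical all_reals all_analysis.
Import Order.TTheory GRing.Theory Num.Theory.
Import numFieldNormedType.Exports.
Set Implicit Arguments.
Unset Strict Implicit.
Unset Printing Implicit Defensive.
Local Open Scope classical_set_scope.
Local Open Scope ring_scope.

(* C^k on V, by iterated partial derivatives; only meant for V open. *)
Fixpoint Ck (R : realType) (m k : nat) (V : set 'rV[R]_m) (f : 'rV[R]_m -> R)
    : Prop :=
  (forall a, V a -> {for a, continuous f}) /\
  if k is k'.+1 then
    forall i : 'I_m,
      (forall a, V a -> derivable f a (delta_mx 0 i)) /\
      Ck k' V (fun a => 'D_(delta_mx 0 i) f a)
  else True.

(* A chart of X with values in R^m; coord is meaningful on cdom only, and icoord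
   on coord @` cdom only. *)
Record chart (R : realType) (X : Type) (m : nat) := Chart {
  cdom : set X;
  coord : X -> 'rV[R]_m;
  icoord : 'rV[R]_m -> X
}.

Definition paracompact (M : topologicalType) : Prop :=
  forall U : set (set M), (forall O, U O -> open O) -> \bigcup_(O in U) O = setT ->
  exists V : set (set M),
    [/\ forall O, V O -> open O,
        \bigcup_(O in V) O = setT,
        forall O, V O -> exists2 O', U O' & O `<=` O' &
        forall x : M, exists2 N, nbhs x N &
          finite_set [set O | V O /\ O `&` N !=set0]].

Definition is_chart (R : realType) (M : topologicalType) (n : nat)
    (c : chart R M n) : Prop :=
  [/\ open (cdom c) /\ open (coord c @` cdom c),
      forall x, cdom c x -> icoord c (coord c x) = x,
      forall x, cdom c x -> {for x, continuous (coord c)} &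
      forall a, (coord c @` cdom c) a -> {for a, continuous (icoord c)}].

Definition smooth_manifold (R : realType) (M : topologicalType) (n : nat)
    (A : set (chart R M n)) : Prop :=
  [/\ hausdorff_space M, paracompact M,
      forall c, A c -> is_chart c,
      forall x, exists2 c, A c & cdom c x &
      forall c d, A c -> A d -> forall (j : 'I_n) k,
        Ck k (coord c @` (cdom c `&` cdom d))
             (fun a => coord d (icoord c a) 0 j)].

(* Notions attached to an atlas A.  They are applied both to the atlas of M and
   to the induced atlas of the bundle of nonzero tangent vectors of M. *)
Section Atlas.
Context (R : realType) (X : Type) (m : nat) (A : set (chart R X m)).

Definition open_in (D W : set X) : Prop :=
  W `<=` D /\ forall c, A c -> open (coord c @` (W `&` cdom c)).

(* f is of class C^oo in a neighbourhood of x. *)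
Definition smooth_at (x : X) (f : X -> R) : Prop :=
  forall c, A c -> cdom c x ->
  exists V : set 'rV[R]_m,
    [/\ open V, V (coord c x), V `<=` coord c @` cdom c &
        forall k, Ck k V (f \o icoord c)].

(* Tangent vectors at x act on the functions that are smooth near x; they are
   extended by 0 to all other functions, so that equality of tangent vectors is
   equality of operators. *)
Definition tvec := (X -> R) -> R.

(* \sum_i y_i d/dx^i at the point of coordinates a in the chart c *)
Definition dvec (c : chart R X m) (a y : 'rV[R]_m) : tvec := fun f =>
  if `[< smooth_at (icoord c a) f >] then 'D_y (f \o icoord c) a else 0.

Definition tangent (x : X) (v : tvec) : Prop :=
  exists c y, [/\ A c, cdom c x & v = dvec c (coord c x) y].

Definition cfun (c : chart R X m) (i : 'I_m) : X -> R := fun x => coord c x 0 i.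

Definition bracket (V W : X -> tvec) : X -> tvec := fun x f =>
  if `[< smooth_at x f >] then V x (W^~ f) - W x (V^~ f) else 0.

(* exterior derivative of a 1-form *)
Definition ext_d (w : (X -> tvec) -> X -> R) (V W : X -> tvec) : X -> R :=
  fun x => V x (w W) - W x (w V) - w (bracket V W) x.

End Atlas.

(* Smooth vector fields along g : Y -> X, defined on the open set W of Y. *)
Definition smooth_along (R : realType) (X Y : Type) (m p : nat)
    (A : set (chart R X m)) (B : set (chart R Y p)) (g : Y -> X)
    (W : set Y) (V : Y -> tvec R X) : Prop :=
  forall u, W u -> tangent A (g u) (V u) /\
    forall c, A c -> cdom c (g u) -> forall i,
      smooth_at B u (fun u' => V u' (cfun c i)).

Section Bundle.
Context (R : realType) (n : nat) (M : Type) (A : set (chart R M n)).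

(* u : TMT is a tangent vector of M iff TM u below holds. *)
Definition TMT := (M * tvec R M)%type.

Definition TM : set TMT := [set u | tangent A u.1 u.2].
Definition slitTM : set TMT := [set u | TM u /\ u.2 <> 0].

Definition tchart (S : set TMT) (c : chart R M n) : chart R TMT (n + n) :=
  Chart [set u | S u /\ cdom c u.1]
        (fun u => row_mx (coord c u.1) (\row_i u.2 (cfun c i)))
        (fun z => (icoord c (lsubmx z), dvec A c (lsubmx z) (rsubmx z))).

Definition TMatlas : set (chart R TMT (n + n)) := [set tchart TM c | c in A].
Definition slit_atlas : set (chart R TMT (n + n)) :=
  [set tchart slitTM c | c in A].

Definition open_slit (W : set TMT) : Prop := open_in slit_atlas slitTM W.

(* Fields of vectors of T(TM minus 0), and pi-vector fields.  The predicates say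
   that the field is defined and smooth on the open set W. *)
Definition field := TMT -> tvec R TMT.
Definition pifield := TMT -> tvec R M.
Definition vf (W : set TMT) (X : field) : Prop :=
  smooth_along slit_atlas slit_atlas id W X.
Definition pivf (W : set TMT) (X : pifield) : Prop :=
  smooth_along A slit_atlas fst W X.

Definition eta : pifield := fun u => u.2.

Definition gamma_at (u : TMT) (w : tvec R M) : tvec R TMT := fun F =>
  if `[< smooth_at slit_atlas u F >]
  then derive1 (fun t : R => F (u.1, u.2 + t *: w)) 0 else 0.
Definition gamma (X : pifield) : field := fun u => gamma_at u (X u).

(* the differential of pi : TM -> M *)
Definition rho_at (v : tvec R TMT) : tvec R M := fun f => v (f \o fst).
Definition rho (X : field) : pifield := fun u => rho_at (X u).

Definition J (X : field) : field := gamma (rho X).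
Definition Liouville : field := gamma eta.

Definition lie (X Y : field) : field := bracket slit_atlas X Y.

Definition dJ (f : TMT -> R) (X : field) : TMT -> R := fun u => J X u f.

Definition energy (L : TMT -> R) : TMT -> R := fun u => 2^-1 * L u ^+ 2.

Definition pos_homogeneous1 (f : TMT -> R) : Prop :=
  forall u t, TM u -> 0 < t -> f (u.1, t *: u.2) = t * f u.

Definition smooth_on_slit (f : TMT -> R) : Prop :=
  forall u, slitTM u -> smooth_at slit_atlas u f.

Definition finsler (L : TMT -> R) : Prop :=
  [/\ (forall u, slitTM u -> 0 < L u) /\ (forall x, L (x, 0) = 0),
      forall c, TMatlas c -> forall u, cdom c u ->
        {for coord c u, continuous (L \o icoord c)},
      smooth_on_slit L,
      pos_homogeneous1 L &
      forall u w, slitTM u -> tangent A u.1 w -> w <> 0 ->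
        0 < derive1n 2 (fun t : R => energy L (u.1, u.2 + t *: w)) 0].

(* i_G dd_J E = - dE *)
Definition canonical_spray (L : TMT -> R) (G : field) : Prop :=
  vf slitTM G /\
  forall W X u, open_slit W -> vf W X -> W u ->
    ext_d slit_atlas (dJ (energy L)) G X u = - X u (energy L).

(* The objects below depend on the Finsler structure through its canonical spray
   G only. *)
Section Spray.
Context (G : field).

Definition barthel (X : field) : field := fun u => lie (J X) G u - J (lie X G) u.
Definition hproj (X : field) : field := fun u => 2^-1 *: (X u + barthel X u).
Definition vproj (X : field) : field := fun u => 2^-1 *: (X u - barthel X u).

(* beta X at u: the vector in the image of h that rho sends to X u.  Since
   barthel acts on fields, the image of h at u consists of the values at u of h
   applied to fields that are smooth near u. *)
Definition beta (X : pifield) : field := fun u =>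
  xget 0 [set v | (exists W Y, [/\ open_slit W, W u, vf W Y & v = hproj Y u]) /\
                  rho_at v = X u].

(* gamma (K X) = v X *)
Definition Kmap (X : field) : pifield := fun u =>
  xget 0 [set w | tangent A u.1 w /\ gamma_at u w = vproj X u].

(* D_X Y, from X = gamma (K X) + beta (rho X) and the two defining formulas for
   D_(gamma _) Y and D_(beta _) Y *)
Definition berwald (X : field) (Y : pifield) : pifield := fun u =>
  rho (lie (gamma (Kmap X)) (beta Y)) u + Kmap (lie (beta (rho X)) (gamma Y)) u.

Definition curv (X Y : field) (Z : pifield) : pifield := fun u =>
  - berwald X (berwald Y Z) u + berwald Y (berwald X Z) u
  + berwald (lie X Y) Z u.

Definition Rh (X Y Z : pifield) : pifield := curv (beta X) (beta Y) Z.
Definition Phv (X Y Z : pifield) : pifield := curv (beta X) (gamma Y) Z.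
Definition Rhat (X Y : pifield) : pifield := Rh X Y eta.

(* (D_(gamma X) a) (Y) and (D_(gamma X) a) (Y, Z) for pi-forms a *)
Definition Dv1 (a : pifield -> TMT -> R) (X Y : pifield) : TMT -> R := fun u =>
  gamma X u (a Y) - a (berwald (gamma X) Y) u.
Definition Dv2 (a : pifield -> pifield -> TMT -> R) (X Y Z : pifield)
    : TMT -> R := fun u =>
  gamma X u (a Y Z) - a (berwald (gamma X) Y) Z u
  - a Y (berwald (gamma X) Z) u.

(* i-th coordinate field d/dx^i of the chart c, as a local pi-vector field *)
Definition frame (c : chart R M n) (i : 'I_n) : pifield := fun u =>
  dvec A c (coord c u.1) (delta_mx 0 i).

(* Trace at u of the endomorphism induced by the tensorial map T on the tangent
   space at u.1, computed in the basis d/dx^i of a chart c around u.1; it does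
   not depend on c. *)
Definition pitrace (T : pifield -> pifield) : TMT -> R := fun u =>
  get [set t : R | exists c, [/\ A c, cdom c u.1 &
    t = \sum_(i < n) T (frame c i) u (cfun c i)]].

Definition ptr (X Y : pifield) : TMT -> R := pitrace (fun Z => Phv X Y Z).
Definition R2 (X Y : pifield) : TMT -> R := pitrace (fun Z => Rh X Z Y).
Definition R1 (X : pifield) : TMT -> R := fun u =>
  (n%:R - 1)^-1 * (n%:R * R2 X eta u + R2 eta X u).

Definition Weyl (X Y : pifield) : pifield := fun u =>
  Rhat X Y u + (n%:R + 1)^-1 *:
    ((R1 Y u *: X u + Dv1 R1 X Y u *: eta u)
     - (R1 X u *: Y u + Dv1 R1 Y X u *: eta u)).

Definition Douglas (X Y Z : pifield) : pifield := fun u =>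
  Phv X Y Z u
  - (n%:R + 1)^-1 *: (ptr X Y u *: Z u + ptr Y Z u *: X u + ptr Z X u *: Y u)
  - ((n%:R + 1)^-1 * Dv2 ptr Y X Z u) *: eta u.

Definition alpha (lam : TMT -> R) (X : pifield) : TMT -> R :=
  dJ lam (beta X).
Definition Qform (lam : TMT -> R) (X : pifield) : TMT -> R := fun u =>
  beta X u lam - lam u * alpha lam X u.

End Spray.

(* Equalities between pi-tensor fields are tested on local smooth sections. *)
Definition pitensor2_zero (T : pifield -> pifield -> pifield) : Prop :=
  forall W X Y, open_slit W -> pivf W X -> pivf W Y ->
  forall u, W u -> T X Y u = 0.
Definition pitensor3_zero (T : pifield -> pifield -> pifield -> pifield)
    : Prop :=
  forall W X Y Z, open_slit W -> pivf W X -> pivf W Y -> pivf W Z ->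
  forall u, W u -> T X Y Z u = 0.
Definition piform1_eq (a b : pifield -> TMT -> R) : Prop :=
  forall W X, open_slit W -> pivf W X -> forall u, W u -> a X u = b X u.
Definition piform2_eq (a b : pifield -> pifield -> TMT -> R) : Prop :=
  forall W X Y, open_slit W -> pivf W X -> pivf W Y ->
  forall u, W u -> a X Y u = b X Y u.

(* L -> L' is a projective change with factor lam; G and G' are the canonical
   sprays of L and L'. *)
Definition projective_change (L L' : TMT -> R) (G G' : field)
    (lam : TMT -> R) : Prop :=
  [/\ finsler L /\ finsler L',
      canonical_spray L G /\ canonical_spray L' G',
      smooth_on_slit lam,
      pos_homogeneous1 lam &
      forall u, slitTM u -> G' u = G u - (2 * lam u) *: Liouville u].

End Bundle.

(* Main.v *)
(* Work in the chart of the slit tangent bundle induced by a chart of M, where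
   G = y^i d/dx^i - 2 G^i d/dy^i.  With N^i_j the y^j-derivative of G^i and
   delta_i = d/dx^i - N^m_i d/dy^m, the Berwald connection has the coefficients
   G^i_jk, the y^k-derivatives of N^i_j; the hv-curvature P has the components
   given by their y-derivatives, and the h-curvature R is built from the
   commutators of the delta_i.  A projective change replaces G^i by
   G^i + lam y^i; writing lam_jk for the second y-derivatives of lam, the
   coefficients of the vertical derivative of alpha, this turns
     P(X,Y)Z   into  P(X,Y)Z + (cyclic sum of lam(X,Y) Z) + (D_(gamma Y) lam)(X,Z) eta,
     Rhat(X,Y) into  Rhat(X,Y) + U_(X,Y) { Q(Y) X + (D_(gamma X) Q)(Y) eta }.
   The two hypotheses express p through lam_jk and R_1 through Q, so that no
   trace has to be computed: the new P is the Douglas tensor of G and the new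
   Rhat is its Weyl torsion tensor.  Finally R and Rhat vanish together, since
   Rhat = R(.,.)eta and, G^i being homogeneous of degree 2 in y, R is the
   vertical derivative of Rhat.  That G has the above form with homogeneous G^i
   follows from i_G dd_J E = -dE by differentiating the Euler identity of E,
   because the vertical Hessian of E is definite. *)
Require Import Defs.
From HB Require Import structures.
From mathcomp Require Import all_boot all_order all_algebra.
From mathcomp Require Import all_classical all_reals all_analysis.
From mathcomp Require Import ring lra.
Import Order.TTheory GRing.Theory Num.Theory.
Import numFieldNormedType.Exports.
Import Defs.
Local Open Scope classical_set_scope.
Local Open Scope ring_scope.
Set Implicit Arguments.
Unset Strict Implicit.
Unset Printing Implicit Defensive.

(** * Calculus in R^m *)

(** The constant n + 1 of the hypotheses comes from traces. As lam is homogeneous of degree 1,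
    tracing over Z the terms added to P gives n + 2 copies of lam(X,Y) from the cyclic sum and -1
    from the eta term, so the new p is p plus n + 1 times the vertical derivative of alpha; likewise
    R_1 is the combination of traces that changes by -(n + 1) Q. The hypotheses thus say that the
    new p and the new R_1 vanish, and then the projectively invariant Douglas and Weyl tensors
    reduce to the new P and Rhat. Two features of the definitions shape the proof. [Ck] speaks of
    partial derivatives only, so differentiability, the chain rule and the symmetry of second
    derivatives are built from it. And [beta] and [Kmap] are values picked by choice, while tangent
    vectors are operators that vanish on functions not smooth at the point. Hence every object is
    identified by its components in a chart, and every formula is proved at all points of an open
    subset [W] of a chart domain, so that the next construction can differentiate it. *)

Lemma is_derive1_line (R : realType) (m : nat) (f : 'rV[R]_m -> R)
    (p e : 'rV[R]_m) (r : R) : derivable f (p + r *: e) e ->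
  is_derive r (1 : R) (fun t : R => f (p + t *: e)) ('D_e f (p + r *: e)).
Proof.
have E : (fun h : R => h^-1 *: (((fun t : R => f (p + t *: e)) \o shift r) (h *: 1)
    - f (p + r *: e))) =
  (fun h : R => h^-1 *: ((f \o shift (p + r *: e)) (h *: e) - f (p + r *: e))).
  apply/funext => h /=; congr (_ *: (f _ - _)).
  by rewrite [h *: 1]mulr1 scalerDl addrCA.
by move=> df; constructor; rewrite /derivable /derive E.
Qed.

(** The parameter runs over [0, 1] and the step [s] is kept as a factor, so that steps of either
    sign, and [s = 0], are covered at once. *)
Lemma mvt_line (R : realType) (m : nat) (f : 'rV[R]_m -> R)
    (p e : 'rV[R]_m) (s : R) :
  (forall t : R, 0 <= t <= 1 -> derivable f (p + (t * s) *: e) e) ->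
  exists2 t : R, 0 <= t <= 1 &
    f (p + s *: e) - f p = s * 'D_e f (p + (t * s) *: e).
Proof.
move=> df.
have H (t : R) : 0 <= t <= 1 -> is_derive t (1 : R) (fun t : R => f (p + (t * s) *: e))
    ('D_e f (p + (t * s) *: e) * s).
  move=> t01.
  have -> : (fun t => f (p + (t * s) *: e)) =
     (fun t => f (p + t *: e)) \o ( *%R^~ s) by [].
  apply: is_derive1_comp; first exact/is_derive1_line/df.
  have -> : *%R^~ s = s \*: (id : R -> R) by apply/funext => r /=; rewrite mulrC.
  by apply: is_derive_eq; exact: mulr1.
have [||t tin] := @MVT_segment R (fun t => f (p + (t * s) *: e))
    (fun t => 'D_e f (p + (t * s) *: e) * s) 0 1 ler01.
- by move=> t; rewrite in_itv /= => /andP[t0 t1]; apply: H; rewrite !ltW.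
- apply: derivable_within_continuous => t; rewrite in_itv /= => t01.
  by have [] := H t t01.
- rewrite mul1r mul0r scale0r addr0 subr0 mulr1 => ->.
  by exists t; [rewrite in_itv in tin | rewrite mulrC].
Qed.

Lemma entry_le_norm (R : realType) (m : nat) (x : 'rV[R]_m) (i : 'I_m) :
  `|x 0 i| <= `|x|.
Proof.
by rewrite [leRHS]/Num.Def.normr /= mx_normrE; exact: (le_bigmax _ _ (0, i)).
Qed.

Lemma norm_le_entry (R : realType) (m : nat) (x : 'rV[R]_m) (c : R) :
  0 <= c -> (forall i, `|x 0 i| <= c) -> `|x| <= c.
Proof.
move=> c0 xc; rewrite [leLHS]/Num.Def.normr /= mx_normrE.
by apply: bigmax_le => //= -[j i] _; rewrite ord1.
Qed.

(** The increment is telescoped along a path that changes one coordinate at a time; the mean value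
    theorem turns each piece into a partial derivative at a point near [a], which continuity
    compares with the one at [a]. *)
Lemma continuous_partial_differentiable (R : realType) (m : nat)
    (V : set 'rV[R]_m) (f : 'rV[R]_m -> R) (a : 'rV[R]_m) : open V -> V a ->
  (forall i b, V b -> derivable f b (delta_mx 0 i)) ->
  (forall i, {for a, continuous (fun b => 'D_(delta_mx 0 i) f b)}) ->
  differentiable f a.
Proof.
move=> oV Va df cf.
pose DL := fun h : 'rV[R]_m => \sum_(i < m) h 0 i * 'D_(delta_mx 0 i) f a.
have linDL : linear DL.
  move=> k x y; rewrite /DL scaler_sumr -big_split /=; apply: eq_bigr => i _.
  by rewrite !mxE mulrDl -mulrA.
pose DLm := GRing.isLinear.Build _ _ _ _ DL linDL.
pose DLl : {linear 'rV[R]_m -> R} := HB.pack DL DLm.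
have cDL : continuous DLl.
  move=> x; apply: differentiable_continuous.
  rewrite (_ : DLl = \sum_(i < m) (fun h : 'rV[R]_m => h 0 i * 'D_(delta_mx 0 i) f a) :> (_ -> _)).
    apply: differentiable_sum => i.
    by apply: (@differentiableM _ _ (fun h : 'rV[R]_m => h 0 i) (fun _ => 'D_(delta_mx 0 i) f a));
      [exact: differentiable_coord | exact: differentiable_cst].
  by apply/funext => h; rewrite fct_sumE.
suff E : f \o shift a = cst (f a) + (DLl : _ -> _) +o_ (0 : 'rV[R]_m) id.
  by apply/diff_locallyP; rewrite (diff_unique cDL E); split.
apply/eqaddoP => _/posnumP[e].
(* Each of the [m] pieces may contribute an error [e']; dividing by [m.+1] also covers [m = 0]. *)
pose e' := e%:num / m.+1%:R.
have e'0 : 0 < e' by rewrite divr_gt0.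
have [d d0 Hd] : exists2 d : R, 0 < d & forall b, `|a - b| < d ->
    V b /\ forall i, `|'D_(delta_mx 0 i) f a - 'D_(delta_mx 0 i) f b| <= e'.
  have : \forall b \near a, V b /\
      forall i, `|'D_(delta_mx 0 i) f a - 'D_(delta_mx 0 i) f b| <= e'.
    have H (i : 'I_m) : \forall b \near a,
        `|'D_(delta_mx 0 i) f a - 'D_(delta_mx 0 i) f b| <= e'.
      by have /cvgrPdist_le /(_ e' e'0) := cf i.
    near=> b; split; last by near: b; exact: filter_forall.
    by near: b; exact: open_nbhs_nbhs.
  by move=> /nbhs_ballP[d /= d0 H]; exists d => // b ab; apply: H; rewrite -ball_normE.
near=> h.
have hd : `|h| < d.
  near: h; apply/nbhs_ballP; exists d => // x; rewrite -ball_normE /= sub0r normrN //.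
(* [p k] has already moved the coordinates of index below [k], so [p 0] is [a] and [p m] is
   [a + h]. *)
pose p (k : nat) := a + \row_(i < m) (if (i < k)%N then h 0 i else 0).
have pS (i : 'I_m) : p i.+1 = p i + h 0 i *: delta_mx 0 i.
  rewrite /p -addrA; congr (_ + _); apply/rowP => j; rewrite !mxE eqxx /= ltnS.
  have [->|ji] := eqVneq j i; first by rewrite leqnn ltnn add0r mulr1.
  by rewrite mulr0 addr0 ltn_neqAle; case: (val j =P val i) ji => [/val_inj ->|]//; rewrite eqxx.
have pd (i : 'I_m) (t : R) : 0 <= t <= 1 -> `|a - (p i + (t * h 0 i) *: delta_mx 0 i)| < d.
  move=> /andP[t0 t1]; apply: le_lt_trans hd; apply: norm_le_entry => // j.
  rewrite !mxE eqxx /= opprD addrA opprD addrA subrr sub0r.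
  have [->|ji] := eqVneq j i.
    rewrite ltnn oppr0 sub0r normrN mulr1 normrM.
    by rewrite (le_trans _ (entry_le_norm h i))// ler_piMl// ger0_norm.
  rewrite mulr0 subr0; case: ifP => _; last by rewrite oppr0 normr0.
  by rewrite normrN entry_le_norm.
have fE : (f \o shift a) h - f a = \sum_(i < m) (f (p i.+1) - f (p i)).
  rewrite -(big_mkord xpredT (fun i => f (p i.+1) - f (p i))) telescope_sumr//.
  congr (f _ - f _) => /=; apply/rowP => i; rewrite !mxE ?ltn_ord ?ltn0 ?addr0//.
  by rewrite addrC.
rewrite /= [X in `|X|](_ : _ = (f \o shift a) h - f a - DL h); last first.
  by rewrite /= opprD addrA.
rewrite fE /DL -sumrB.
apply: (@le_trans _ _ (\sum_(i < m) `|h| * e')).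
  apply: le_trans (ler_norm_sum _ _ _) _; apply: ler_sum => i _.
  have [|t t01] := @mvt_line R m f (p i) (delta_mx 0 i) (h 0 i).
    by move=> t t01; apply: df; have [] := Hd _ (pd i t t01).
  rewrite pS => ->; rewrite -mulrBr normrM ler_pM ?entry_le_norm//.
  by rewrite distrC; have [_] := Hd _ (pd i t t01); exact.
rewrite sumr_const card_ord -mulrnAr mulrC ler_wpM2r// /e'.
rewrite -[leLHS]mulr_natr -mulrA ler_piMr// mulrC ler_pdivrMr ?ltr0n// mul1r ler_nat//.
Unshelve. all: by end_near. Qed.

(** * Closure properties of C^k functions and the chain rule *)

Section CkTheory.
Context (R : realType).

Lemma CkW (m k : nat) (V : set 'rV[R]_m) f : Ck k.+1 V f -> Ck k V f.
Proof.
elim: k f => [f []//|k IH f [cf df]]; split=> // i.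
by have [dfi /IH] := df i.
Qed.

Lemma Ck_sub (m k : nat) (V V' : set 'rV[R]_m) f :
  V' `<=` V -> Ck k V f -> Ck k V' f.
Proof.
move=> sV; elim: k f => [|k IH] f [cf df]; split=> //; first by move=> a /sV/cf.
  by move=> a /sV/cf.
by move=> i; have [dfi /IH] := df i; split=> // a /sV/dfi.
Qed.

Lemma near_eq_continuous (T U : topologicalType) (f g : T -> U) a :
  (\forall b \near a, f b = g b) -> {for a, continuous f} ->
  {for a, continuous g}.
Proof.
move=> fg cf; rewrite /prop_for /continuous_at -(nbhs_singleton fg).
by apply: cvg_trans cf; exact: near_eq_cvg.
Qed.

(** Since [V] is open, equality on [V] is equality near each of its points, and so passes to the
    partial derivatives. *)
Lemma Ck_eq (m k : nat) (V : set 'rV[R]_m) f g : open V ->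
  (forall a, V a -> f a = g a) -> Ck k V f -> Ck k V g.
Proof.
move=> oV; elim: k f g => [|k IH] f g fg [cf df];
  have nfg a : V a -> \forall b \near a, f b = g b
    by (move=> Va; near=> b; apply: fg; near: b; exact: open_nbhs_nbhs).
  by split=> // a Va; apply: near_eq_continuous (cf a Va); exact: nfg.
split; first by move=> a Va; apply: near_eq_continuous (cf a Va); exact: nfg.
move=> i.
have [dfi Cfi] := df i; split.
  by move=> a Va; apply: near_eq_derivable (dfi a Va); exact: nfg.
by apply: IH Cfi => a Va; apply: near_eq_derive; exact: nfg.
Unshelve. all: by end_near. Qed.

Lemma Ck_cst (m k : nat) (V : set 'rV[R]_m) (c : R) : Ck k V (fun => c).
Proof.
elim: k c => [|k IH] c; split=> //.
- by move=> a _; exact: cst_continuous.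
- by move=> a _; exact: cst_continuous.
- move=> i; split; first by move=> a _; exact: derivable_cst.
  rewrite (_ : (fun a => 'D_(delta_mx 0 i) _ a) = (fun=> 0)); first exact: IH.
  by apply/funext => a; exact: derive_cst.
Qed.

Lemma derive_coord (m : nat) (a v : 'rV[R]_m) (j : 'I_m) :
  'D_v (fun b : 'rV[R]_m => b 0 j) a = v 0 j.
Proof.
have := @derive_mx R _ 1 m id a v (@derivable_id _ _ a v).
by rewrite derive_id => /rowP/(_ j) => ->; rewrite mxE.
Qed.

Lemma Ck_coord (m k : nat) (V : set 'rV[R]_m) (j : 'I_m) :
  Ck k V (fun a => a 0 j).
Proof.
case: k => [|k]; split=> //.
- by move=> a _; exact: coord_continuous.
- by move=> a _; exact: coord_continuous.
- move=> i; split.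
    by move=> a _; apply/diff_derivable; exact: differentiable_coord.
  rewrite (_ : (fun a => 'D_(delta_mx 0 i) _ a) =
    (fun=> (delta_mx 0 i : 'rV[R]_m) 0 j)); first exact: Ck_cst.
  by apply/funext => a; exact: derive_coord.
Qed.

Lemma Ck_add (m k : nat) (V : set 'rV[R]_m) f g : open V ->
  Ck k V f -> Ck k V g -> Ck k V (fun a => f a + g a).
Proof.
move=> oV; elim: k f g => [|k IH] f g [cf df] [cg dg]; split=> //.
- by move=> a Va; exact: continuousD (cf a Va) (cg a Va).
- by move=> a Va; exact: continuousD (cf a Va) (cg a Va).
- move=> i; have [dfi Cfi] := df i; have [dgi Cgi] := dg i; split.
    by move=> a Va; apply: derivableD; [exact: dfi|exact: dgi].
  apply: (Ck_eq oV _ (IH _ _ Cfi Cgi)) => a Va.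
  by rewrite -deriveD//; [exact: dfi|exact: dgi].
Qed.

Lemma Ck_mul (m k : nat) (V : set 'rV[R]_m) f g : open V ->
  Ck k V f -> Ck k V g -> Ck k V (fun a => f a * g a).
Proof.
move=> oV; elim: k f g => [|k IH] f g Cf Cg.
  case: Cf Cg => cf _ [cg _]; split=> // a Va.
  by exact: continuousM (cf a Va) (cg a Va).
have [cf df] := Cf; have [cg dg] := Cg; split.
  by move=> a Va; exact: continuousM (cf a Va) (cg a Va).
move=> i; have [dfi Cfi] := df i; have [dgi Cgi] := dg i; split.
  by move=> a Va; apply: derivableM; [exact: dfi|exact: dgi].
apply: (Ck_eq oV _ (Ck_add oV (IH _ _ (CkW Cf) Cgi) (IH _ _ (CkW Cg) Cfi))) => a Va.
by rewrite /= -deriveM//; [exact: dfi|exact: dgi].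
Qed.

Lemma Ck_sum (m k : nat) (V : set 'rV[R]_m) (I : Type) (r : seq I)
    (F : I -> 'rV[R]_m -> R) : open V ->
  (forall i, Ck k V (F i)) -> Ck k V (fun a => \sum_(i <- r) F i a).
Proof.
move=> oV CF; elim: r => [|i r IH].
  by apply: (Ck_eq oV _ (@Ck_cst m k V 0)) => a _; rewrite big_nil.
by apply: (Ck_eq oV _ (Ck_add oV (CF i) IH)) => a _; rewrite big_cons.
Qed.

Lemma Ck1_differentiable (m : nat) (V : set 'rV[R]_m) f a : open V -> V a ->
  Ck 1 V f -> differentiable f a.
Proof.
move=> oV Va [_ df]; apply: (continuous_partial_differentiable oV Va).
  by move=> i b Vb; have [dfi _] := df i; exact: dfi.
by move=> i; have [_ []] := df i => + _; exact.
Qed.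

Lemma derive_partials (m : nat) (f : 'rV[R]_m -> R) (a v : 'rV[R]_m) :
  differentiable f a ->
  'D_v f a = \sum_(i < m) v 0 i * 'D_(delta_mx 0 i) f a.
Proof.
move=> df; rewrite deriveE// [X in 'd f a X]row_sum_delta linear_sum/=.
by apply: eq_bigr => i _; rewrite linearZ/= deriveE.
Qed.

Lemma differentiable_row (m p : nat) (g : 'rV[R]_m -> 'rV[R]_p) a :
  (forall j, differentiable (fun b => g b 0 j) a) -> differentiable g a.
Proof.
move=> dg; rewrite (_ : g = \sum_(j < p) (fun b => g b 0 j *: (delta_mx 0 j : 'rV_p))).
  by apply: differentiable_sum => j; exact: differentiableZl.
by apply/funext => b; rewrite fct_sumE [LHS]row_sum_delta.
Qed.

Lemma derive_comp_row (m p : nat) (f : 'rV[R]_p -> R) (g : 'rV[R]_m -> 'rV[R]_p)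
    (a v : 'rV[R]_m) : differentiable f (g a) ->
  (forall j, differentiable (fun b => g b 0 j) a) ->
  'D_v (f \o g) a =
  \sum_(j < p) 'D_(delta_mx 0 j) f (g a) * 'D_v (fun b => g b 0 j) a.
Proof.
move=> df dg; have dg' := differentiable_row dg.
rewrite deriveE; last exact: differentiable_comp.
rewrite diff_comp//= -!deriveE// derive_partials//.
apply: eq_bigr => j _; rewrite mulrC; congr (_ * _).
by rewrite derive_mx ?mxE//; exact: diff_derivable.
Qed.

Lemma continuous_row (T : topologicalType) (p : nat) (g : T -> 'rV[R]_p) a :
  (forall j, {for a, continuous (fun b => g b 0 j)}) -> {for a, continuous g}.
Proof.
move=> cg; apply/cvgrPdist_le => e e0; near=> b.
apply: norm_le_entry; first exact: ltW.
move=> i; rewrite !mxE; move: i; near: b.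
have H (i : 'I_p) : \forall b \near a, `|g a 0 i - g b 0 i| <= e.
  by have /cvgrPdist_le /(_ e e0) := cg i.
exact: filter_forall.
Unshelve. all: by end_near. Qed.

(** Induction on the order: by the chain rule, a partial derivative of the composite is a sum of
    products of (partial derivative of [f]) composed with [g] and a partial derivative of [g], all
    of one order less. *)
Lemma Ck_comp (m p k : nat) (V : set 'rV[R]_m) (W : set 'rV[R]_p)
    (f : 'rV[R]_p -> R) (g : 'rV[R]_m -> 'rV[R]_p) : open V -> open W ->
  (forall a, V a -> W (g a)) -> Ck k W f ->
  (forall j, Ck k V (fun a => g a 0 j)) -> Ck k V (f \o g).
Proof.
move=> oV oW gVW.
have cont (f' : 'rV[R]_p -> R) : (forall b, W b -> {for b, continuous f'}) ->
    (forall j a, V a -> {for a, continuous (fun a => g a 0 j)}) ->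
    forall a, V a -> {for a, continuous (f' \o g)}.
  move=> cf cg a Va; have cga : {for a, continuous g}.
    by apply: continuous_row => j; exact: cg.
  by have := @continuous_comp _ _ _ _ _ _ cga (cf _ (gVW a Va)).
elim: k f => [|k IH] f Cf Cg.
  split=> //; apply: cont; first by case: Cf.
  by move=> j; have [] := Cg j.
split; first by apply: cont => [|j]; [case: Cf | have [] := Cg j].
(* The chain rule needs total differentiability, which order 1 already provides. *)
have Cg1 j : Ck 1 V (fun a => g a 0 j).
  elim: k {IH Cf} Cg => [|k IH] Cg //.
  by apply: IH => i; exact: CkW.
have Cf1 : Ck 1 W f by elim: k {IH Cg} Cf => [|k IH] Cf //; apply: IH; exact: CkW.
have df a : V a -> differentiable f (g a).
  by move=> Va; apply: Ck1_differentiable Cf1 => //; exact: gVW.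
have dg j a : V a -> differentiable (fun b => g b 0 j) a.
  by move=> Va; apply: Ck1_differentiable (Cg1 j).
move=> i; split.
  move=> a Va; apply: diff_derivable; apply: differentiable_comp; last exact: df.
  by apply: differentiable_row => j; exact: dg.
have [_ Cfj] := Cf.
have Cgi j : Ck k V (fun a => 'D_(delta_mx 0 i) (fun b => g b 0 j) a).
  by have [_ /(_ i)[]] := Cg j.
have C : Ck k V (fun a => \sum_(j < p) ('D_(delta_mx 0 j) f \o g) a *
    'D_(delta_mx 0 i) (fun b => g b 0 j) a).
  apply: Ck_sum => // j; apply: Ck_mul => //; apply: IH; first by have [] := Cfj j.
  by move=> l; exact: CkW.
apply: (Ck_eq oV _ C) => a Va.
by rewrite derive_comp_row//; [exact: df | move=> j; exact: dg].
Qed.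

End CkTheory.

(** * Symmetry of second partial derivatives *)

Section Schwarz.
Context (R : realType) (m : nat).
Implicit Types (f : 'rV[R]_m -> R) (a b v w : 'rV[R]_m).

Lemma is_derive_translate f b v w : derivable f (b + w) v ->
  is_derive b v (fun x => f (x + w)) ('D_v f (b + w)).
Proof.
have E : (fun h : R => h^-1 *: (((fun x => f (x + w)) \o shift b) (h *: v) - f (b + w)))
   = (fun h : R => h^-1 *: ((f \o shift (b + w)) (h *: v) - f (b + w))).
  by apply/funext => h /=; rewrite addrA.
by move=> df; constructor; rewrite /derivable /derive E.
Qed.

Lemma norm_step_le (t s : R) (i : 'I_m) : 0 <= t <= 1 ->
  `|(t * s) *: (delta_mx 0 i : 'rV[R]_m)| <= `|s|.
Proof.
move=> /andP[t0 t1]; apply: norm_le_entry => // j; rewrite !mxE eqxx /=.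
case: eqP => _; last by rewrite mulr0 normr0.
by rewrite mulr1 normrM ger0_norm// ler_piMl.
Qed.

(** The mean value theorem is used twice: in direction [i] for the difference of [f] and its
    translate along [j], then in direction [j] for the [i]-th partial derivative. *)
Lemma second_difference (V : set 'rV[R]_m) f a (i j : 'I_m) (d s : R) :
  Ck 2 V f -> (forall b, `|a - b| < d -> V b) -> `|s| + `|s| < d ->
  exists2 b, `|a - b| < d &
    f (a + s *: delta_mx 0 i + s *: delta_mx 0 j) - f (a + s *: delta_mx 0 i)
    - (f (a + s *: delta_mx 0 j) - f a)
    = s * (s * 'D_(delta_mx 0 j) ('D_(delta_mx 0 i) f) b).
Proof.
move=> [_ Cf] dV sd.
have near2 (t t' : R) : 0 <= t <= 1 -> 0 <= t' <= 1 ->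
    `|a - (a + (t * s) *: delta_mx 0 i + (t' * s) *: delta_mx 0 j)| < d.
  move=> t01 t'01; rewrite -addrA opprD addrA subrr sub0r normrN.
  apply: le_lt_trans sd; apply: le_trans (ler_normD _ _) _.
  by rewrite lerD ?norm_step_le.
have i0 : 0 <= (0 : R) <= 1 by rewrite lexx ler01.
have i1 : 0 <= (1 : R) <= 1 by rewrite lexx ler01.
have [dfi [_ Cfi]] := Cf i; have [dfij _] := Cfi j.
have g' (t : R) : 0 <= t <= 1 -> is_derive (a + (t * s) *: delta_mx 0 i) (delta_mx 0 i)
    (fun b => f (b + s *: delta_mx 0 j) - f b)
    ('D_(delta_mx 0 i) f (a + (t * s) *: delta_mx 0 i + s *: delta_mx 0 j)
     - 'D_(delta_mx 0 i) f (a + (t * s) *: delta_mx 0 i)).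
  move=> t01; apply: is_deriveB.
    apply: is_derive_translate; apply: dfi; apply: dV.
    by have := near2 t 1 t01 i1; rewrite mul1r.
  apply/derivableP/dfi/dV.
  by have := near2 t 0 t01 i0; rewrite mul0r scale0r addr0.
have [t t01|t t01 /= ->] :=
  @mvt_line R m (fun b => f (b + s *: delta_mx 0 j) - f b) a (delta_mx 0 i) s.
  by have [] := g' t t01.
have [_ ->] := g' t t01.
have [t' t'01|t' t'01 ->] := @mvt_line R m ('D_(delta_mx 0 i) f)
  (a + (t * s) *: delta_mx 0 i) (delta_mx 0 j) s.
  by apply/dfij/dV/near2.
by exists (a + (t * s) *: delta_mx 0 i + (t' * s) *: delta_mx 0 j) => //; exact: near2.
Qed.

Lemma schwarz (V : set 'rV[R]_m) f a (i j : 'I_m) : open V -> V a -> Ck 2 V f ->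
  'D_(delta_mx 0 j) ('D_(delta_mx 0 i) f) a =
  'D_(delta_mx 0 i) ('D_(delta_mx 0 j) f) a.
Proof.
move=> oV Va Cf; apply/eqP; rewrite -subr_eq0 -normr_le0; apply/ler_addgt0Pl => e e0.
rewrite addr0.
have e20 : 0 < e / 2 by rewrite divr_gt0.
have c2 k l : {for a, continuous ('D_(delta_mx 0 l) ('D_(delta_mx 0 k) f))}.
  by have [_ /(_ k)[_ [_ /(_ l)[_ [+ _]]]]] := Cf; exact.
have : \forall b \near a, V b /\
   (`|'D_(delta_mx 0 j) ('D_(delta_mx 0 i) f) a - 'D_(delta_mx 0 j) ('D_(delta_mx 0 i) f) b| <= e / 2 /\
   `|'D_(delta_mx 0 i) ('D_(delta_mx 0 j) f) a - 'D_(delta_mx 0 i) ('D_(delta_mx 0 j) f) b| <= e / 2).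
  have /cvgrPdist_le /(_ _ e20) H1 := c2 i j.
  have /cvgrPdist_le /(_ _ e20) H2 := c2 j i.
  have H0 : nbhs a V by exact: open_nbhs_nbhs.
  exact: (@filterI _ _ (nbhs_filter a) _ _ H0 (@filterI _ _ (nbhs_filter a) _ _ H1 H2)).
move=> /nbhs_ballP[d /= d0]; rewrite -ball_normE => dV.
(* Two steps of length [d / 3] stay inside the ball of radius [d]. *)
have sd : `|d / 3| + `|d / 3| < d by rewrite gtr0_norm ?divr_gt0//; lra.
have dV' b : `|a - b| < d -> V b by move=> /dV[].
have [b bd Eb] := second_difference i j Cf dV' sd.
have [b' b'd Eb'] := second_difference j i Cf dV' sd.
have [_ [Hb _]] := dV _ bd; have [_ [_ Hb']] := dV _ b'd.
move: Eb Eb' Hb Hb'; rewrite [in X in _ -> X -> _](addrAC a).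
move: ('D_(delta_mx 0 j) _ a) ('D_(delta_mx 0 i) _ a) ('D_(delta_mx 0 j) _ b)
  ('D_(delta_mx 0 i) _ b') (f _) (f _) (f _) (f a) => A B C C' p q r t Eb Eb'.
have d3 : d / 3 != 0 by rewrite gt_eqF ?divr_gt0.
(* The second difference is symmetric in [i] and [j], so both mixed derivatives, taken at their own
   intermediate points, equal it divided by the squared step. *)
have -> : C' = C.
  by apply: (mulfI d3); apply: (mulfI d3); rewrite -Eb -Eb'; ring.
rewrite !ler_norml; lra.
Qed.

End Schwarz.

(** * Functions and tangent vectors on a smooth atlas *)

Lemma open_preimage_on (S T : topologicalType) (U : set S) (V : set T) (g : S -> T) :
  open U -> open V -> (forall a, U a -> {for a, continuous g}) ->
  open (U `&` g @^-1` V).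
Proof.
move=> oU oV cg; rewrite openE => a [Ua Va]; apply: filterI.
  exact: open_nbhs_nbhs.
by apply: (cg a Ua); exact: open_nbhs_nbhs.
Qed.

(** Only what the local calculus uses, with no topology on [X], so that one theory serves both the
    atlas of M and the induced atlas of the slit tangent bundle. *)
Record good_atlas (R : realType) (X : Type) (m : nat) (A : set (chart R X m)) : Prop :=
  GoodAtlas {
    atlas_icoordK : forall c x, A c -> cdom c x -> icoord c (coord c x) = x;
    atlas_overlap : forall c d, A c -> A d -> open (coord c @` (cdom c `&` cdom d));
    atlas_transition : forall c d, A c -> A d -> forall (j : 'I_m) k,
      Ck k (coord c @` (cdom c `&` cdom d)) (fun a => coord d (icoord c a) 0 j)
  }.

(* Locked, since failed unifications of two derivatives would otherwise unfold
   them down to limits of difference quotients. *)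
HB.lock Definition pd (R : realType) (X : Type) (m : nat) (A : set (chart R X m))
    (c : chart R X m) (i : 'I_m) (x : X) : tvec R X :=
  dvec A c (coord c x) (delta_mx 0 i).

Section AtlasTheory.
Context (R : realType) (X : Type) (m : nat) (A : set (chart R X m)).
Hypothesis gA : good_atlas A.
Implicit Types (c d : chart R X m) (x : X) (f g : X -> R) (v w : tvec R X).

Definition opn (W : set X) := forall c, A c -> open (coord c @` (W `&` cdom c)).
Local Notation sm := (smooth_at A).
Local Notation pd := (pd A).

Lemma coordK c a : A c -> (coord c @` cdom c) a ->
  cdom c (icoord c a) /\ coord c (icoord c a) = a.
Proof. by move=> Ac [x cx <-]; rewrite (atlas_icoordK gA). Qed.

Lemma atlas_image_open c : A c -> open (coord c @` cdom c).
Proof. by move=> Ac; have := atlas_overlap gA Ac Ac; rewrite setIid. Qed.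

Lemma opnI W W' : opn W -> opn W' -> opn (W `&` W').
Proof.
move=> oW oW' c Ac.
rewrite (_ : _ @` _ = coord c @` (W `&` cdom c) `&` coord c @` (W' `&` cdom c)).
  by apply: openI; [exact: oW | exact: oW'].
apply/seteqP; split=> [_ [x [[Wx W'x] cx] <-]|a [[x [Wx cx] xa] [y [Wy cy] ya]]].
  by split; exists x.
exists x => //; split=> //; split=> //.
by rewrite -(atlas_icoordK gA Ac cx) xa -ya (atlas_icoordK gA Ac cy).
Qed.

Lemma opn_pull c (V : set 'rV[R]_m) : A c -> open V ->
  opn [set x | cdom c x /\ V (coord c x)].
Proof.
move=> Ac oV d Ad.
rewrite (_ : _ @` _ = (coord d @` (cdom d `&` cdom c)) `&`
    (fun a => coord c (icoord d a)) @^-1` V).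
  apply: open_preimage_on => //; first exact: (atlas_overlap gA).
  move=> a da; apply: continuous_row => j.
  by have [+ _] := atlas_transition gA Ad Ac j 0; exact.
apply/seteqP; split=> [_ [x [[cx Vx] dx] <-]|_ [[x [dx cx] <-]]] /=.
  by split; [exists x | rewrite (atlas_icoordK gA)].
by rewrite (atlas_icoordK gA)// => Vx; exists x.
Qed.

Lemma opn_cdom c : A c -> opn (cdom c).
Proof.
move=> Ac; have := opn_pull Ac openT.
by rewrite (_ : [set x | _] = cdom c)//; apply/seteqP; split=> [x []|x].
Qed.

(** [smooth_at] quantifies over all charts around [x]; as the transition maps are C^k for every k,
    one chart is enough. *)
Lemma sm_intro c x f (V : set 'rV[R]_m) : A c -> cdom c x -> open V ->
  V (coord c x) -> V `<=` coord c @` cdom c ->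
  (forall k, Ck k V (f \o icoord c)) -> sm x f.
Proof.
move=> Ac cx oV Vx sV CV d Ad dx.
have oW := opn_pull Ac oV Ad.
exists (coord d @` ([set x | cdom c x /\ V (coord c x)] `&` cdom d)); split=> //.
- by exists x.
- by move=> _ [y [_ dy] <-]; exists y.
move=> k; apply: (Ck_eq oW (f := (f \o icoord c) \o (fun a => coord c (icoord d a)))).
  move=> _ [y [[cy Vy] dy] <-] /=.
  by rewrite (atlas_icoordK gA Ad dy) (atlas_icoordK gA Ac cy).
apply: (Ck_comp oW oV) => //.
  by move=> _ [y [[cy Vy] dy] <-] /=; rewrite (atlas_icoordK gA Ad dy).
move=> j; apply: Ck_sub (atlas_transition gA Ad Ac j k) => _ [y [[cy _] dy] <-].
by exists y.
Qed.

Lemma sm_eq W x f g : opn W -> W x -> (forall y, W y -> f y = g y) ->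
  sm x f -> sm x g.
Proof.
move=> oW Wx fg smf c Ac cx; have [V [oV Vx sV CV]] := smf c Ac cx.
have oI := openI oV (oW c Ac).
exists (V `&` coord c @` (W `&` cdom c)); split=> //.
- by split=> //; exists x.
- by move=> a [/sV].
move=> k; apply: (Ck_eq oI (f := f \o icoord c)).
  move=> a [_ [y [Wy cy] <-]] /=.
  by rewrite (atlas_icoordK gA)//; exact: fg.
by apply: Ck_sub (CV k) => a [].
Qed.

Lemma sm_cst x (r : R) : sm x (fun=> r).
Proof.
move=> c Ac cx; exists (coord c @` cdom c); split.
- exact: atlas_image_open.
- by exists x.
- by [].
- by move=> k; exact: Ck_cst.
Qed.

Let sm_op2 (op : R -> R -> R) :
  (forall k (V : set 'rV[R]_m) (f g : 'rV[R]_m -> R), open V -> Ck k V f -> Ck k V g ->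
     Ck k V (fun a => op (f a) (g a))) ->
  forall x f g, sm x f -> sm x g -> sm x (fun y => op (f y) (g y)).
Proof.
move=> Hop x f g smf smg c Ac cx.
have [V [oV Vx sV CV]] := smf c Ac cx; have [V' [oV' V'x sV' CV']] := smg c Ac cx.
have oI := openI oV oV'; exists (V `&` V'); split=> // [a [/sV]//|k].
have C1 : Ck k (V `&` V') (f \o icoord c) by apply: Ck_sub (CV k) => a [].
have C2 : Ck k (V `&` V') (g \o icoord c) by apply: Ck_sub (CV' k) => a [].
exact: Hop C1 C2.
Qed.

Lemma smD x f g : sm x f -> sm x g -> sm x (fun y => f y + g y).
Proof. by apply: (sm_op2 (op := +%R)) => *; exact: Ck_add. Qed.

Lemma smM x f g : sm x f -> sm x g -> sm x (fun y => f y * g y).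
Proof. by apply: (sm_op2 (op := *%R)) => *; exact: Ck_mul. Qed.

Lemma smN x f : sm x f -> sm x (fun y => - f y).
Proof.
move=> smf; have := smM (@sm_cst x (-1)) smf.
by under eq_fun do rewrite mulN1r.
Qed.

Lemma smB x f g : sm x f -> sm x g -> sm x (fun y => f y - g y).
Proof. by move=> smf smg; apply: smD => //; exact: smN. Qed.

Lemma sm_sum (I : Type) (r : seq I) (F : I -> X -> R) x :
  (forall i, sm x (F i)) -> sm x (fun y => \sum_(i <- r) F i y).
Proof.
move=> smF; elim: r => [|i r IH].
  by under eq_fun do rewrite big_nil; exact: sm_cst.
by under eq_fun do rewrite big_cons; exact: smD.
Qed.

Lemma sm_cfun c x i : A c -> cdom c x -> sm x (cfun c i).
Proof.
move=> Ac cx; apply: (sm_intro Ac cx (atlas_image_open Ac)); first by exists x.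
  by [].
move=> k; apply: (Ck_eq (atlas_image_open Ac)) (Ck_coord k _ i) => a ca.
by rewrite /= /cfun; have [_ ->] := coordK Ac ca.
Qed.

Lemma sm_differentiable c x f : A c -> cdom c x -> sm x f ->
  differentiable (f \o icoord c) (coord c x).
Proof.
by move=> Ac cx /(_ c Ac cx)[V [oV Vx _ CV]]; exact: Ck1_differentiable (CV 1%N).
Qed.

Lemma dvecE c x (y : 'rV[R]_m) f : A c -> cdom c x -> sm x f ->
  dvec A c (coord c x) y f = 'D_y (f \o icoord c) (coord c x).
Proof.
by move=> Ac cx smf; rewrite /dvec (atlas_icoordK gA)//; case: asboolP.
Qed.

Lemma dvec_out c x (y : 'rV[R]_m) f : A c -> cdom c x -> ~ sm x f ->
  dvec A c (coord c x) y f = 0.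
Proof.
by move=> Ac cx smf; rewrite /dvec (atlas_icoordK gA)//; case: asboolP.
Qed.

Lemma tangent_dvec c x (y : 'rV[R]_m) : A c -> cdom c x ->
  tangent A x (dvec A c (coord c x) y).
Proof. by move=> Ac cx; exists c, y. Qed.

Lemma tangent_out x v f : tangent A x v -> ~ sm x f -> v f = 0.
Proof. by move=> [c [y [Ac cx ->]]] smf; exact: dvec_out. Qed.

(** No smoothness of [f] is required: if one of the two functions is not smooth at [x], neither is
    the other, and tangent vectors send both to 0. *)
Lemma tan_eq W x v f g : tangent A x v -> opn W -> W x ->
  (forall y, W y -> f y = g y) -> v f = v g.
Proof.
move=> [c [y [Ac cx ->]]] oW Wx fg.
have [smf|nsmf] := pselect (sm x f); last first.
  rewrite !dvec_out// => smg; apply: nsmf; by apply: (sm_eq oW Wx _ smg) => z Wz; rewrite fg.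
rewrite !dvecE//; last exact: (sm_eq oW Wx fg smf).
apply: near_eq_derive.
have : nbhs (coord c x) (coord c @` (W `&` cdom c)).
  by apply: open_nbhs_nbhs; split; [exact: oW | exists x].
apply: filterS => _ [z [Wz cz] <-] /=.
by rewrite (atlas_icoordK gA)//; exact: fg.
Qed.

Lemma tan_cst x v r : tangent A x v -> v (fun=> r) = 0.
Proof.
move=> [c [y [Ac cx ->]]]; rewrite dvecE//; last exact: sm_cst.
exact: derive_cst.
Qed.

Lemma tanD x v f g : tangent A x v -> sm x f -> sm x g ->
  v (fun y => f y + g y) = v f + v g.
Proof.
move=> [c [y [Ac cx ->]]] smf smg; rewrite !dvecE//; last exact: smD.
by rewrite -deriveD//; apply: diff_derivable; exact: sm_differentiable.
Qed.

Lemma tanM x v f g : tangent A x v -> sm x f -> sm x g ->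
  v (fun y => f y * g y) = f x * v g + g x * v f.
Proof.
move=> [c [y [Ac cx ->]]] smf smg; rewrite !dvecE//; last exact: smM.
rewrite -[in X in X * _ + _](atlas_icoordK gA Ac cx).
rewrite -[in X in _ + X * _](atlas_icoordK gA Ac cx).
rewrite -[f _]/((f \o icoord c) _) -[g _]/((g \o icoord c) _).
by rewrite -deriveM//; apply: diff_derivable; exact: sm_differentiable.
Qed.

Lemma tanZ x v f r : tangent A x v -> sm x f -> v (fun y => r * f y) = r * v f.
Proof.
by move=> tv smf; rewrite (tanM tv)//; [rewrite (tan_cst _ tv) mulr0 addr0 | exact: sm_cst].
Qed.

Lemma tanN x v f : tangent A x v -> sm x f -> v (fun y => - f y) = - v f.
Proof.
by move=> tv smf; rewrite -mulN1r -(tanZ _ tv)//; congr v; apply/funext => y; rewrite mulN1r.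
Qed.

Lemma tanB x v f g : tangent A x v -> sm x f -> sm x g ->
  v (fun y => f y - g y) = v f - v g.
Proof. by move=> tv smf smg; rewrite (tanD tv)// ?(tanN tv)//; exact: smN. Qed.

Lemma tan_sum (I : Type) (r : seq I) (F : I -> X -> R) x v : tangent A x v ->
  (forall i, sm x (F i)) ->
  v (fun y => \sum_(i <- r) F i y) = \sum_(i <- r) v (F i).
Proof.
move=> tv smF; elim: r => [|i r IH].
  by under eq_fun do rewrite big_nil; rewrite big_nil (tan_cst _ tv).
under eq_fun do rewrite big_cons; rewrite big_cons (tanD tv)// ?IH//.
exact: sm_sum.
Qed.

Lemma tangent_pd c x i : A c -> cdom c x -> tangent A x (pd c i x).
Proof. rewrite pd.unlock; exact: tangent_dvec. Qed.

Lemma dvec_sum c x (y : 'rV[R]_m) f : A c -> cdom c x ->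
  dvec A c (coord c x) y f = \sum_(i < m) y 0 i * pd c i x f.
Proof.
move=> Ac cx; have [smf|nsmf] := pselect (sm x f); last first.
  by rewrite dvec_out// big1// => i _; rewrite pd.unlock dvec_out// mulr0.
rewrite dvecE// derive_partials; last exact: sm_differentiable.
by apply: eq_bigr => i _; rewrite pd.unlock dvecE.
Qed.

Lemma dvec_cfun c x (y : 'rV[R]_m) j : A c -> cdom c x ->
  dvec A c (coord c x) y (cfun c j) = y 0 j.
Proof.
move=> Ac cx; rewrite dvecE//; last exact: sm_cfun.
rewrite -[RHS](derive_coord (coord c x) y j); apply: near_eq_derive.
have : nbhs (coord c x) (coord c @` cdom c).
  by apply: open_nbhs_nbhs; split; [exact: atlas_image_open | exists x].
by apply: filterS => a ca; rewrite /= /cfun; have [_ ->] := coordK Ac ca.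
Qed.

Lemma pd_cfun c x i j : A c -> cdom c x -> pd c i x (cfun c j) = (i == j)%:R.
Proof. by move=> Ac cx; rewrite pd.unlock dvec_cfun// mxE eqxx eq_sym. Qed.

Lemma sm_pd c x i f : A c -> cdom c x -> sm x f -> sm x (fun y => pd c i y f).
Proof.
move=> Ac cx smf; have [V [oV Vx sV CV]] := smf c Ac cx.
apply: (sm_intro Ac cx oV Vx sV) => k.
have [_ /(_ i)[_ Ci]] := CV k.+1; apply: (Ck_eq oV _ Ci) => a Va.
have [ca caE] := coordK Ac (sV _ Va).
rewrite /= pd.unlock dvecE ?caE//.
by apply: (sm_intro Ac ca oV _ sV CV); rewrite caE.
Qed.

Lemma pd_comm c x i j f : A c -> cdom c x -> sm x f ->
  pd c i x (fun y => pd c j y f) = pd c j x (fun y => pd c i y f).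
Proof.
move=> Ac cx smf; have [V [oV Vx sV CV]] := smf c Ac cx.
have E k l : pd c k x (fun y => pd c l y f) =
    'D_(delta_mx 0 k) ('D_(delta_mx 0 l) (f \o icoord c)) (coord c x).
  rewrite pd.unlock dvecE//; last by have := sm_pd l Ac cx smf; rewrite pd.unlock.
  apply: near_eq_derive.
  have : nbhs (coord c x) V by exact: open_nbhs_nbhs.
  apply: filterS => a Va /=; have [ca caE] := coordK Ac (sV _ Va).
  rewrite dvecE ?caE//.
  by apply: (sm_intro Ac ca oV _ sV CV); rewrite caE.
by rewrite !E; exact: (schwarz _ _ oV Vx (CV 2%N)).
Qed.

Lemma pd_change c d x i f : A c -> A d -> cdom c x -> cdom d x -> sm x f ->
  pd d i x f = \sum_(j < m) pd d i x (cfun c j) * pd c j x f.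
Proof.
move=> Ac Ad cx dx smf; rewrite pd.unlock dvecE//.
rewrite (_ : 'D__ _ _ = 'D_(delta_mx 0 i)
   ((f \o icoord c) \o (fun a => coord c (icoord d a))) (coord d x)); last first.
  apply: near_eq_derive.
  have : nbhs (coord d x) (coord d @` (cdom d `&` cdom c)).
    by apply: open_nbhs_nbhs; split; [exact: (atlas_overlap gA) | exists x].
  by apply: filterS => _ [y [dy cy] <-] /=; rewrite !(atlas_icoordK gA).
rewrite derive_comp_row/= ?(atlas_icoordK gA Ad dx).
- apply: eq_bigr => j _; rewrite mulrC dvecE//; last exact: sm_cfun.
  by rewrite dvecE.
- exact: sm_differentiable.
- by move=> j; have := @sm_differentiable d x (cfun c j) Ad dx (sm_cfun j Ac cx).
Qed.

(** The vector may have been given through another chart, hence the change of coordinates; on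
    functions that are not smooth both sides are 0, so the expansion is an identity of operators. *)
Lemma tangent_app c x v f : A c -> cdom c x -> tangent A x v ->
  v f = \sum_(i < m) v (cfun c i) * pd c i x f.
Proof.
move=> Ac cx tv; have [smf|nsmf] := pselect (sm x f); last first.
  rewrite (tangent_out tv)// big1// => i _.
  by rewrite (tangent_out (tangent_pd i Ac cx))// mulr0.
case: tv => d [y [Ad dx ->]]; rewrite dvec_sum//.
under [RHS]eq_bigr => i _ do rewrite dvec_sum// mulr_suml.
rewrite exchange_big /=; apply: eq_bigr => j _.
rewrite (pd_change j Ac Ad cx dx smf) mulr_sumr.
by apply: eq_bigr => i _; rewrite mulrA.
Qed.

Lemma tangentE c x v : A c -> cdom c x -> tangent A x v ->
  v = dvec A c (coord c x) (\row_i v (cfun c i)).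
Proof.
move=> Ac cx tv; apply/funext => f; rewrite (tangent_app f Ac cx tv) dvec_sum//.
by apply: eq_bigr => i _; rewrite mxE.
Qed.

Lemma tangent_ext c x v w : A c -> cdom c x -> tangent A x v -> tangent A x w ->
  (forall i, v (cfun c i) = w (cfun c i)) -> v = w.
Proof.
move=> Ac cx tv tw vw; rewrite (tangentE Ac cx tv) (tangentE Ac cx tw).
by congr dvec; apply/rowP => i; rewrite !mxE.
Qed.

Lemma tangentP c x v : A c -> cdom c x ->
  (forall f, v f = \sum_(i < m) v (cfun c i) * pd c i x f) -> tangent A x v.
Proof.
move=> Ac cx vE; exists c, (\row_i v (cfun c i)); split=> //.
apply/funext => f; rewrite vE dvec_sum//.
by apply: eq_bigr => i _; rewrite mxE.
Qed.

Lemma tangentD x v w : tangent A x v -> tangent A x w -> tangent A x (v + w).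
Proof.
move=> tv tw; have [c [y [Ac cx _]]] := tv; apply: (tangentP Ac cx) => f.
have vwE g : (v + w) g = v g + w g by [].
rewrite vwE (tangent_app f Ac cx tv) (tangent_app f Ac cx tw) -big_split/=.
by apply: eq_bigr => i _; rewrite vwE mulrDl.
Qed.

Lemma tangentZ x v (r : R) : tangent A x v -> tangent A x (r *: v).
Proof.
move=> tv; have [c [y [Ac cx _]]] := tv; apply: (tangentP Ac cx) => f.
have rvE g : (r *: v) g = r * v g by [].
rewrite rvE (tangent_app f Ac cx tv) mulr_sumr.
by apply: eq_bigr => i _; rewrite rvE mulrA.
Qed.

Lemma tangentB x v w : tangent A x v -> tangent A x w -> tangent A x (v - w).
Proof. by move=> tv tw; rewrite -scaleN1r; apply/tangentD/tangentZ. Qed.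

Lemma tangent0 c x : A c -> cdom c x -> tangent A x 0.
Proof. by move=> Ac cx; apply: (tangentP Ac cx) => f; rewrite big1// => i _; rewrite mul0r. Qed.

Definition vfield (W : set X) (V : X -> tvec R X) := smooth_along A A id W V.

Lemma vfield_tan W V x : vfield W V -> W x -> tangent A x (V x).
Proof. by move=> vV Wx; have [] := vV x Wx. Qed.

Lemma sm_app c W V x f : A c -> cdom c x -> opn W -> W x -> vfield W V ->
  sm x f -> sm x (fun y => V y f).
Proof.
move=> Ac cx oW Wx vV smf.
have oI : opn (W `&` cdom c) by apply: opnI => //; exact: opn_cdom.
apply: (sm_eq oI _ (f := fun y => \sum_(i < m) V y (cfun c i) * pd c i y f)) => //.
  by move=> y [Wy cy]; rewrite (tangent_app f Ac cy)//; exact: vfield_tan Wy.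
apply: sm_sum => i; apply: smM; last exact: sm_pd.
by have [_ /(_ c Ac cx i)] := vV x Wx.
Qed.

(** Smoothness of the components in one chart gives it in all others, since the change of components
    has smooth coefficients. *)
Lemma vfield_intro c W V : A c -> opn W -> W `<=` cdom c ->
  (forall x, W x -> tangent A x (V x)) ->
  (forall x i, W x -> sm x (fun y => V y (cfun c i))) -> vfield W V.
Proof.
move=> Ac oW sW tV smV x Wx; split; first exact: tV.
move=> d Ad dx i.
apply: (sm_eq oW Wx (f := fun y => \sum_(j < m) V y (cfun c j) * pd c j y (cfun d i))).
  by move=> y Wy; rewrite (tangent_app (cfun d i) Ac (sW y Wy))//; exact: tV.
apply: sm_sum => j; apply: smM; first exact: smV.
by apply: sm_pd => //; [exact: sW | exact: sm_cfun].
Qed.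

Lemma bracketE V W x f : sm x f ->
  bracket A V W x f = V x (W^~ f) - W x (V^~ f).
Proof. by move=> smf; rewrite /bracket; case: asboolP. Qed.

(** Expanding both iterated derivatives in the chart, the terms with second derivatives of [f]
    cancel by [pd_comm], and a first order operator remains. *)
Lemma tangent_bracket c N V W x : A c -> cdom c x -> opn N -> N x ->
  vfield N V -> vfield N W -> tangent A x (bracket A V W x).
Proof.
move=> Ac cx oN Nx vV vW; apply: (tangentP Ac cx) => f.
have [smf|nsmf] := pselect (sm x f); last first.
  rewrite big1 => [|i _].
    by rewrite /bracket; case: asboolP.
  by rewrite (tangent_out (tangent_pd i Ac cx))// mulr0.
have oI : opn (N `&` cdom c) by apply: opnI => //; exact: opn_cdom.
have tV := vfield_tan vV Nx; have tW := vfield_tan vW Nx.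
have E (U U' : X -> tvec R X) : vfield N U -> vfield N U' ->
    U x (U'^~ f) = \sum_(i < m) (U' x (cfun c i) * U x (fun y => pd c i y f)
       + pd c i x f * U x (U'^~ (cfun c i))).
  move=> vU vU'; have tU := vfield_tan vU Nx.
  rewrite (tan_eq (g := fun y => \sum_(i < m) U' y (cfun c i) * pd c i y f) tU oI)//.
    have smi i : sm x (U'^~ (cfun c i)) by apply: (sm_app Ac cx oN) => //; exact: sm_cfun.
    have smj i : sm x (fun y => pd c i y f) by exact: sm_pd.
    rewrite (tan_sum _ tU) => [|i]; last exact: smM.
    by apply: eq_bigr => i _; rewrite (tanM tU).
  by move=> y [Ny cy]; rewrite (tangent_app f Ac cy)//; exact: vfield_tan Ny.
rewrite bracketE// E// E// -sumrB.
under eq_bigr => i _ do rewrite [V x _](tangent_app _ Ac cx tV) [W x (fun y => pd _ _ y f)](tangent_app _ Ac cx tW).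
rewrite [RHS](eq_bigr (fun i => V x (W^~ (cfun c i)) * pd c i x f -
    W x (V^~ (cfun c i)) * pd c i x f)); last first.
  by move=> i _; rewrite bracketE ?mulrBl//; exact: sm_cfun.
rewrite (eq_bigr (fun i =>
  (\sum_(j < m) W x (cfun c i) * (V x (cfun c j) * pd c j x (fun y => pd c i y f))
  - \sum_(j < m) V x (cfun c i) * (W x (cfun c j) * pd c j x (fun y => pd c i y f)))
  + (V x (W^~ (cfun c i)) * pd c i x f - W x (V^~ (cfun c i)) * pd c i x f))); last first.
  by move=> i _; rewrite -!mulr_sumr; ring.
(* The two double sums of second order terms differ by exchanging the indices. *)
rewrite big_split/= sumrB [X in _ - X]exchange_big/=.
rewrite (_ : _ - _ = 0) ?add0r//; apply/eqP; rewrite subr_eq0; apply/eqP.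
apply: eq_bigr => i _; apply: eq_bigr => j _.
by rewrite (pd_comm j i)//; ring.
Qed.

End AtlasTheory.

(** * The bundle of nonzero tangent vectors *)

Section SlitBundle.
Context (R : realType) (n : nat).

Lemma smooth_manifold_good_atlas (M : topologicalType) (A : set (chart R M n)) :
  smooth_manifold A -> good_atlas A.
Proof.
move=> [_ _ chA _ trA]; split.
- by move=> c x /chA[_ + _ _]; exact.
- move=> c d Ac Ad; have [[_ oc] cK _ cic] := chA c Ac; have [[od _] _ _ _] := chA d Ad.
  rewrite (_ : _ @` _ = coord c @` cdom c `&` icoord c @^-1` cdom d).
    exact: open_preimage_on.
  apply/seteqP; split=> [_ [x [cx dx] <-]|_ [[x cx <-]]] /=.
    by split; [exists x | rewrite cK].
  by rewrite cK// => dx; exists x.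
- exact: trA.
Qed.

Context (M : Type) (A : set (chart R M n)).
Hypothesis gA : good_atlas A.
Local Notation S := (slit_atlas A).
Local Notation tc := (tchart A (slitTM A)).

Lemma lsubmx_continuous (a : 'rV[R]_(n + n)) : {for a, continuous (@lsubmx R 1 n n)}.
Proof.
apply: continuous_row => j.
have -> : (fun b : 'rV[R]_(n + n) => lsubmx b 0 j) = (fun b => b 0 (lshift n j)).
  by apply/funext => b; rewrite mxE.
exact: coord_continuous.
Qed.

Lemma rsubmx_continuous (a : 'rV[R]_(n + n)) : {for a, continuous (@rsubmx R 1 n n)}.
Proof.
apply: continuous_row => j.
have -> : (fun b : 'rV[R]_(n + n) => rsubmx b 0 j) = (fun b => b 0 (rshift n j)).
  by apply/funext => b; rewrite mxE.
exact: coord_continuous.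
Qed.

Lemma Ck_lsubmx k (V : set 'rV[R]_(n + n)) j : Ck k V (fun z => lsubmx z 0 j).
Proof. by under eq_fun do rewrite mxE; exact: Ck_coord. Qed.

Lemma Ck_rsubmx k (V : set 'rV[R]_(n + n)) j : Ck k V (fun z => rsubmx z 0 j).
Proof. by under eq_fun do rewrite mxE; exact: Ck_coord. Qed.

Lemma open_lsub_rsub_neq0 (V : set 'rV[R]_n) : open V ->
  open [set z : 'rV[R]_(n + n) | V (lsubmx z) /\ rsubmx z <> 0].
Proof.
move=> oV; rewrite (_ : [set z | _] =
  (@lsubmx R 1 n n @^-1` V) `&` (@rsubmx R 1 n n @^-1` ~` [set 0])) //.
apply: openI; apply: open_comp => //.
- by move=> z _; exact: lsubmx_continuous.
- by move=> z _; exact: rsubmx_continuous.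
- apply: closed_openC; apply: accessible_closed_set1.
  by apply: hausdorff_accessible; exact: norm_hausdorff.
Qed.

Lemma dvec_eq0 c x (y : 'rV[R]_n) : A c -> cdom c x ->
  dvec A c (coord c x) y = 0 -> y = 0.
Proof.
move=> Ac cx y0; apply/rowP => j; rewrite -(dvec_cfun gA y j Ac cx) y0 mxE.
by [].
Qed.

Lemma dvec0 c x : A c -> cdom c x -> dvec A c (coord c x) 0 = 0.
Proof.
move=> Ac cx; apply/funext => f; rewrite dvec_sum// big1// => i _.
by rewrite mxE mul0r.
Qed.

Lemma tchart_coordK c u : A c -> cdom (tc c) u -> icoord (tc c) (coord (tc c) u) = u.
Proof.
case: u => x v Ac [[/= tv v0] cx]; rewrite /= row_mxKl row_mxKr.
by rewrite (atlas_icoordK gA)// -(tangentE gA Ac cx tv).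
Qed.

Lemma tchart_icoord c a (y : 'rV[R]_n) : A c -> (coord c @` cdom c) a -> y <> 0 ->
  cdom (tc c) (icoord (tc c) (row_mx a y)) /\
  coord (tc c) (icoord (tc c) (row_mx a y)) = row_mx a y.
Proof.
move=> Ac [x cx <-] y0 /=; rewrite row_mxKl row_mxKr (atlas_icoordK gA)//; split.
  split=> //; split=> /=; first exact: tangent_dvec.
  by move=> /(dvec_eq0 Ac cx).
by congr row_mx; apply/rowP => j; rewrite mxE dvec_cfun.
Qed.

Lemma tchart_overlap c d : A c -> A d ->
  coord (tc c) @` (cdom (tc c) `&` cdom (tc d)) =
  [set z | (coord c @` (cdom c `&` cdom d)) (lsubmx z) /\ rsubmx z <> 0].
Proof.
move=> Ac Ad; apply/seteqP; split=> [_ [[x v] [[[/= tv v0] cx] [_ /= dx]] <-]|z [[x [cx dx] xz] z0]] /=.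
  rewrite row_mxKl row_mxKr; split; first by exists x.
  move=> /= y0; apply: v0 => /=; have tv' : tangent A x v := tv.
  rewrite (tangentE gA Ac cx tv') y0.
  exact: dvec0.
have ca : (coord c @` cdom c) (lsubmx z) by exists x.
have [] := tchart_icoord Ac ca z0; rewrite hsubmxK => cz zE.
exists (icoord (tc c) z); last exact: zE.
split=> //; case: cz => sz _; split=> //=.
by rewrite -xz (atlas_icoordK gA).
Qed.

Lemma tchart_image c : A c -> coord (tc c) @` cdom (tc c) =
  [set z | (coord c @` cdom c) (lsubmx z) /\ rsubmx z <> 0].
Proof. by move=> Ac; have := tchart_overlap Ac Ac; rewrite !setIid. Qed.

(** The base part of a transition map is the one of M; the fibre part is linear in the fibre
    coordinates, with the Jacobian of the base transition as coefficients. *)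
Lemma slit_good_atlas : good_atlas S.
Proof.
split.
- by move=> _ u [c Ac <-]; exact: tchart_coordK.
- move=> _ _ [c Ac <-] [d Ad <-]; rewrite tchart_overlap//.
  by apply: open_lsub_rsub_neq0; exact: (atlas_overlap gA).
- move=> _ _ [c Ac <-] [d Ad <-] j k; rewrite tchart_overlap//.
  have oV := atlas_overlap gA Ac Ad; have oW := open_lsub_rsub_neq0 oV.
  set W := [set z | _] in oW *.
  rewrite -(fintype.splitK j); case: (fintype.split j) => i /=.
    under eq_fun do rewrite row_mxEl.
    by apply: (Ck_comp oW oV (g := @lsubmx R 1 n n) _ (atlas_transition gA Ac Ad i k)) => [z []|l] //; exact: Ck_lsubmx.
  apply: (Ck_eq oW (f := fun z => \sum_(l < n) rsubmx z 0 l *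
      (fun a => pd A c l (icoord c a) (cfun d i)) (lsubmx z))).
    move=> z [[x [cx dx] xz] z0]; rewrite row_mxEr mxE -xz dvec_sum//.
    by rewrite (atlas_icoordK gA).
  apply: Ck_sum => // l; apply: Ck_mul => //; first exact: Ck_rsubmx.
  have CP : Ck k (coord c @` (cdom c `&` cdom d))
      (fun a => pd A c l (icoord c a) (cfun d i)).
    have [_ /(_ l)[_ Cl]] := atlas_transition gA Ac Ad i k.+1.
    apply: (Ck_eq oV _ Cl) => _ [x [cx dx] <-].
    by rewrite (atlas_icoordK gA)// pd.unlock dvecE//; exact: sm_cfun.
  by apply: (Ck_comp oW oV (g := @lsubmx R 1 n n) _ CP) => [z []|l'] //; exact: Ck_lsubmx.
Qed.

End SlitBundle.

Lemma derive1_line (R : realType) (m : nat) (F : R -> R) (f : 'rV[R]_m -> R)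
    (a v : 'rV[R]_m) : (forall h, F h = f (h *: v + a)) -> F^`()%classic 0 = 'D_v f a.
Proof.
move=> E; rewrite /derive1 /derive.
rewrite (_ : (fun h => h^-1 *: (F (h + 0) - F 0)) =
  (fun h => h^-1 *: ((f \o shift a) (h *: v) - f a)))//.
by apply/funext => h; rewrite !E addr0 scale0r add0r.
Qed.

(** * Coordinate fields, vertical lift and projection in a bundle chart *)

Section SlitFields.
Context (R : realType) (n : nat) (M : Type) (A : set (chart R M n)).
Hypothesis gA : good_atlas A.
Local Notation S := (slit_atlas A).
Local Notation sm := (smooth_at S).
Let gS : good_atlas S := slit_good_atlas gA.

Variable c : chart R M n.
Hypothesis Ac : A c.
Local Notation tc := (tchart A (slitTM A) c).
Local Notation xc i := (cfun tc (lshift n i)).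
Local Notation yc i := (cfun tc (rshift n i)).

Lemma slit_atlas_tchart : S tc. Proof. by exists c. Qed.
Let Sc := slit_atlas_tchart.

Definition Xd (i : 'I_n) (u : TMT R M) : tvec R (TMT R M) := pd S tc (lshift n i) u.
Definition Yd (i : 'I_n) (u : TMT R M) : tvec R (TMT R M) := pd S tc (rshift n i) u.

Lemma xcE i : xc i = cfun c i \o fst.
Proof. by apply/funext => u; rewrite /cfun /= row_mxEl. Qed.

Lemma ycE i : yc i = (fun u => u.2 (cfun c i)).
Proof. by apply/funext => u; rewrite /cfun /= row_mxEr mxE. Qed.

Lemma sm_snd_cfun u i : cdom tc u -> sm u (fun u => u.2 (cfun c i)).
Proof. by move=> cu; rewrite -ycE; exact: sm_cfun. Qed.

Section Point.
Variable u : TMT R M.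
Hypothesis cu : cdom tc u.
Let cx : cdom c u.1. Proof. by case: cu. Qed.
Let tu : tangent A u.1 u.2. Proof. by case: cu => -[]. Qed.

Lemma sm_fst f : smooth_at A u.1 f -> sm u (f \o fst).
Proof.
move=> /(_ c Ac cx)[V [oV Vx sV CV]].
have oW := open_lsub_rsub_neq0 oV.
have Wi : [set z : 'rV[R]_(n + n) | V (lsubmx z) /\ rsubmx z <> 0] `<=` coord tc @` cdom tc.
  by move=> z [Vz z0]; rewrite (tchart_image gA Ac); split=> //; exact: sV.
apply: (sm_intro gS Sc cu oW _ Wi) => [|k].
  have : (coord tc @` cdom tc) (coord tc u) by exists u.
  by rewrite (tchart_image gA Ac) => -[_ u0]; split=> //=; rewrite row_mxKl.
by apply: (Ck_comp oW oV (g := @lsubmx R 1 n n) _ (CV k)) => [z []|l] //; exact: Ck_lsubmx.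
Qed.

(** Restricting to the slice where the fibre coordinates keep their values at [u] recovers [f]. This
    is needed because [rho_at] must also send functions that are not smooth to 0. *)
Lemma sm_fstK f : sm u (f \o fst) -> smooth_at A u.1 f.
Proof.
move=> /(_ tc Sc cu)[V [oV Vu sV CV]].
pose y0 : 'rV[R]_n := rsubmx (coord tc u).
pose g (a : 'rV[R]_n) : 'rV[R]_(n + n) := row_mx a y0.
have Cg k (W : set 'rV[R]_n) j : Ck k W (fun a => g a 0 j).
  rewrite -(fintype.splitK j); case: (fintype.split j) => i /=.
    by under eq_fun do rewrite row_mxEl; exact: Ck_coord.
  by under eq_fun do rewrite row_mxEr; exact: Ck_cst.
have gu : g (coord c u.1) = coord tc u by rewrite /g /y0 /= row_mxKr.
have oW : open (g @^-1` V).
  apply: open_comp => // a _; apply: continuous_row => j.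
  by have [+ _] := Cg 0%N setT j; exact.
apply: (sm_intro gA Ac cx oW) => [|a Va|k] /=.
- by rewrite gu.
- by have := sV _ Va; rewrite (tchart_image gA Ac) => -[]; rewrite row_mxKl.
- have := @Ck_comp R _ _ k (g @^-1` V) V _ g oW oV (fun a => id) (CV k) (Cg k _).
  by congr Ck; apply/funext => a /=; rewrite row_mxKl.
Qed.

Lemma slit_app v f : tangent S u v ->
  v f = \sum_(i < n) v (xc i) * Xd i u f + \sum_(i < n) v (yc i) * Yd i u f.
Proof. by move=> tv; rewrite (tangent_app gS f Sc cu tv) big_split_ord. Qed.

Lemma slit_ext v w : tangent S u v -> tangent S u w ->
  (forall i, v (xc i) = w (xc i)) -> (forall i, v (yc i) = w (yc i)) -> v = w.
Proof.
move=> tv tw xvw yvw; apply/funext => f; rewrite !slit_app//.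
by congr (_ + _); apply: eq_bigr => i _; rewrite ?xvw ?yvw.
Qed.

Lemma Xd_xc i j : Xd i u (xc j) = (i == j)%:R.
Proof. by rewrite /Xd (pd_cfun gS)// eq_lshift. Qed.
Lemma Xd_yc i j : Xd i u (yc j) = 0.
Proof. by rewrite /Xd (pd_cfun gS)// eq_lrshift. Qed.
Lemma Yd_xc i j : Yd i u (xc j) = 0.
Proof. by rewrite /Yd (pd_cfun gS)// eq_rlshift. Qed.
Lemma Yd_yc i j : Yd i u (yc j) = (i == j)%:R.
Proof. by rewrite /Yd (pd_cfun gS)// eq_rshift. Qed.

Lemma tangent_Xd i : tangent S u (Xd i u). Proof. exact: tangent_pd. Qed.
Lemma tangent_Yd i : tangent S u (Yd i u). Proof. exact: tangent_pd. Qed.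

Lemma sm_Xd i f : sm u f -> sm u (fun u' => Xd i u' f).
Proof. exact: (sm_pd gS). Qed.
Lemma sm_Yd i f : sm u f -> sm u (fun u' => Yd i u' f).
Proof. exact: (sm_pd gS). Qed.

Lemma pd_fst i f : pd S tc i u (f \o fst) =
  if fintype.split i is inl j then pd A c j u.1 f else 0.
Proof.
have [smf|nsmf] := pselect (smooth_at A u.1 f); last first.
  have nsmf' : ~ sm u (f \o fst) by move=> /sm_fstK.
  rewrite pd.unlock dvec_out//; case: (fintype.split i) => // j.
  by rewrite dvec_out.
rewrite pd.unlock dvecE//; last exact: sm_fst.
rewrite (_ : _ \o icoord tc = (f \o icoord c) \o @lsubmx R 1 n n) //.
have dl j : differentiable (fun b : 'rV[R]_(n + n) => lsubmx b 0 j) (coord tc u).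
  rewrite (_ : (fun b => _) = (fun b : 'rV[R]_(n + n) => b 0 (lshift n j))).
    exact: differentiable_coord.
  by apply/funext => b; rewrite mxE.
have df : differentiable (f \o icoord c) (lsubmx (coord tc u)).
  have -> : lsubmx (coord tc u) = coord c u.1 by rewrite /= row_mxKl.
  exact: (sm_differentiable Ac cx smf).
rewrite (derive_comp_row _ df dl).
have E j : 'D_(delta_mx 0 i) (fun b : 'rV[R]_(n + n) => lsubmx b 0 j) (coord tc u) =
    (lshift n j == i)%:R.
  rewrite (_ : (fun b => _) = (fun b : 'rV[R]_(n + n) => b 0 (lshift n j))).
    by rewrite derive_coord mxE eqxx.
  by apply/funext => b; rewrite mxE.
under eq_bigr do rewrite E /= row_mxKl.
case: fintype.splitP => j /= ij.
  rewrite (bigD1 j)//= big1 => [|l lj].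
    by rewrite addr0 -val_eqE /= ij eqxx mulr1 dvecE.
  by rewrite -val_eqE /= ij val_eqE (negbTE lj) mulr0.
rewrite big1 // => l _; rewrite -val_eqE /= ij.
by rewrite ltn_eqF ?mulr0// (leq_trans (ltn_ord l))// leq_addr.
Qed.

Lemma rho_at_cfun v i : rho_at v (cfun c i) = v (xc i).
Proof. by rewrite xcE. Qed.

Lemma tangent_rho_at v : tangent S u v -> tangent A u.1 (rho_at v).
Proof.
move=> tv; apply: (tangentP gA Ac cx) => f.
rewrite {1}/rho_at slit_app// [X in _ + X]big1 => [|i _].
  rewrite addr0; apply: eq_bigr => i _; rewrite rho_at_cfun /Xd pd_fst.
  by rewrite -[lshift _ _]/(unsplit (inl _)) unsplitK.
rewrite /Yd pd_fst.
by rewrite -[rshift _ _]/(unsplit (inr _)) unsplitK mulr0.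
Qed.

Lemma gamma_atE w : tangent A u.1 w ->
  gamma_at A u w = dvec S tc (coord tc u) (row_mx 0 (\row_i w (cfun c i))).
Proof.
move=> tw; apply/funext => F; rewrite /gamma_at /dvec (tchart_coordK gA)//.
case: asboolP => // _; apply: derive1_line => h /=.
rewrite scale_row_mx scaler0 add_row_mx add0r row_mxKl row_mxKr (atlas_icoordK gA)//.
congr (F (_, _)).
rewrite (_ : _ + _ = \row_i (u.2 + h *: w) (cfun c i)).
  by apply: (tangentE gA Ac cx); apply: (tangentD gA) => //; exact: (tangentZ gA).
by apply/rowP => i; rewrite !mxE addrC.
Qed.

Lemma tangent_gamma_at w : tangent A u.1 w -> tangent S u (gamma_at A u w).
Proof. by move=> tw; rewrite gamma_atE//; exact: tangent_dvec. Qed.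

Lemma gamma_at_xc w i : tangent A u.1 w -> gamma_at A u w (xc i) = 0.
Proof. by move=> tw; rewrite gamma_atE// (dvec_cfun gS)// row_mxEl mxE. Qed.

Lemma gamma_at_yc w i : tangent A u.1 w -> gamma_at A u w (yc i) = w (cfun c i).
Proof. by move=> tw; rewrite gamma_atE// (dvec_cfun gS)// row_mxEr mxE. Qed.

End Point.

Section Fields.
Variable W : set (TMT R M).
Hypotheses (oW : opn S W) (sW : W `<=` cdom tc).

Let cx u : W u -> cdom c u.1. Proof. by move=> /sW[]. Qed.

Lemma pivf_tan Z u : pivf A W Z -> W u -> tangent A u.1 (Z u).
Proof. by move=> ZW Wu; have [] := ZW u Wu. Qed.

Lemma pivf_sm Z u i : pivf A W Z -> W u -> sm u (fun u' => Z u' (cfun c i)).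
Proof. by move=> ZW Wu; have [_ +] := ZW u Wu; apply => //; exact: cx. Qed.

Lemma pivf_intro Z : (forall u, W u -> tangent A u.1 (Z u)) ->
  (forall u i, W u -> sm u (fun u' => Z u' (cfun c i))) -> pivf A W Z.
Proof.
move=> tZ smZ u Wu; split; first exact: tZ.
move=> d Ad du i.
apply: (sm_eq gS oW Wu (f := fun u' => \sum_(j < n) Z u' (cfun c j) *
    ((fun x => pd A c j x (cfun d i)) \o fst) u')).
  by move=> u' Wu'; rewrite (tangent_app gA (cfun d i) Ac (cx Wu'))//; exact: tZ.
apply: (sm_sum gS) => j; apply: (smM) => //; first exact: smZ.
apply: (sm_fst (sW Wu)); apply: (sm_pd gA) => //; first exact: cx.
exact: (sm_cfun gA).
Qed.

Lemma vf_tan X u : vf A W X -> W u -> tangent S u (X u).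
Proof. by move=> XW Wu; have [] := XW u Wu. Qed.

Lemma vf_sm X u f : vf A W X -> W u -> sm u f -> sm u (fun u' => X u' f).
Proof. by move=> XW Wu; apply: (sm_app gS Sc (sW Wu) oW Wu). Qed.

Lemma vf_intro X : (forall u, W u -> tangent S u (X u)) ->
  (forall u i, W u -> sm u (fun u' => X u' (xc i))) ->
  (forall u i, W u -> sm u (fun u' => X u' (yc i))) -> vf A W X.
Proof.
move=> tX smx smy; apply: (vfield_intro gS Sc oW sW tX) => u i Wu.
by rewrite -(fintype.splitK i); case: (fintype.split i) => j; [exact: smx | exact: smy].
Qed.

Lemma pivf_eta : pivf A W (@eta R M).
Proof.
apply: pivf_intro => [u /sW[[]]//|u i Wu].
by apply: sm_snd_cfun; exact: sW.
Qed.

Lemma rho_pivf X : vf A W X -> pivf A W (rho X).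
Proof.
move=> XW; apply: pivf_intro => [u Wu|u i Wu].
  by apply: (tangent_rho_at (sW Wu)); exact: vf_tan.
rewrite (_ : (fun u' => _) = (fun u' => X u' (xc i))); last by rewrite xcE.
by apply: vf_sm => //; apply: (sm_cfun gS) => //; exact: sW.
Qed.

Lemma gamma_vf Z : pivf A W Z -> vf A W (gamma A Z).
Proof.
move=> ZW; apply: vf_intro => [u Wu|u i Wu|u i Wu].
- by apply: (tangent_gamma_at (sW Wu)); exact: pivf_tan.
- apply: (sm_eq gS oW Wu (f := fun=> 0)); last exact: (sm_cst gS).
  by move=> u' Wu'; rewrite /gamma gamma_at_xc//; [exact: sW | exact: pivf_tan].
- apply: (sm_eq gS oW Wu (f := fun u' => Z u' (cfun c i))); last exact: pivf_sm.
  by move=> u' Wu'; rewrite /gamma gamma_at_yc//; [exact: sW | exact: pivf_tan].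
Qed.

Lemma lie_vf X Y : vf A W X -> vf A W Y -> vf A W (lie A X Y).
Proof.
have smb V V' u j : vf A W V -> vf A W V' -> W u ->
    sm u (fun u' => V u' (V'^~ (cfun tc j))).
  move=> VW V'W Wu; apply: vf_sm => //; apply: vf_sm => //.
  by apply: (sm_cfun gS) => //; exact: sW.
move=> XW YW; apply: (vfield_intro gS Sc oW sW) => [u Wu|u j Wu].
  by apply: (tangent_bracket gS Sc (sW Wu) oW Wu).
apply: (sm_eq gS oW Wu (f := fun u' => X u' (Y^~ (cfun tc j)) - Y u' (X^~ (cfun tc j)))).
  move=> u' Wu'; rewrite /lie bracketE//.
  by apply: (sm_cfun gS) => //; exact: sW.
by apply: (smB gS); [exact: (smb X Y) | exact: (smb Y X)].
Qed.

Lemma lieE X Y u f : sm u f -> lie A X Y u f = X u (Y^~ f) - Y u (X^~ f).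
Proof. exact: bracketE. Qed.

Lemma vf_eq X u f g : vf A W X -> W u -> (forall u', W u' -> f u' = g u') ->
  X u f = X u g.
Proof. by move=> XW Wu; apply: (tan_eq gS _ oW Wu); exact: vf_tan. Qed.

End Fields.

Lemma vf_sub (W W' : set (TMT R M)) X : W' `<=` W -> vf A W X -> vf A W' X.
Proof. by move=> sW XW u /sW; exact: XW. Qed.

Lemma pivf_sub (W W' : set (TMT R M)) Z : W' `<=` W -> pivf A W Z -> pivf A W' Z.
Proof. by move=> sW XW u /sW; exact: XW. Qed.

End SlitFields.

(** * The Barthel and Berwald connections in a chart *)

Section SprayCalculus.
Context (R : realType) (n : nat) (M : Type) (A : set (chart R M n)).
Hypothesis gA : good_atlas A.
Local Notation S := (slit_atlas A).
Local Notation sm := (smooth_at S).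
Let gS : good_atlas S := slit_good_atlas gA.

Variable c : chart R M n.
Hypothesis Ac : A c.
Local Notation tc := (tchart A (slitTM A) c).
Local Notation xc i := (cfun tc (lshift n i)).
Local Notation yc i := (cfun tc (rshift n i)).
Local Notation Xd := (Xd A c).
Local Notation Yd := (Yd A c).
Let Sc : S tc := slit_atlas_tchart Ac.

Variable G : field R M.

(* In the chart, G = y^i d/dx^i - 2 G^i d/dy^i. *)
Definition spray_coef (i : 'I_n) (u : TMT R M) : R := - 2^-1 * G u (yc i).
Definition barthel_coef (i j : 'I_n) (u : TMT R M) : R := Yd j u (spray_coef i).
Definition berwald_coef (i j k : 'I_n) (u : TMT R M) : R :=
  Yd k u (barthel_coef i j).
Local Notation g := spray_coef.
Local Notation N := barthel_coef.
Local Notation Gam := berwald_coef.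

Hypothesis GV : vf A (cdom tc) G.
Hypothesis Gx : forall u i, cdom tc u -> G u (xc i) = u.2 (cfun c i).

Let oU : opn S (cdom tc). Proof. exact: (opn_cdom gS). Qed.
Let sU : cdom tc `<=` cdom tc. Proof. by []. Qed.

Lemma sm_spray_coef i u : cdom tc u -> sm u (g i).
Proof.
move=> cu; apply: (smM (f := fun=> - 2^-1) (g := fun u => G u (yc i))).
  exact: (sm_cst gS).
by apply: (vf_sm gA Ac oU sU GV cu); exact: (sm_cfun gS).
Qed.

Lemma sm_barthel_coef i j u : cdom tc u -> sm u (N i j).
Proof. by move=> cu; apply: (sm_Yd gA Ac cu); exact: sm_spray_coef. Qed.

Lemma sm_berwald_coef i j k u : cdom tc u -> sm u (Gam i j k).
Proof. by move=> cu; apply: (sm_Yd gA Ac cu); exact: sm_barthel_coef. Qed.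

Lemma G_yc i u : G u (yc i) = - 2 * g i u.
Proof. by rewrite /g; field. Qed.

Section OnOpen.
Variable W : set (TMT R M).
Hypotheses (oW : opn S W) (sW : W `<=` cdom tc).

Let GW : vf A W G. Proof. exact: vf_sub GV. Qed.

Lemma J_vf X : vf A W X -> vf A W (J A X).
Proof. by move=> XW; apply: (gamma_vf gA Ac oW sW); exact: (rho_pivf gA Ac oW sW). Qed.

Lemma J_xc X u i : vf A W X -> W u -> J A X u (xc i) = 0.
Proof.
move=> XW Wu; apply: (gamma_at_xc gA Ac (sW Wu)).
exact: (tangent_rho_at gA Ac (sW Wu) (vf_tan XW Wu)).
Qed.

Lemma J_yc X u i : vf A W X -> W u -> J A X u (yc i) = X u (xc i).
Proof.
move=> XW Wu; rewrite /J /gamma (gamma_at_yc gA Ac (sW Wu)); first exact: (rho_at_cfun A).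
exact: (tangent_rho_at gA Ac (sW Wu) (vf_tan XW Wu)).
Qed.

Lemma gamma_xc Z u i : pivf A W Z -> W u -> gamma A Z u (xc i) = 0.
Proof. by move=> ZW Wu; apply: (gamma_at_xc gA Ac (sW Wu)); exact: (pivf_tan ZW Wu). Qed.

Lemma gamma_yc Z u i : pivf A W Z -> W u -> gamma A Z u (yc i) = Z u (cfun c i).
Proof. by move=> ZW Wu; apply: (gamma_at_yc gA Ac (sW Wu)); exact: (pivf_tan ZW Wu). Qed.

Lemma gamma_app Z u f : pivf A W Z -> W u ->
  gamma A Z u f = \sum_(j < n) Z u (cfun c j) * Yd j u f.
Proof.
move=> ZW Wu; have tg := vf_tan (gamma_vf gA Ac oW sW ZW) Wu.
rewrite (slit_app gA Ac (sW Wu) f tg) [X in X + _]big1 => [|i _].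
  by rewrite add0r; apply: eq_bigr => i _; rewrite gamma_yc.
by rewrite gamma_xc// mul0r.
Qed.

Lemma J_app X u f : vf A W X -> W u ->
  J A X u f = \sum_(j < n) X u (xc j) * Yd j u f.
Proof.
move=> XW Wu; rewrite /J gamma_app//; last exact: (rho_pivf gA Ac oW sW).
by apply: eq_bigr => i _; rewrite /rho (rho_at_cfun A).
Qed.

Lemma vf_cst0 X u f : vf A W X -> W u -> (forall u', W u' -> f u' = 0) -> X u f = 0.
Proof.
move=> XW Wu f0; rewrite (vf_eq gA oW (g := fun=> 0) XW Wu)//.
by apply: (tan_cst gS); exact: (vf_tan XW Wu).
Qed.

Lemma sm_xc u i : W u -> sm u (xc i).
Proof. by move=> Wu; apply: (sm_cfun gS) => //; exact: sW. Qed.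

Lemma sm_yc u i : W u -> sm u (yc i).
Proof. by move=> Wu; apply: (sm_cfun gS) => //; exact: sW. Qed.

Lemma barthel_tan X u : vf A W X -> W u -> tangent S u (barthel A G X u).
Proof.
move=> XW Wu; apply: (tangentB gS).
  by apply: (vf_tan _ Wu); apply: (lie_vf gA Ac oW sW) => //; exact: J_vf.
by apply: (vf_tan _ Wu); apply: J_vf; exact: (lie_vf gA Ac oW sW).
Qed.

(** Together with [barthel_yc]: the matrix of [barthel] is block triangular with diagonal blocks 1
    and -1, so [hproj] and [vproj] are complementary projectors that share the off-diagonal block
    N. *)
Lemma barthel_xc X u i : vf A W X -> W u -> barthel A G X u (xc i) = X u (xc i).
Proof.
move=> XW Wu; have XG := lie_vf gA Ac oW sW XW GW; have JX := J_vf XW.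
rewrite (_ : barthel A G X u (xc i) =
  lie A (J A X) G u (xc i) - J A (lie A X G) u (xc i)) //.
rewrite J_xc// subr0 lieE; last exact: sm_xc.
rewrite [X in _ - X](vf_cst0 GW Wu) => [|u' Wu']; last by rewrite J_xc.
rewrite subr0 -(J_yc i XW Wu); apply: (vf_eq gA oW JX Wu) => u' Wu'.
by rewrite Gx ?ycE//; exact: sW.
Qed.

Lemma barthel_yc X u i : vf A W X -> W u -> barthel A G X u (yc i) =
  - X u (yc i) - 2 * \sum_(j < n) N i j u * X u (xc j).
Proof.
move=> XW Wu; have XG := lie_vf gA Ac oW sW XW GW; have JX := J_vf XW.
rewrite (_ : barthel A G X u (yc i) =
  lie A (J A X) G u (yc i) - J A (lie A X G) u (yc i)) //.
rewrite J_yc// !lieE; [|exact: sm_xc|exact: sm_yc].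
rewrite (vf_eq gA oW (g := fun u' => - 2 * g i u') JX Wu) => [|u' _]; last exact: G_yc.
(* The derivative along [G] of the x-components of [X] occurs in both brackets and cancels. *)
rewrite (vf_eq gA oW (g := fun u' => X u' (xc i)) GW Wu) => [|u' Wu']; last by rewrite J_yc.
rewrite (vf_eq gA oW (g := yc i) XW Wu) => [|u' Wu']; last by rewrite Gx ?ycE//; exact: sW.
rewrite (tanZ gS _ (vf_tan JX Wu)); last exact/sm_spray_coef/sW.
rewrite J_app//; under [in RHS]eq_bigr do rewrite mulrC.
by rewrite -/(N i _ u); ring.
Qed.

Lemma hproj_tan X u : vf A W X -> W u -> tangent S u (hproj A G X u).
Proof.
move=> XW Wu; apply: (tangentZ gS); apply: (tangentD gS); first exact: (vf_tan XW Wu).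
exact: barthel_tan.
Qed.

Lemma vproj_tan X u : vf A W X -> W u -> tangent S u (vproj A G X u).
Proof.
move=> XW Wu; apply: (tangentZ gS); apply: (tangentB gS); first exact: (vf_tan XW Wu).
exact: barthel_tan.
Qed.

Lemma hproj_xc X u i : vf A W X -> W u -> hproj A G X u (xc i) = X u (xc i).
Proof.
move=> XW Wu.
rewrite (_ : hproj _ _ _ _ _ = 2^-1 * (X u (xc i) + barthel A G X u (xc i)))//.
by rewrite barthel_xc//; field.
Qed.

Lemma hproj_yc X u i : vf A W X -> W u ->
  hproj A G X u (yc i) = - \sum_(j < n) N i j u * X u (xc j).
Proof.
move=> XW Wu.
rewrite (_ : hproj _ _ _ _ _ = 2^-1 * (X u (yc i) + barthel A G X u (yc i)))//.
by rewrite barthel_yc//; field.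
Qed.

Lemma vproj_xc X u i : vf A W X -> W u -> vproj A G X u (xc i) = 0.
Proof.
move=> XW Wu.
rewrite (_ : vproj _ _ _ _ _ = 2^-1 * (X u (xc i) - barthel A G X u (xc i)))//.
by rewrite barthel_xc//; field.
Qed.

Lemma vproj_yc X u i : vf A W X -> W u ->
  vproj A G X u (yc i) = X u (yc i) + \sum_(j < n) N i j u * X u (xc j).
Proof.
move=> XW Wu.
rewrite (_ : vproj _ _ _ _ _ = 2^-1 * (X u (yc i) - barthel A G X u (yc i)))//.
by rewrite barthel_yc//; field.
Qed.

End OnOpen.

(** [beta] is a choice, so existence of an admissible value is shown first. The components of any
    admissible value are then forced, because [hproj] sees only the x-components of its argument,
    and these are prescribed by [rho_at]. Only the value of [Z] at [u] matters. *)
Lemma beta_spec Z u : cdom tc u -> tangent A u.1 (Z u) ->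
  [/\ tangent S u (beta A G Z u),
      forall i, beta A G Z u (xc i) = Z u (cfun c i) &
      forall i, beta A G Z u (yc i) = - \sum_(j < n) N i j u * Z u (cfun c j)].
Proof.
move=> cu tZ; have cx : cdom c u.1 by case: cu.
pose P := [set v | (exists W Y, [/\ open_slit A W, W u, vf A W Y & v = hproj A G Y u])
  /\ rho_at v = Z u].
have oslit : open_slit A (cdom tc) by split=> // u' [].
(* The witness is [hproj] of a field with constant components; its y-components do not affect the
   result and are set to 0. *)
pose z : 'rV[R]_(n + n) := row_mx (\row_i Z u (cfun c i)) 0.
pose Y : field R M := fun u' => dvec S tc (coord tc u') z.
have YV : vf A (cdom tc) Y.
  apply: (vf_intro gA Ac oU sU) => [u' cu'|u' i cu'|u' i cu'].
  - exact: tangent_dvec.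
  - apply: (sm_eq gS oU cu' (f := fun=> z 0 (lshift n i))); last exact: (sm_cst gS).
    by move=> u1 cu1; rewrite /Y dvec_cfun.
  - apply: (sm_eq gS oU cu' (f := fun=> z 0 (rshift n i))); last exact: (sm_cst gS).
    by move=> u1 cu1; rewrite /Y dvec_cfun.
have Yx i : Y u (xc i) = Z u (cfun c i) by rewrite /Y dvec_cfun// row_mxEl mxE.
have [[W [Y' [[sWs oW] Wu Y'W bE]]] rE] : P (beta A G Z u).
  suff: exists v, P v by exact: xgetPex.
  exists (hproj A G Y u); split; first by exists (cdom tc), Y.
  have th := hproj_tan oU sU YV cu.
  apply: (tangent_ext gA Ac cx (tangent_rho_at gA Ac cu th) tZ) => i.
  by rewrite (rho_at_cfun A) (hproj_xc oU sU)// Yx.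
(* The field delivered by the choice lives on an unknown open set, so it is restricted to the chart
   domain before components are computed. *)
have oI : opn S (W `&` cdom tc) by apply: opnI.
have sI : W `&` cdom tc `<=` cdom tc by move=> ? [].
have Y'I : vf A (W `&` cdom tc) Y' by apply: vf_sub Y'W => ? [].
have Iu : (W `&` cdom tc) u by [].
have Y'x i : Y' u (xc i) = Z u (cfun c i).
  by rewrite -rE (rho_at_cfun A) bE (hproj_xc oI sI).
rewrite bE; split.
- exact: (hproj_tan oI sI).
- by move=> i; rewrite (hproj_xc oI sI).
- by move=> i; rewrite (hproj_yc oI sI)//; under eq_bigr do rewrite Y'x.
Qed.

(** [vproj] has no x-components, so the vector of M with the y-components of [vproj] is a witness;
    the vertical lift keeps all components, which makes the choice unique. *)
Lemma Kmap_spec W X u : opn S W -> W `<=` cdom tc -> vf A W X -> W u ->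
  tangent A u.1 (Kmap A G X u) /\
  forall i, Kmap A G X u (cfun c i) = X u (yc i) + \sum_(j < n) N i j u * X u (xc j).
Proof.
move=> oW sW XW Wu; have cu := sW _ Wu; have cx : cdom c u.1 by case: cu.
pose P := [set w | tangent A u.1 w /\ gamma_at A u w = vproj A G X u].
have [tK KE] : P (Kmap A G X u).
  suff: exists w, P w by exact: xgetPex.
  pose w := dvec A c (coord c u.1) (\row_i vproj A G X u (yc i)).
  have tw : tangent A u.1 w by exact: tangent_dvec.
  exists w; split=> //.
  apply: (slit_ext gA Ac cu (tangent_gamma_at gA Ac cu tw) (vproj_tan oW sW XW Wu)) => i.
    by rewrite (gamma_at_xc gA Ac cu)// (vproj_xc oW sW).
  by rewrite (gamma_at_yc gA Ac cu)// /w dvec_cfun// mxE.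
split=> // i.
by rewrite -(gamma_at_yc gA Ac cu _ tK) KE (vproj_yc oW sW).
Qed.

Section OnOpen2.
Variable W : set (TMT R M).
Hypotheses (oW : opn S W) (sW : W `<=` cdom tc).

Lemma beta_tan Z u : pivf A W Z -> W u -> tangent S u (beta A G Z u).
Proof. by move=> ZW Wu; have [] := beta_spec (sW Wu) (pivf_tan ZW Wu). Qed.

Lemma beta_xc Z u i : pivf A W Z -> W u -> beta A G Z u (xc i) = Z u (cfun c i).
Proof. by move=> ZW Wu; have [] := beta_spec (sW Wu) (pivf_tan ZW Wu). Qed.

Lemma beta_yc Z u i : pivf A W Z -> W u ->
  beta A G Z u (yc i) = - \sum_(j < n) N i j u * Z u (cfun c j).
Proof. by move=> ZW Wu; have [] := beta_spec (sW Wu) (pivf_tan ZW Wu). Qed.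

Lemma beta_vf Z : pivf A W Z -> vf A W (beta A G Z).
Proof.
move=> ZW; apply: (vf_intro gA Ac oW sW) => [u Wu|u i Wu|u i Wu].
- exact: beta_tan.
- apply: (sm_eq gS oW Wu (f := fun u' => Z u' (cfun c i))); last exact: (pivf_sm Ac sW).
  by move=> u' Wu'; rewrite beta_xc.
- apply: (sm_eq gS oW Wu (f := fun u' => - \sum_(j < n) N i j u' * Z u' (cfun c j))).
    by move=> u' Wu'; rewrite beta_yc.
  apply: (smN gS); apply: (sm_sum gS) => j; apply: smM.
    exact/sm_barthel_coef/sW.
  exact: (pivf_sm Ac sW).
Qed.

Lemma Kmap_cfun X u i : vf A W X -> W u -> Kmap A G X u (cfun c i) =
  X u (yc i) + \sum_(j < n) N i j u * X u (xc j).
Proof. by move=> XW Wu; have [] := Kmap_spec oW sW XW Wu. Qed.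

Lemma Kmap_pivf X : vf A W X -> pivf A W (Kmap A G X).
Proof.
move=> XW; apply: (pivf_intro gA Ac oW sW) => [u Wu|u i Wu].
  by have [] := Kmap_spec oW sW XW Wu.
apply: (sm_eq gS oW Wu (f := fun u' => X u' (yc i) + \sum_(j < n) N i j u' * X u' (xc j))).
  by move=> u' Wu'; rewrite Kmap_cfun.
apply: smD; first by apply: (vf_sm gA Ac oW sW XW Wu); exact: (sm_yc sW).
apply: (sm_sum gS) => j; apply: smM; first exact/sm_barthel_coef/sW.
by apply: (vf_sm gA Ac oW sW XW Wu); exact: (sm_xc sW).
Qed.

Lemma berwald_pivf X Z : vf A W X -> pivf A W Z -> pivf A W (berwald A G X Z).
Proof.
move=> XW ZW; have KX := Kmap_pivf XW; have rX := rho_pivf gA Ac oW sW XW.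
have P1 : pivf A W (rho (lie A (gamma A (Kmap A G X)) (beta A G Z))).
  apply: (rho_pivf gA Ac oW sW); apply: (lie_vf gA Ac oW sW); last exact: beta_vf.
  exact: (gamma_vf gA Ac oW sW).
have P2 : pivf A W (Kmap A G (lie A (beta A G (rho X)) (gamma A Z))).
  apply: Kmap_pivf; apply: (lie_vf gA Ac oW sW); first exact: beta_vf.
  exact: (gamma_vf gA Ac oW sW).
apply: (pivf_intro gA Ac oW sW) => [u Wu|u i Wu].
  by apply: (tangentD gA); exact: pivf_tan Wu.
by apply: (smD (pivf_sm Ac sW i P1 Wu) (pivf_sm Ac sW i P2 Wu)).
Qed.

Lemma vf_split X u f : vf A W X -> W u ->
  X u f = gamma A (Kmap A G X) u f + beta A G (rho X) u f.
Proof.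
move=> XW Wu; have KX := Kmap_pivf XW; have rX := rho_pivf gA Ac oW sW XW.
have tg := vf_tan (gamma_vf gA Ac oW sW KX) Wu; have tb := beta_tan rX Wu.
rewrite [in LHS](slit_ext gA Ac (sW Wu) (vf_tan XW Wu) (tangentD gS tg tb))// => i.
  rewrite (_ : (_ + _) _ = gamma A (Kmap A G X) u (xc i) + beta A G (rho X) u (xc i))//.
  by rewrite (gamma_xc sW)// beta_xc// add0r /rho (rho_at_cfun A).
rewrite (_ : (_ + _) _ = gamma A (Kmap A G X) u (yc i) + beta A G (rho X) u (yc i))//.
rewrite (gamma_yc sW)// beta_yc// Kmap_cfun//.
by rewrite [X in _ - X](eq_bigr (fun j => N i j u * X u (xc j))) ?addrK// => j _; rewrite /rho (rho_at_cfun A).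
Qed.

(** The vertical and horizontal parts of [X] together differentiate the components of [Z]. In the
    bracket with [gamma Z], the derivatives of the components of [X] cancel against the N-term of
    [Kmap], and the derivatives of N in the direction of [Z] remain. *)
Lemma berwald_cfun X Z u i : vf A W X -> pivf A W Z -> W u ->
  berwald A G X Z u (cfun c i) = X u (fun u' => Z u' (cfun c i)) +
  \sum_(j < n) \sum_(k < n) X u (xc j) * Gam i j k u * Z u (cfun c k).
Proof.
move=> XW ZW Wu; have KX := Kmap_pivf XW; have rX := rho_pivf gA Ac oW sW XW.
have gKX := gamma_vf gA Ac oW sW KX; have bZ := beta_vf ZW.
have brX := beta_vf rX; have gZ := gamma_vf gA Ac oW sW ZW.
have L := lie_vf gA Ac oW sW brX gZ.
have smx j := sm_xc sW j Wu.
rewrite (_ : berwald A G X Z u (cfun c i) =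
  rho (lie A (gamma A (Kmap A G X)) (beta A G Z)) u (cfun c i) +
  Kmap A G (lie A (beta A G (rho X)) (gamma A Z)) u (cfun c i))//.
rewrite /rho (rho_at_cfun A) Kmap_cfun// !lieE//; last exact: (sm_yc sW).
rewrite (vf_eq gA oW (g := fun u' => Z u' (cfun c i)) gKX Wu); last first.
  by move=> u' Wu'; rewrite beta_xc.
rewrite [X in _ - X](vf_cst0 oW bZ Wu) => [|u' Wu']; last by rewrite (gamma_xc sW).
rewrite subr0 (vf_eq gA oW (g := fun u' => Z u' (cfun c i)) brX Wu); last first.
  by move=> u' Wu'; rewrite (gamma_yc sW).
rewrite (vf_split (fun u' => Z u' (cfun c i)) XW Wu) -!addrA; congr (_ + (_ + _)).
rewrite (vf_eq gA oW (g := fun u' => - \sum_(j < n) N i j u' * X u' (xc j)) gZ Wu); last first.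
  by move=> u' Wu'; rewrite beta_yc//; under eq_bigr do rewrite /rho (rho_at_cfun A).
have smN j : sm u (N i j) by exact/sm_barthel_coef/sW.
have smX j : sm u (fun u' => X u' (xc j)) by apply: (vf_sm gA Ac oW sW XW Wu).
have tgZ := vf_tan gZ Wu.
rewrite (tanN gS tgZ); last by apply: (sm_sum gS) => j; exact: smM.
rewrite opprK (tan_sum gS _ tgZ); last by move=> j; exact: smM.
rewrite -big_split/=; apply: eq_bigr => j _.
rewrite (tanM gS tgZ)// lieE//.
rewrite (vf_cst0 oW brX Wu) => [|u' Wu']; last by rewrite (gamma_xc sW).
rewrite (vf_eq gA oW (f := fun u' => beta A G (rho X) u' (xc j))
  (g := fun u' => X u' (xc j)) gZ Wu); last first.
  by move=> u' Wu'; rewrite beta_xc// /rho (rho_at_cfun A).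
rewrite sub0r mulrN addrAC subrr add0r (gamma_app oW sW)// mulr_sumr.
by apply: eq_bigr => k _; rewrite /Gam; ring.
Qed.

End OnOpen2.
End SprayCalculus.

(** * Curvature *)

(* The horizontal frame delta_i = d/dx^i - N^m_i d/dy^m. *)
HB.lock Definition hd (R : realType) (n : nat) (M : Type) (A : set (chart R M n))
    (c : chart R M n) (G : field R M) (i : 'I_n) (u : TMT R M) : tvec R (TMT R M) :=
  dvec (slit_atlas A) (tchart A (slitTM A) c) (coord (tchart A (slitTM A) c) u)
    (row_mx (delta_mx 0 i) (\row_m - barthel_coef A c G m i u)).

Section Curvature.
Context (R : realType) (n : nat) (M : Type) (A : set (chart R M n)).
Hypothesis gA : good_atlas A.
Local Notation S := (slit_atlas A).
Local Notation sm := (smooth_at S).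
Let gS : good_atlas S := slit_good_atlas gA.

Variable c : chart R M n.
Hypothesis Ac : A c.
Local Notation tc := (tchart A (slitTM A) c).
Local Notation xc i := (cfun tc (lshift n i)).
Local Notation Xd := (Xd A c).
Local Notation Yd := (Yd A c).
Let Sc : S tc := slit_atlas_tchart Ac.

Variable G : field R M.
Local Notation g := (spray_coef A c G).
Local Notation N := (barthel_coef A c G).
Local Notation Gam := (berwald_coef A c G).
Hypothesis GV : vf A (cdom tc) G.
Hypothesis Gx : forall u i, cdom tc u -> G u (xc i) = u.2 (cfun c i).

Variable W : set (TMT R M).
Hypotheses (oW : opn S W) (sW : W `<=` cdom tc).

(** Entries of the connection matrix in the coordinate frame; there is no dy-part, since the
    coordinate fields are parallel in vertical directions. *)
Definition conn_form (X : field R M) (l k : 'I_n) (u : TMT R M) : R :=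
  \sum_(j < n) X u (xc j) * Gam l j k u.
Local Notation om := conn_form.

Lemma berwald_conn X Z u l : vf A W X -> pivf A W Z -> W u ->
  berwald A G X Z u (cfun c l) = X u (fun u' => Z u' (cfun c l)) +
  \sum_(k < n) om X l k u * Z u (cfun c k).
Proof.
move=> XW ZW Wu; rewrite (berwald_cfun gA Ac GV Gx oW sW)//; congr (_ + _).
by rewrite exchange_big; apply: eq_bigr => k _; rewrite mulr_suml.
Qed.

Lemma sm_conn_form X l k u : vf A W X -> W u -> sm u (om X l k).
Proof.
move=> XW Wu; apply: (sm_sum gS) => j; apply: smM.
  by apply: (vf_sm gA Ac oW sW XW Wu); exact: (sm_xc gA Ac sW).
by apply: (sm_berwald_coef gA Ac GV); exact: sW.
Qed.

(** The terms are grouped so that the last pair, the only one with first derivatives of [Z], is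
    symmetric in [X] and [Y] and disappears from the curvature. *)
Lemma berwald_twice X Y Z u l : vf A W X -> vf A W Y -> pivf A W Z -> W u ->
  berwald A G X (berwald A G Y Z) u (cfun c l) =
  X u (fun u' => Y u' (fun u'' => Z u'' (cfun c l))) +
  \sum_(k < n) (Z u (cfun c k) * (X u (om Y l k)
                  + \sum_(m < n) om X l m u * om Y m k u)
     + (om Y l k u * X u (fun u' => Z u' (cfun c k))
     + om X l k u * Y u (fun u' => Z u' (cfun c k)))).
Proof.
move=> XW YW ZW Wu; have YZ := berwald_pivf gA Ac GV Gx oW sW YW ZW.
have tX := vf_tan XW Wu.
have smZ k : sm u (fun u' => Z u' (cfun c k)) by exact: (pivf_sm Ac sW k ZW Wu).
have smo k : sm u (om Y l k) by exact: sm_conn_form.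
rewrite berwald_conn//.
rewrite (vf_eq gA oW XW Wu (fun u' Wu' => berwald_conn l YW ZW Wu')).
rewrite (tanD gS tX); last 2 first.
- exact: (vf_sm gA Ac oW sW YW Wu).
- by apply: (sm_sum gS) => k; exact: smM.
rewrite (tan_sum gS _ tX) => [|k]; last exact: smM.
rewrite -addrA; congr (_ + _).
have -> : \sum_(m < n) om X l m u * berwald A G Y Z u (cfun c m) =
    \sum_(k < n) (om X l k u * Y u (fun u' => Z u' (cfun c k)) +
       Z u (cfun c k) * \sum_(m < n) om X l m u * om Y m k u).
  under eq_bigr => m _ do rewrite berwald_conn// mulrDr mulr_sumr.
  rewrite !big_split/=; congr (_ + _); rewrite exchange_big/=.
  apply: eq_bigr => k _; rewrite mulr_sumr; apply: eq_bigr => m _.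
  by rewrite mulrA mulrC.
rewrite -big_split/=; apply: eq_bigr => k _.
by rewrite (tanM gS tX)//; ring.
Qed.

(** Cartan's structure equation: with omega the connection matrix and the sign convention of [curv],
    the bracketed factor is the entry of minus (d omega + omega wedge omega) at (X, Y). *)
Lemma curv_cfun X Y Z u l : vf A W X -> vf A W Y -> pivf A W Z -> W u ->
  curv A G X Y Z u (cfun c l) = \sum_(k < n) Z u (cfun c k) *
   (om (lie A X Y) l k u - X u (om Y l k) + Y u (om X l k)
    - \sum_(m < n) (om X l m u * om Y m k u - om Y l m u * om X m k u)).
Proof.
move=> XW YW ZW Wu.
rewrite (_ : curv A G X Y Z u (cfun c l) =
  - berwald A G X (berwald A G Y Z) u (cfun c l)
  + berwald A G Y (berwald A G X Z) u (cfun c l)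
  + berwald A G (lie A X Y) Z u (cfun c l))//.
rewrite !berwald_twice// berwald_conn//; last exact: (lie_vf gA Ac oW sW).
rewrite lieE; last exact: (pivf_sm Ac sW l ZW Wu).
(* The second derivatives of the component of [Z] cancel against the bracket; only the three sums
   are left. *)
set B := (X in - (_ + X)); set B' := (X in _ + (_ + X) + _); set C := \sum_(k < n) om (lie A X Y) l k u * _.
transitivity (- B + B' + C); first by ring.
rewrite /B /B' /C -sumrN -!big_split/=; apply: eq_bigr => k _.
by rewrite sumrB; ring.
Qed.

Lemma curv_pivf X Y Z : vf A W X -> vf A W Y -> pivf A W Z ->
  pivf A W (curv A G X Y Z).
Proof.
move=> XW YW ZW; have XY := lie_vf gA Ac oW sW XW YW.
have B := berwald_pivf gA Ac GV Gx oW sW.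
have P1 := B _ _ XW (B _ _ YW ZW); have P2 := B _ _ YW (B _ _ XW ZW).
have P3 := B _ _ XY ZW.
apply: (pivf_intro gA Ac oW sW) => [u Wu|u i Wu].
  apply: (tangentD gA); last exact: (pivf_tan P3 Wu).
  apply: (tangentD gA); last exact: (pivf_tan P2 Wu).
  by rewrite -scaleN1r; apply: (tangentZ gA); exact: (pivf_tan P1 Wu).
have S1 := pivf_sm Ac sW i P1 Wu; have S2 := pivf_sm Ac sW i P2 Wu.
have S3 := pivf_sm Ac sW i P3 Wu.
exact: (smD (smD (smN gS S1) S2) S3).
Qed.

Local Notation hd := (hd A c G).

Lemma hd_tan i u : cdom tc u -> tangent S u (hd i u).
Proof. by move=> cu; rewrite hd.unlock; exact: tangent_dvec. Qed.

Lemma hd_app i u f : cdom tc u ->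
  hd i u f = Xd i u f - \sum_(m < n) N m i u * Yd m u f.
Proof.
move=> cu; rewrite hd.unlock (dvec_sum gS)// big_split_ord/=; congr (_ + _).
  rewrite (bigD1 i)//= big1 => [|j ji].
    by rewrite addr0 row_mxEl mxE !eqxx mul1r.
  by rewrite row_mxEl mxE eqxx/= (negbTE ji) mul0r.
by rewrite -sumrN; apply: eq_bigr => m _; rewrite row_mxEr mxE mulNr.
Qed.

Lemma sm_hd i u f : cdom tc u -> sm u f -> sm u (fun u' => hd i u' f).
Proof.
move=> cu smf.
apply: (sm_eq gS (opn_cdom gS Sc) cu
  (f := fun u' => Xd i u' f - \sum_(m < n) N m i u' * Yd m u' f)).
  by move=> u' cu'; rewrite hd_app.
apply: (smB gS); first exact: (sm_Xd gA Ac cu).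
apply: (sm_sum gS) => m; apply: smM; first exact: (sm_barthel_coef gA Ac GV).
exact: (sm_Yd gA Ac cu).
Qed.

Lemma beta_app X u f : pivf A W X -> W u ->
  beta A G X u f = \sum_(i < n) X u (cfun c i) * hd i u f.
Proof.
move=> XW Wu; have cu := sW Wu.
rewrite (slit_app gA Ac cu f (beta_tan gA Ac GV Gx sW XW Wu)).
under [RHS]eq_bigr => i _ do rewrite hd_app// mulrBr mulr_sumr.
rewrite sumrB; congr (_ + _).
  by apply: eq_bigr => i _; rewrite (beta_xc gA Ac GV Gx sW).
rewrite exchange_big -sumrN; apply: eq_bigr => m _.
rewrite (beta_yc gA Ac GV Gx sW)// mulNr mulr_suml; congr (- _).
by apply: eq_bigr => i _; ring.
Qed.

Definition hv_coef (l j k i : 'I_n) (u : TMT R M) : R := Yd i u (Gam l j k).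

(** In [Rh_cfun], [i] and [j] belong to the two horizontal arguments and [k] to the vector acted
    on. *)
Definition h_coef (l k i j : 'I_n) (u : TMT R M) : R :=
  hd j u (Gam l i k) - hd i u (Gam l j k) +
  \sum_(m < n) (Gam l j m u * Gam m i k u - Gam l i m u * Gam m j k u).

Lemma conn_form_beta X l k u : pivf A W X -> W u ->
  om (beta A G X) l k u = \sum_(j < n) X u (cfun c j) * Gam l j k u.
Proof.
by move=> XW Wu; apply: eq_bigr => j _; rewrite (beta_xc gA Ac GV Gx sW).
Qed.

Lemma conn_form_gamma X l k u : pivf A W X -> W u -> om (gamma A X) l k u = 0.
Proof.
by move=> XW Wu; rewrite /om big1// => j _; rewrite (gamma_xc gA Ac sW)// mul0r.
Qed.

(** The connection form vanishes on vertical fields, so only its derivative along [gamma Y] and its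
    value on the bracket survive; the latter removes the derivatives of the components of [X]. *)
Lemma Phv_cfun X Y Z u l : pivf A W X -> pivf A W Y -> pivf A W Z -> W u ->
  Phv A G X Y Z u (cfun c l) = \sum_(k < n) Z u (cfun c k) *
    \sum_(j < n) X u (cfun c j) * \sum_(i < n) Y u (cfun c i) * hv_coef l j k i u.
Proof.
move=> XW YW ZW Wu; have bX := beta_vf gA Ac GV Gx oW sW XW.
have gY := gamma_vf gA Ac oW sW YW; have tgY := vf_tan gY Wu.
rewrite /Phv curv_cfun//; apply: eq_bigr => k _; congr (_ * _).
rewrite [X in _ - X]big1 => [|m _]; last by rewrite !conn_form_gamma// mulr0 mul0r subr0.
rewrite (vf_cst0 gA oW bX Wu) => [|u' Wu']; last exact: conn_form_gamma.
rewrite !subr0 (vf_eq gA oW gY Wu (fun u' Wu' => conn_form_beta l k XW Wu')).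
have smX j : sm u (fun u' => X u' (cfun c j)) by exact: (pivf_sm Ac sW j XW Wu).
have smG j : sm u (Gam l j k) by apply: (sm_berwald_coef gA Ac GV); exact: sW.
rewrite (tan_sum gS _ tgY) => [|j]; last exact: smM.
rewrite -big_split/=; apply: eq_bigr => j _.
rewrite lieE; last exact: (sm_xc gA Ac sW).
rewrite (vf_cst0 gA oW bX Wu) => [|u' Wu']; last by rewrite (gamma_xc gA Ac sW).
rewrite (vf_eq gA oW gY Wu (fun u' Wu' => beta_xc gA Ac GV Gx sW j XW Wu')).
rewrite (tanM gS tgY)// (gamma_app gA Ac oW sW (Gam l j k) YW Wu).
by rewrite -/(hv_coef l j k _ u); ring.
Qed.

Lemma Rh_cfun X Y Z u l : pivf A W X -> pivf A W Y -> pivf A W Z -> W u ->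
  Rh A G X Y Z u (cfun c l) = \sum_(k < n) Z u (cfun c k) *
    \sum_(i < n) \sum_(j < n) X u (cfun c i) * Y u (cfun c j) * h_coef l k i j u.
Proof.
move=> XW YW ZW Wu; have bX := beta_vf gA Ac GV Gx oW sW XW.
have bY := beta_vf gA Ac GV Gx oW sW YW.
have tX := vf_tan bX Wu; have tY := vf_tan bY Wu.
rewrite /Rh curv_cfun//; apply: eq_bigr => k _; congr (_ * _).
have smX j : sm u (fun u' => X u' (cfun c j)) by exact: (pivf_sm Ac sW j XW Wu).
have smY j : sm u (fun u' => Y u' (cfun c j)) by exact: (pivf_sm Ac sW j YW Wu).
have smG l' j k' : sm u (Gam l' j k') by apply: (sm_berwald_coef gA Ac GV); exact: sW.
rewrite (vf_eq gA oW bX Wu (fun u' Wu' => conn_form_beta l k YW Wu')).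
rewrite (vf_eq gA oW bY Wu (fun u' Wu' => conn_form_beta l k XW Wu')).
rewrite (tan_sum gS _ tX) => [|j]; last exact: smM.
rewrite (tan_sum gS _ tY) => [|j]; last exact: smM.
have -> : om (lie A (beta A G X) (beta A G Y)) l k u = \sum_(j < n)
    (beta A G X u (fun u' => Y u' (cfun c j)) - beta A G Y u (fun u' => X u' (cfun c j)))
    * Gam l j k u.
  apply: eq_bigr => j _; rewrite lieE; last exact: (sm_xc gA Ac sW).
  rewrite (vf_eq gA oW bX Wu (fun u' Wu' => beta_xc gA Ac GV Gx sW j YW Wu')).
  by rewrite (vf_eq gA oW bY Wu (fun u' Wu' => beta_xc gA Ac GV Gx sW j XW Wu')).
(* The bracket term cancels the derivatives of the components of [X] and [Y], as it must for a
   tensor. *)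
rewrite (_ : \sum_(j < n) _ - _ + _ = \sum_(j < n) X u (cfun c j) * beta A G Y u (Gam l j k)
   - \sum_(j < n) Y u (cfun c j) * beta A G X u (Gam l j k)); last first.
  rewrite -!sumrB -big_split/=; apply: eq_bigr => j _.
  by rewrite (tanM gS tX)// (tanM gS tY)//; ring.
rewrite [X in X - _ - _](_ : _ = \sum_(i < n) \sum_(j < n)
    X u (cfun c i) * Y u (cfun c j) * hd j u (Gam l i k)); last first.
  apply: eq_bigr => i _; rewrite beta_app// mulr_sumr.
  by apply: eq_bigr => j _; rewrite mulrA.
rewrite [X in _ - X - _](_ : _ = \sum_(i < n) \sum_(j < n)
    X u (cfun c i) * Y u (cfun c j) * hd i u (Gam l j k)); last first.
  rewrite exchange_big; apply: eq_bigr => i _; rewrite beta_app// mulr_sumr.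
  by apply: eq_bigr => j _; ring.
rewrite [X in _ - X](_ : _ = \sum_(i < n) \sum_(j < n) X u (cfun c i) * Y u (cfun c j) *
   \sum_(m < n) (Gam l i m u * Gam m j k u - Gam l j m u * Gam m i k u)); last first.
  under eq_bigr => m _ do rewrite !conn_form_beta//.
  have E (a b : 'I_n -> R) : (\sum_(j < n) X u (cfun c j) * a j) *
     (\sum_(j < n) Y u (cfun c j) * b j) - (\sum_(j < n) Y u (cfun c j) * a j) *
     (\sum_(j < n) X u (cfun c j) * b j) = \sum_(i < n) \sum_(j < n)
      X u (cfun c i) * Y u (cfun c j) * (a i * b j - a j * b i) :> R.
    rewrite [X in _ - X]mulrC !big_distrlr/= -sumrB; apply: eq_bigr => i _.
    by rewrite -sumrB; apply: eq_bigr => j _; ring.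
  under eq_bigr => m _ do rewrite E.
  rewrite exchange_big; apply: eq_bigr => i _.
  rewrite exchange_big; apply: eq_bigr => j _.
  by rewrite mulr_sumr.
rewrite -!sumrB; apply: eq_bigr => i _; rewrite -!sumrB; apply: eq_bigr => j _.
rewrite /h_coef mulrDr mulrBr; congr (_ + _).
rewrite -mulrN -sumrN; congr (_ * _).
by apply: eq_bigr => m _; rewrite opprB.
Qed.

(** * Consequences of the degree 2 homogeneity of the spray coefficients *)

Section Homogeneous.
Hypothesis Geuler : forall u l, cdom tc u ->
  \sum_(k < n) u.2 (cfun c k) * N l k u = 2 * g l u.

Let oU : opn S (cdom tc). Proof. exact: (opn_cdom gS). Qed.

Lemma Yd_comm i j u f : cdom tc u -> sm u f ->
  Yd i u (fun u' => Yd j u' f) = Yd j u (fun u' => Yd i u' f).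
Proof. by move=> cu; exact: (pd_comm gS). Qed.

Lemma Xd_Yd_comm i j u f : cdom tc u -> sm u f ->
  Xd i u (fun u' => Yd j u' f) = Yd j u (fun u' => Xd i u' f).
Proof. by move=> cu; exact: (pd_comm gS). Qed.

Lemma berwald_coef_sym l j k u : cdom tc u -> Gam l j k u = Gam l k j u.
Proof. by move=> cu; apply: Yd_comm => //; exact: (sm_spray_coef gA Ac GV). Qed.

Lemma Yd_y i k u : cdom tc u -> Yd i u (fun u' => u'.2 (cfun c k)) = (i == k)%:R.
Proof. by move=> cu; rewrite -(ycE A) (Yd_yc gA Ac cu). Qed.

Lemma sum_delta (F : 'I_n -> R) i : \sum_(k < n) F k * (i == k)%:R = F i.
Proof.
rewrite (bigD1 i)//= eqxx mulr1 big1 ?addr0// => k ki.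
by rewrite eq_sym (negbTE ki) mulr0.
Qed.

(** Differentiating Euler's identity for the spray coefficients with respect to y^j: one of the two
    copies of N on the right comes from the derivative of y^k. *)
Lemma barthel_coef_euler l j u : cdom tc u ->
  \sum_(k < n) u.2 (cfun c k) * Gam l j k u = N l j u.
Proof.
move=> cu; have tY := tangent_Yd Ac cu j.
have smy k : sm u (fun u' => u'.2 (cfun c k)) by exact: (sm_snd_cfun gA Ac).
have smN' k : sm u (N l k) by exact: (sm_barthel_coef gA Ac GV).
have : Yd j u (fun u' => \sum_(k < n) u'.2 (cfun c k) * N l k u') = 2 * N l j u.
  rewrite (tan_eq gS tY oU cu (fun u' cu' => Geuler l cu')).
  by rewrite (tanZ gS _ tY)//; exact: (sm_spray_coef gA Ac GV).
rewrite (tan_sum gS _ tY) => [|k]; last exact: smM.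
under eq_bigr => k _ do rewrite (tanM gS tY)// Yd_y//.
rewrite big_split/= sum_delta.
move=> E.
have E' : \sum_(k < n) u.2 (cfun c k) * Yd j u (N l k) =
    \sum_(k < n) u.2 (cfun c k) * Gam l j k u.
  by apply: eq_bigr => k _; rewrite (berwald_coef_sym l j k cu).
by rewrite -E'; apply: (addIr (N l j u)); rewrite E mulr_natl.
Qed.

(** The vertical components of the commutator of delta_i and delta_j, that is, the obstruction to
    integrability of the horizontal distribution. *)
Definition rhat_coef (l i j : 'I_n) (u : TMT R M) : R :=
  hd j u (N l i) - hd i u (N l j).

Lemma Yd_hd k j f u : cdom tc u -> sm u f ->
  Yd k u (fun u' => hd j u' f) = hd j u (fun u' => Yd k u' f)
    - \sum_(m < n) Gam m j k u * Yd m u f.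
Proof.
move=> cu smf; have tY := tangent_Yd Ac cu k.
have smN' m : sm u (N m j) by exact: (sm_barthel_coef gA Ac GV).
have smY m : sm u (fun u' => Yd m u' f) by exact: (sm_Yd gA Ac cu).
rewrite (tan_eq gS tY oU cu (fun u' cu' => hd_app j f cu')).
rewrite (tanB gS tY); first last.
- by apply: (sm_sum gS) => m; exact: smM.
- exact: (sm_Xd gA Ac cu).
rewrite (tan_sum gS _ tY) => [|m]; last exact: smM.
rewrite hd_app// Xd_Yd_comm//.
rewrite -addrA; congr (_ + _); rewrite -opprD; congr (- _).
rewrite -big_split/=; apply: eq_bigr => m _; rewrite (tanM gS tY)//.
by rewrite (Yd_comm k m)//; congr (_ + _); exact: mulrC.
Qed.

(** Recovers R from Rhat. The products of Berwald coefficients in [h_coef] are exactly what [Yd_hd]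
    produces when d/dy^k is moved past delta_i and delta_j. *)
Lemma Yd_rhat_coef l k i j u : cdom tc u ->
  Yd k u (rhat_coef l i j) = h_coef l k i j u.
Proof.
move=> cu; have tY := tangent_Yd Ac cu k.
have smN' i' : sm u (N l i') by exact: (sm_barthel_coef gA Ac GV).
rewrite (tanB gS tY); try exact: sm_hd.
rewrite (Yd_hd k j cu (smN' i)) (Yd_hd k i cu (smN' j)).
have E a b : \sum_(m < n) Gam m a k u * Yd m u (N l b) =
    \sum_(m < n) Gam l b m u * Gam m a k u.
  by apply: eq_bigr => m _; exact: mulrC.
rewrite (E j i) (E i j) /h_coef sumrB.
have aux (a b p q : R) : a - p - (b - q) = a - b + (q - p) by ring.
exact: aux.
Qed.

Lemma hd_y j k u : cdom tc u -> hd j u (fun u' => u'.2 (cfun c k)) = - N k j u.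
Proof.
move=> cu; rewrite hd_app// -(ycE A) (Xd_yc gA Ac cu) sub0r; congr (- _).
by under eq_bigr => m _ do rewrite (Yd_yc gA Ac cu) eq_sym; rewrite sum_delta.
Qed.

(** Moving y^k inside delta_j costs a term with N, by [hd_y]; these terms cancel against the
    contracted products of Berwald coefficients. *)
Lemma h_coef_euler l i j u : cdom tc u ->
  \sum_(k < n) u.2 (cfun c k) * h_coef l k i j u = rhat_coef l i j u.
Proof.
move=> cu.
have smy k : sm u (fun u' => u'.2 (cfun c k)) by exact: (sm_snd_cfun gA Ac).
have smG i' k : sm u (Gam l i' k) by exact: (sm_berwald_coef gA Ac GV).
have E i' j' : \sum_(k < n) u.2 (cfun c k) * hd j' u (Gam l i' k) =
    hd j' u (N l i') + \sum_(k < n) N k j' u * Gam l i' k u.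
  have tH := hd_tan j' cu.
  have <- : hd j' u (fun u' => \sum_(k < n) u'.2 (cfun c k) * Gam l i' k u') = hd j' u (N l i').
    by apply: (tan_eq gS tH oU cu) => u' cu'; exact: barthel_coef_euler.
  rewrite (tan_sum gS _ tH) => [|k]; last exact: smM.
  rewrite -big_split/=; apply: eq_bigr => k _.
  by rewrite (tanM gS tH)// hd_y//; ring.
rewrite /h_coef; under eq_bigr => k _ do rewrite mulrDr mulrBr mulr_sumr.
rewrite big_split/= sumrB !E exchange_big/=.
rewrite [X in _ + X](_ : _ = \sum_(m < n) (N m i u * Gam l j m u - N m j u * Gam l i m u)).
  by rewrite sumrB /rhat_coef; ring.
apply: eq_bigr => m _; rewrite -!(barthel_coef_euler m)//.
rewrite !mulr_suml -sumrB; apply: eq_bigr => k _; ring.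
Qed.

Lemma Rhat_cfun X Y u l : pivf A W X -> pivf A W Y -> W u ->
  Rhat A G X Y u (cfun c l) =
    \sum_(i < n) \sum_(j < n) X u (cfun c i) * Y u (cfun c j) * rhat_coef l i j u.
Proof.
move=> XW YW Wu; rewrite /Rhat Rh_cfun//; last exact: (pivf_eta gA Ac oW sW).
under eq_bigr => k _ do rewrite mulr_sumr.
rewrite exchange_big; apply: eq_bigr => i _.
under eq_bigr => k _ do rewrite mulr_sumr.
rewrite exchange_big; apply: eq_bigr => j _.
rewrite -h_coef_euler ?mulr_sumr; last exact: sW.
by apply: eq_bigr => k _; rewrite /eta; ring.
Qed.

End Homogeneous.
End Curvature.

(** * Projective change *)

Section Multilinear.
Context (R : comRingType) (n : nat).
Implicit Types (x y z : 'I_n -> R) (b : 'I_n -> 'I_n -> R).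

Lemma sum_deltal x l : \sum_(i < n) x i * (i == l)%:R = x l.
Proof.
rewrite (bigD1 l)//= eqxx mulr1 big1 ?addr0// => k kl.
by rewrite (negbTE kl) mulr0.
Qed.

Let linear_expand w (F G H K : 'I_n -> R) (e f g h : R) l :
  \sum_(i < n) w i * (F i + G i * e + H i * f + K i * g + h * (i == l)%:R) =
  \sum_(i < n) w i * F i + (\sum_(i < n) w i * G i) * e
  + (\sum_(i < n) w i * H i) * f + (\sum_(i < n) w i * K i) * g + h * w l.
Proof.
rewrite -(sum_deltal w l) mulr_sumr !mulr_suml -!big_split/=.
by apply: eq_bigr => i _; ring.
Qed.

(** Each Kronecker delta replaces a summation by a component of [x], [y] or [z], giving the cyclic
    sum in the Douglas tensor. The coefficients are arbitrary functions into a commutative ring, so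
    that [ring] meets no derivatives. *)
Lemma trilinear_expand x y z (P a : 'I_n -> 'I_n -> 'I_n -> R) b (e : R) l :
  \sum_(k < n) z k * \sum_(j < n) x j * \sum_(i < n) y i *
    (P j k i + (a j k i * e + b j k * (i == l)%:R + b j i * (k == l)%:R
                + b k i * (j == l)%:R)) =
  \sum_(k < n) z k * \sum_(j < n) x j * \sum_(i < n) y i * P j k i
  + ((\sum_(j < n) \sum_(i < n) x j * y i * b j i) * z l
  + (\sum_(k < n) \sum_(i < n) z k * y i * b k i) * x l
  + (\sum_(j < n) \sum_(k < n) x j * z k * b j k) * y l)
  + (\sum_(k < n) z k * \sum_(j < n) x j * \sum_(i < n) y i * a j k i) * e.
Proof.
have E1 j k : \sum_(i < n) y i *
    (P j k i + (a j k i * e + b j k * (i == l)%:R + b j i * (k == l)%:R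
                + b k i * (j == l)%:R)) =
  \sum_(i < n) y i * P j k i + (\sum_(i < n) y i * a j k i) * e
  + (\sum_(i < n) y i * b j i) * (k == l)%:R
  + (\sum_(i < n) y i * b k i) * (j == l)%:R + b j k * y l.
  by rewrite -linear_expand; apply: eq_bigr => i _; ring.
have E2 k : \sum_(j < n) x j * \sum_(i < n) y i *
    (P j k i + (a j k i * e + b j k * (i == l)%:R + b j i * (k == l)%:R
                + b k i * (j == l)%:R)) =
   \sum_(j < n) x j * (\sum_(i < n) y i * P j k i)
   + (\sum_(j < n) x j * (\sum_(i < n) y i * a j k i)) * e
   + (\sum_(j < n) x j * b j k) * y l
   + (\sum_(j < n) x j * (\sum_(i < n) y i * b j i)) * (k == l)%:R
   + (\sum_(i < n) y i * b k i) * x l.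
  rewrite -linear_expand; apply: eq_bigr => j _; rewrite E1; congr (_ * _).
  by ring.
rewrite (eq_bigr (fun k => z k * ((\sum_(j < n) x j * (\sum_(i < n) y i * P j k i))
   + (\sum_(j < n) x j * (\sum_(i < n) y i * a j k i)) * e
   + (\sum_(j < n) x j * b j k) * y l
   + (\sum_(i < n) y i * b k i) * x l
   + (\sum_(j < n) x j * (\sum_(i < n) y i * b j i)) * (k == l)%:R))); last first.
  by move=> k _; rewrite E2; ring.
rewrite linear_expand.
have S1 : \sum_(i < n) z i * (\sum_(j < n) x j * b j i) =
    \sum_(j < n) \sum_(k < n) x j * z k * b j k.
  rewrite exchange_big; apply: eq_bigr => k _; rewrite mulr_sumr.
  by apply: eq_bigr => j _; rewrite mulrCA mulrA.
have S2 u v : \sum_(i < n) u i * (\sum_(j < n) v j * b i j) =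
    \sum_(i < n) \sum_(j < n) u i * v j * b i j.
  apply: eq_bigr => i _; rewrite mulr_sumr.
  by apply: eq_bigr => j _; rewrite mulrA.
by rewrite S1 (S2 z y) (S2 x y); ring.
Qed.

(** The same passage for the Weyl torsion: [q] stands for the components of Q and [r i j] for the
    y^i-derivative of [q j]. *)
Lemma bilinear_expand x y (P r : 'I_n -> 'I_n -> R) q (e : R) l :
  \sum_(i < n) \sum_(j < n) x i * y j *
    (P i j + ((r i j - r j i) * e + q j * (i == l)%:R - q i * (j == l)%:R)) =
  \sum_(i < n) \sum_(j < n) x i * y j * P i j
  + (((\sum_(i < n) y i * q i) * x l + (\sum_(i < n) y i * \sum_(k < n) x k * r k i) * e)
  - ((\sum_(i < n) x i * q i) * y l + (\sum_(i < n) x i * \sum_(k < n) y k * r k i) * e)).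
Proof.
have E1 i : \sum_(j < n) x i * y j *
    (P i j + ((r i j - r j i) * e + q j * (i == l)%:R - q i * (j == l)%:R)) =
  \sum_(j < n) x i * y j * P i j + (\sum_(j < n) y j * (x i * r i j)) * e
  + (\sum_(j < n) y j * r j i) * (- (x i * e))
  + (\sum_(j < n) y j * q j) * (x i * (i == l)%:R) + (- (x i * q i)) * y l.
  rewrite (eq_bigr (fun j => y j * (x i * P i j + (x i * r i j) * e + r j i * (- (x i * e))
     + q j * (x i * (i == l)%:R) + (- (x i * q i)) * (j == l)%:R))); last by move=> j _; ring.
  rewrite linear_expand; congr (_ + _ + _ + _ + _).
  by apply: eq_bigr => j _; ring.
under eq_bigr => i _ do rewrite E1.
rewrite !big_split/= -!mulr_suml sumrN -mulr_sumr sum_deltal.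
have S1 : \sum_(i < n) (\sum_(j < n) y j * (x i * r i j)) =
    \sum_(i < n) y i * (\sum_(k < n) x k * r k i).
  by rewrite exchange_big; apply: eq_bigr => j _; rewrite mulr_sumr.
have S2 : \sum_(i < n) (\sum_(j < n) y j * r j i) * (- (x i * e)) =
    - ((\sum_(i < n) x i * (\sum_(k < n) y k * r k i)) * e).
  by rewrite mulr_suml -sumrN; apply: eq_bigr => i _; ring.
rewrite S1 S2; ring.
Qed.

End Multilinear.

Section Projective.
Context (R : realType) (n : nat) (M : Type) (A : set (chart R M n)).
Hypothesis gA : good_atlas A.
Local Notation S := (slit_atlas A).
Local Notation sm := (smooth_at S).
Let gS : good_atlas S := slit_good_atlas gA.

Variable c : chart R M n.
Hypothesis Ac : A c.
Local Notation tc := (tchart A (slitTM A) c).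
Local Notation xc i := (cfun tc (lshift n i)).
Local Notation Xd := (Xd A c).
Local Notation Yd := (Yd A c).
Let Sc : S tc := slit_atlas_tchart Ac.
Let oU : opn S (cdom tc). Proof. exact: (opn_cdom gS). Qed.

Section OneSpray.
Variable G : field R M.
Hypothesis GV : vf A (cdom tc) G.
Hypothesis Gx : forall u i, cdom tc u -> G u (xc i) = u.2 (cfun c i).
Variable W : set (TMT R M).
Hypotheses (oW : opn S W) (sW : W `<=` cdom tc).

Lemma berwald_gamma X Y u l : pivf A W X -> pivf A W Y -> W u ->
  berwald A G (gamma A X) Y u (cfun c l) = gamma A X u (fun u' => Y u' (cfun c l)).
Proof.
move=> XW YW Wu; rewrite (berwald_conn gA Ac GV Gx oW sW)//; last exact: (gamma_vf gA Ac oW sW).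
rewrite [X in _ + X]big1 ?addr0// => k _.
by rewrite (conn_form_gamma gA Ac G sW)// mul0r.
Qed.

(** The formula for [a] is assumed on all of [W] and for all sections, because [a Y] is
    differentiated and [a] is also applied to the covariant derivative of [Y]. That second term
    removes the derivatives of the components of [Y]. *)
Lemma Dv1_form (a : pifield R M -> TMT R M -> R) (F : 'I_n -> TMT R M -> R) X Y u :
  (forall Y u, pivf A W Y -> W u -> a Y u = \sum_(j < n) Y u (cfun c j) * F j u) ->
  (forall j, sm u (F j)) -> pivf A W X -> pivf A W Y -> W u ->
  Dv1 A G a X Y u =
  \sum_(j < n) Y u (cfun c j) * \sum_(k < n) X u (cfun c k) * Yd k u (F j).
Proof.
move=> aE smF XW YW Wu; have gX := gamma_vf gA Ac oW sW XW.
have tX := vf_tan gX Wu; have DY := berwald_pivf gA Ac GV Gx oW sW gX YW.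
have smY j : sm u (fun u' => Y u' (cfun c j)) by exact: (pivf_sm Ac sW j YW Wu).
rewrite /Dv1 (aE _ _ DY Wu) (vf_eq gA oW gX Wu (fun u' Wu' => aE Y u' YW Wu')).
rewrite (tan_sum gS _ tX) => [|j]; last exact: smM.
rewrite -sumrB; apply: eq_bigr => j _.
rewrite (tanM gS tX)// berwald_gamma// (gamma_app gA Ac oW sW (F j) XW Wu).
by rewrite [F j u * _]mulrC addrK.
Qed.

Lemma Dv2_form (a : pifield R M -> pifield R M -> TMT R M -> R)
    (F : 'I_n -> 'I_n -> TMT R M -> R) X Y Z u :
  (forall X Z u, pivf A W X -> pivf A W Z -> W u -> a X Z u =
     \sum_(j < n) \sum_(k < n) X u (cfun c j) * Z u (cfun c k) * F j k u) ->
  (forall j k, sm u (F j k)) ->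
  pivf A W X -> pivf A W Y -> pivf A W Z -> W u ->
  Dv2 A G a Y X Z u = \sum_(k < n) Z u (cfun c k) * \sum_(j < n) X u (cfun c j) *
     \sum_(i < n) Y u (cfun c i) * Yd i u (F j k).
Proof.
move=> aE smF XW YW ZW Wu; have gY := gamma_vf gA Ac oW sW YW.
have tY := vf_tan gY Wu; have DX := berwald_pivf gA Ac GV Gx oW sW gY XW.
have DZ := berwald_pivf gA Ac GV Gx oW sW gY ZW.
have smX j : sm u (fun u' => X u' (cfun c j)) by exact: (pivf_sm Ac sW j XW Wu).
have smZ j : sm u (fun u' => Z u' (cfun c j)) by exact: (pivf_sm Ac sW j ZW Wu).
have smXZ j k : sm u (fun u' => X u' (cfun c j) * Z u' (cfun c k)) by exact: smM.
rewrite /Dv2 (aE _ _ _ DX ZW Wu) (aE _ _ _ XW DZ Wu).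
rewrite (vf_eq gA oW gY Wu (fun u' Wu' => aE X Z u' XW ZW Wu')).
rewrite (tan_sum gS _ tY) => [|j]; last by apply: (sm_sum gS) => k; exact: smM.
under [RHS]eq_bigr => k _ do rewrite mulr_sumr.
rewrite [RHS]exchange_big -!sumrB; apply: eq_bigr => j _.
rewrite (tan_sum gS _ tY) => [|k]; last exact: smM.
rewrite -!sumrB; apply: eq_bigr => k _.
rewrite (tanM gS tY)// (tanM gS tY)// !berwald_gamma//.
rewrite (gamma_app gA Ac oW sW (F j k) YW Wu).
move: (gamma A Y u _) (gamma A Y u _) (X u _) (Z u _) (F j k u) (\sum_(i < n) _).
by move=> p q r s t w; ring.
Qed.

End OneSpray.

Variables G G' : field R M.
Hypothesis GV : vf A (cdom tc) G.
Hypothesis Gx : forall u i, cdom tc u -> G u (xc i) = u.2 (cfun c i).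
Hypothesis GV' : vf A (cdom tc) G'.
Hypothesis Gx' : forall u i, cdom tc u -> G' u (xc i) = u.2 (cfun c i).
Local Notation g := (spray_coef A c G).
Local Notation N := (barthel_coef A c G).
Local Notation Gam := (berwald_coef A c G).
Local Notation hd' := (hd A c G').
Local Notation hd := (hd A c G).
Local Notation g' := (spray_coef A c G').
Local Notation N' := (barthel_coef A c G').
Local Notation Gam' := (berwald_coef A c G').

Variable lam : TMT R M -> R.
Hypothesis smlam : forall u, cdom tc u -> sm u lam.
Hypothesis Gproj : forall u i, cdom tc u -> g' i u = g i u + lam u * u.2 (cfun c i).

Definition lam1 (j : 'I_n) (u : TMT R M) : R := Yd j u lam.
Definition lam2 (j k : 'I_n) (u : TMT R M) : R := Yd k u (lam1 j).
(* Q = q_i dx^i *)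
Definition qcoef (i : 'I_n) (u : TMT R M) : R := hd i u lam - lam u * lam1 i u.

Lemma sm_lam1 j u : cdom tc u -> sm u (lam1 j).
Proof. by move=> cu; apply: (sm_Yd gA Ac cu); exact: smlam. Qed.

Lemma sm_lam2 j k u : cdom tc u -> sm u (lam2 j k).
Proof. by move=> cu; apply: (sm_Yd gA Ac cu); exact: sm_lam1. Qed.

Lemma sm_qcoef j u : cdom tc u -> sm u (qcoef j).
Proof.
move=> cu; apply: (smB gS); first by apply: (sm_hd gA Ac GV j cu); exact: smlam.
by apply: smM; [exact: smlam | exact: sm_lam1].
Qed.

Lemma lam2_sym j k u : cdom tc u -> lam2 j k u = lam2 k j u.
Proof. by move=> cu; apply: (Yd_comm gA Ac) => //; exact: smlam. Qed.

Lemma barthel_proj l j u : cdom tc u ->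
  N' l j u = N l j u + (lam1 j u * u.2 (cfun c l) + lam u * (j == l)%:R).
Proof.
move=> cu; have tY := tangent_Yd Ac cu j.
have smy := sm_snd_cfun gA Ac l cu; have sml := smlam cu.
have smg : sm u (g l) by exact: (sm_spray_coef gA Ac GV).
rewrite /N' (tan_eq gS tY oU cu (fun u' cu' => Gproj l cu')).
rewrite (tanD gS tY)//; last exact: smM.
rewrite (tanM gS tY)// (Yd_y gA Ac)//; congr (_ + _).
by rewrite addrC [X in X + _]mulrC.
Qed.

Lemma berwald_proj l j k u : cdom tc u ->
  Gam' l j k u = Gam l j k u + (lam2 j k u * u.2 (cfun c l)
    + lam1 j u * (k == l)%:R + lam1 k u * (j == l)%:R).
Proof.
move=> cu; have tY := tangent_Yd Ac cu k.
have smy := sm_snd_cfun gA Ac l cu; have sml := smlam cu; have sml1 := sm_lam1 j cu.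
have smN : sm u (N l j) by exact: (sm_barthel_coef gA Ac GV).
have smd : sm u (fun=> (j == l)%:R) by exact: (sm_cst gS).
rewrite /Gam' (tan_eq gS tY oU cu (fun u' cu' => barthel_proj l j cu')).
rewrite (tanD gS tY)//; last by apply: smD; exact: smM.
rewrite (tanD gS tY); [|exact: smM|exact: smM].
rewrite !(tanM gS tY)// (tan_cst gS _ tY) (Yd_y gA Ac)// mulr0 add0r.
congr (_ + _); rewrite -[Yd k u (lam1 j)]/(lam2 j k u) -[Yd k u lam]/(lam1 k u).
by rewrite [X in X + _]addrC [u.2 _ * _]mulrC [_%:R * _]mulrC.
Qed.

Lemma hv_proj l j k i u : cdom tc u ->
  hv_coef A c G' l j k i u = hv_coef A c G l j k i u +
    (Yd i u (lam2 j k) * u.2 (cfun c l) + lam2 j k u * (i == l)%:R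
    + lam2 j i u * (k == l)%:R + lam2 k i u * (j == l)%:R).
Proof.
move=> cu; have tY := tangent_Yd Ac cu i.
have smy := sm_snd_cfun gA Ac l cu; have sml j' := sm_lam1 j' cu; have sml2 := sm_lam2 j k cu.
have smG : sm u (Gam l j k) by exact: (sm_berwald_coef gA Ac GV).
have smd b : sm u (fun=> b) by exact: (sm_cst gS).
have sm1 : sm u (fun u' => lam2 j k u' * u'.2 (cfun c l)) by exact: smM.
have sm2 : sm u (fun u' => lam1 j u' * (k == l)%:R) by exact: smM.
have sm3 : sm u (fun u' => lam1 k u' * (j == l)%:R) by exact: smM.
have sm12 := smD sm1 sm2; have sm123 := smD sm12 sm3.
rewrite /hv_coef (tan_eq gS tY oU cu (fun u' cu' => berwald_proj l j k cu')).
rewrite (tanD gS tY smG sm123) (tanD gS tY sm12 sm3) (tanD gS tY sm1 sm2).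
rewrite !(tanM gS tY)// !(tan_cst gS _ tY) (Yd_y gA Ac)// !mulr0 !add0r.
rewrite -[Yd i u (lam1 j)]/(lam2 j i u) -[Yd i u (lam1 k)]/(lam2 k i u).
by rewrite [X in X + _ + _]addrC [u.2 _ * _]mulrC ![_%:R * _]mulrC.
Qed.

Hypothesis Geuler : forall u l, cdom tc u ->
  \sum_(k < n) u.2 (cfun c k) * N l k u = 2 * g l u.
Hypothesis Geuler' : forall u l, cdom tc u ->
  \sum_(k < n) u.2 (cfun c k) * N' l k u = 2 * g' l u.

Lemma hd_proj j f u : cdom tc u -> hd' j u f =
  hd j u f - lam1 j u * (\sum_(m < n) u.2 (cfun c m) * Yd m u f) - lam u * Yd j u f.
Proof.
move=> cu; rewrite !(hd_app gA Ac)//.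
rewrite (eq_bigr (fun m => N m j u * Yd m u f + lam1 j u * (u.2 (cfun c m) * Yd m u f)
   + lam u * (Yd m u f * (j == m)%:R))); last first.
  move=> m _; rewrite barthel_proj//.
  by move: (N m j u) (lam1 j u) (lam u) (Yd m u f) => p q r s; ring.
rewrite !big_split/= -!mulr_sumr sum_delta.
by move: (Xd j u f) (\sum_(m < n) _) (\sum_(m < n) _) => p q r; ring.
Qed.

(** Arranged for antisymmetrisation: the last three groups are symmetric in [i] and [j] and will
    drop out of [rhat_coef]. *)
Lemma hd_barthel_proj l i j u : cdom tc u ->
  hd' j u (N' l i) = hd j u (N l i)
   + (hd j u (lam1 i) - lam1 j u * lam1 i u - lam u * lam2 i j u) * u.2 (cfun c l)
   + qcoef j u * (i == l)%:R
   - (lam1 i u * N l j u + lam1 j u * N l i u)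
   - lam u * Gam l i j u
   - lam u * (lam1 i u * (j == l)%:R + lam1 j u * (i == l)%:R).
Proof.
move=> cu; have tH := hd_tan Ac G j cu.
have smy := sm_snd_cfun gA Ac l cu; have sml := smlam cu; have sml1 := sm_lam1 i cu.
have smN : sm u (N l i) by exact: (sm_barthel_coef gA Ac GV).
have smd : sm u (fun=> (i == l)%:R) by exact: (sm_cst gS).
rewrite hd_proj//.
(* The new coefficients N' are again homogeneous of degree 1, so the Euler operator in [hd_proj]
   reproduces them. *)
have -> : \sum_(m < n) u.2 (cfun c m) * Yd m u (N' l i) = N' l i u.
  rewrite -(barthel_coef_euler gA Ac GV' Geuler')//.
have -> : hd j u (N' l i) = hd j u (N l i) + (lam1 i u * - N l j u
    + u.2 (cfun c l) * hd j u (lam1 i) + (i == l)%:R * hd j u lam).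
  rewrite (tan_eq gS tH oU cu (fun u' cu' => barthel_proj l i cu')).
  rewrite (tanD gS tH)//; last by apply: smD; exact: smM.
  rewrite (tanD gS tH); [|exact: smM|exact: smM].
  by rewrite !(tanM gS tH)// (tan_cst gS _ tH) (hd_y gA Ac)// mulr0 add0r.
rewrite -[Yd j u (N' l i)]/(Gam' l i j u) berwald_proj// barthel_proj// /qcoef.
move: (hd j u (N l i)) (hd j u (lam1 i)) (hd j u lam) (N l j u) (N l i u) (Gam l i j u).
move: (lam1 i u) (lam1 j u) (lam u) (lam2 i j u) (u.2 _) (i == l) (j == l).
by move=> a b d e f g0 h k m o p q r; ring.
Qed.

Lemma Yd_qcoef i j u : cdom tc u ->
  Yd i u (qcoef j) = hd j u (lam1 i) - \sum_(m < n) Gam m j i u * lam1 m u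
   - (lam u * lam2 j i u + lam1 j u * lam1 i u).
Proof.
move=> cu; have tY := tangent_Yd Ac cu i.
have sml := smlam cu; have sml1 := sm_lam1 j cu.
have smh : sm u (fun u' => hd j u' lam) by exact: (sm_hd gA Ac GV).
rewrite (tanB gS tY)//; last exact: smM.
by rewrite (tanM gS tY)// (Yd_hd gA Ac GV).
Qed.

(** The coefficient of y^l in [hd_barthel_proj] differs from the derivative of [qcoef] in [Yd_qcoef]
    only by a contraction of Berwald coefficients that is symmetric in [i] and [j]. *)
Lemma rhat_proj l i j u : cdom tc u ->
  rhat_coef A c G' l i j u = rhat_coef A c G l i j u +
   ((Yd i u (qcoef j) - Yd j u (qcoef i)) * u.2 (cfun c l)
    + qcoef j u * (i == l)%:R - qcoef i u * (j == l)%:R).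
Proof.
move=> cu; rewrite /rhat_coef !hd_barthel_proj// !Yd_qcoef//.
rewrite (lam2_sym j i cu) (berwald_coef_sym gA Ac GV l j i cu).
have -> : \sum_(m < n) Gam m j i u * lam1 m u = \sum_(m < n) Gam m i j u * lam1 m u.
  by apply: eq_bigr => m _; rewrite (berwald_coef_sym gA Ac GV m j i cu).
move: (hd j u (N l i)) (hd i u (N l j)) (hd j u (lam1 i)) (hd i u (lam1 j)).
move: (\sum_(m < n) _) (lam1 i u) (lam1 j u) (lam u) (lam2 i j u) (u.2 _).
move: (qcoef j u) (qcoef i u) (N l j u) (N l i u) (Gam l i j u) (i == l) (j == l).
by move=> *; ring.
Qed.

Variable W : set (TMT R M).
Hypotheses (oW : opn S W) (sW : W `<=` cdom tc).

Lemma alpha_cfun X u : pivf A W X -> W u ->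
  alpha A G lam X u = \sum_(j < n) X u (cfun c j) * lam1 j u.
Proof.
move=> XW Wu; have bX := beta_vf gA Ac GV Gx oW sW XW.
rewrite /alpha /dJ (J_app gA Ac oW sW)//; apply: eq_bigr => j _.
by rewrite (beta_xc gA Ac GV Gx sW).
Qed.

Lemma Qform_cfun X u : pivf A W X -> W u ->
  Qform A G lam X u = \sum_(j < n) X u (cfun c j) * qcoef j u.
Proof.
move=> XW Wu; rewrite /Qform alpha_cfun// (beta_app gA Ac GV Gx sW)//.
by rewrite mulr_sumr -sumrB; apply: eq_bigr => j _; rewrite mulrBr mulrCA.
Qed.

Lemma Dv1_alpha X Y u : pivf A W X -> pivf A W Y -> W u ->
  Dv1 A G (alpha A G lam) X Y u =
  \sum_(j < n) \sum_(k < n) X u (cfun c j) * Y u (cfun c k) * lam2 j k u.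
Proof.
move=> XW YW Wu; rewrite (Dv1_form GV Gx oW sW (fun Y u => @alpha_cfun Y u))//; last first.
  by move=> j; exact/sm_lam1/sW.
rewrite exchange_big; apply: eq_bigr => k _; rewrite mulr_sumr; apply: eq_bigr => j _.
rewrite -[Yd j u (lam1 k)]/(lam2 k j u) (lam2_sym k j (sW Wu)).
by rewrite mulrA [Y u _ * _]mulrC.
Qed.

Hypothesis Hptr : forall X Y u, pivf A W X -> pivf A W Y -> W u ->
  ptr A G X Y u = - (n%:R + 1) * Dv1 A G (alpha A G lam) X Y u.
Hypothesis HR1 : forall X u, pivf A W X -> W u ->
  R1 A G X u = (n%:R + 1) * Qform A G lam X u.

Let n1 : (n%:R + 1 : R) != 0.
Proof. by rewrite gt_eqF// ltr_wpDl. Qed.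

Lemma ptr_cfun X Y u : pivf A W X -> pivf A W Y -> W u -> ptr A G X Y u =
  - (n%:R + 1) * \sum_(j < n) \sum_(k < n) X u (cfun c j) * Y u (cfun c k) * lam2 j k u.
Proof. by move=> XW YW Wu; rewrite Hptr// Dv1_alpha. Qed.

(** Under the hypothesis on p this is the symmetry of the vertical Hessian of lam; it lets the
    cyclic sum of [Douglas] match the order of arguments in [trilinear_expand]. *)
Lemma ptr_sym X Y u : pivf A W X -> pivf A W Y -> W u -> ptr A G X Y u = ptr A G Y X u.
Proof.
move=> XW YW Wu; rewrite !ptr_cfun//; congr (_ * _); rewrite exchange_big.
apply: eq_bigr => k _; apply: eq_bigr => j _.
by rewrite (lam2_sym j k (sW Wu)) [X u _ * _]mulrC.
Qed.

Lemma Phv_proj X Y Z u l : pivf A W X -> pivf A W Y -> pivf A W Z -> W u ->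
  Phv A G' X Y Z u (cfun c l) = Douglas A G X Y Z u (cfun c l).
Proof.
move=> XW YW ZW Wu; have cu := sW Wu.
rewrite (_ : Douglas A G X Y Z u (cfun c l) = Phv A G X Y Z u (cfun c l)
  - (n%:R + 1)^-1 * (ptr A G X Y u * Z u (cfun c l) + ptr A G Y Z u * X u (cfun c l)
     + ptr A G Z X u * Y u (cfun c l))
  - ((n%:R + 1)^-1 * Dv2 A G (ptr A G) Y X Z u) * u.2 (cfun c l))//.
rewrite (Phv_cfun gA Ac GV Gx oW sW)// (Phv_cfun gA Ac GV' Gx' oW sW)//.
(* [ptr] is known at every point of [W] as a form with coefficients [lam2], and can therefore be
   differentiated without unfolding the trace. *)
have -> : Dv2 A G (ptr A G) Y X Z u = - (n%:R + 1) * \sum_(k < n) Z u (cfun c k) *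
   \sum_(j < n) X u (cfun c j) * \sum_(i < n) Y u (cfun c i) * Yd i u (lam2 j k).
  have sm2 j k : sm u (fun u' => - (n%:R + 1) * lam2 j k u').
    by apply: smM; [exact: (sm_cst gS) | exact: sm_lam2].
  rewrite (Dv2_form GV Gx oW sW (F := fun j k u' => - (n%:R + 1) * lam2 j k u'))//; last first.
    move=> X' Z' u' XW' ZW' Wu'; rewrite ptr_cfun// mulr_sumr; apply: eq_bigr => j _.
    by rewrite mulr_sumr; apply: eq_bigr => k _; rewrite mulrCA.
  rewrite mulr_sumr; apply: eq_bigr => k _; rewrite mulrCA; congr (_ * _).
  rewrite mulr_sumr; apply: eq_bigr => j _; rewrite mulrCA; congr (_ * _).
  rewrite mulr_sumr; apply: eq_bigr => i _; rewrite mulrCA; congr (_ * _).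
  by rewrite (tanZ gS _ (tangent_Yd Ac cu i))//; exact: sm_lam2.
rewrite (ptr_sym YW ZW Wu) (ptr_sym ZW XW Wu) !ptr_cfun//.
rewrite (eq_bigr (fun k => Z u (cfun c k) * \sum_(j < n) X u (cfun c j) *
  \sum_(i < n) Y u (cfun c i) * (hv_coef A c G l j k i u +
    (Yd i u (lam2 j k) * u.2 (cfun c l) + lam2 j k u * (i == l)%:R
    + lam2 j i u * (k == l)%:R + lam2 k i u * (j == l)%:R)))); last first.
  move=> k _; congr (_ * _); apply: eq_bigr => j _; congr (_ * _).
  by apply: eq_bigr => i _; rewrite hv_proj.
rewrite (trilinear_expand (fun j => X u (cfun c j)) (fun j => Y u (cfun c j))
  (fun j => Z u (cfun c j)) (fun j k i => hv_coef A c G l j k i u)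
  (fun j k i => Yd i u (lam2 j k)) (fun j k => lam2 j k u)).
(* The factor -(n + 1) brought in by the hypothesis on p cancels the normalisation of the Douglas
   tensor, signs included. *)
have aux (P a1 a2 a3 z x y D e : R) : P + (a1 * z + a2 * x + a3 * y) + D * e =
  P - (n%:R + 1)^-1 * (- (n%:R + 1) * a1 * z + - (n%:R + 1) * a2 * x + - (n%:R + 1) * a3 * y)
   - ((n%:R + 1)^-1 * (- (n%:R + 1) * D)) * e by field.
exact: aux.
Qed.

Lemma R1_cfun X u : pivf A W X -> W u ->
  R1 A G X u = \sum_(j < n) X u (cfun c j) * ((n%:R + 1) * qcoef j u).
Proof.
move=> XW Wu; rewrite HR1// Qform_cfun// mulr_sumr.
by apply: eq_bigr => j _; rewrite mulrCA.
Qed.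

Lemma Rhat_proj X Y u l : pivf A W X -> pivf A W Y -> W u ->
  Rhat A G' X Y u (cfun c l) = Weyl A G X Y u (cfun c l).
Proof.
move=> XW YW Wu; have cu := sW Wu.
rewrite (_ : Weyl A G X Y u (cfun c l) = Rhat A G X Y u (cfun c l) + (n%:R + 1)^-1 *
  ((R1 A G Y u * X u (cfun c l) + Dv1 A G (R1 A G) X Y u * u.2 (cfun c l))
   - (R1 A G X u * Y u (cfun c l) + Dv1 A G (R1 A G) Y X u * u.2 (cfun c l))))//.
have D1 X' Y' : pivf A W X' -> pivf A W Y' -> Dv1 A G (R1 A G) X' Y' u =
    (n%:R + 1) * \sum_(j < n) Y' u (cfun c j) *
      \sum_(k < n) X' u (cfun c k) * Yd k u (qcoef j).
  move=> XW' YW'.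
  rewrite (Dv1_form GV Gx oW sW (F := fun j u' => (n%:R + 1) * qcoef j u') (fun Y u => @R1_cfun Y u))//; last first.
    by move=> j; apply: smM; [exact: (sm_cst gS) | exact: sm_qcoef].
  rewrite mulr_sumr; apply: eq_bigr => j _; rewrite mulrCA; congr (_ * _).
  rewrite mulr_sumr; apply: eq_bigr => k _; rewrite mulrCA; congr (_ * _).
  by rewrite (tanZ gS _ (tangent_Yd Ac cu k))//; exact: sm_qcoef.
rewrite !D1// !HR1// !Qform_cfun//.
rewrite (Rhat_cfun gA Ac GV Gx oW sW Geuler)// (Rhat_cfun gA Ac GV' Gx' oW sW Geuler')//.
rewrite (eq_bigr (fun i => \sum_(j < n) X u (cfun c i) * Y u (cfun c j) *
   (rhat_coef A c G l i j u +
   ((Yd i u (qcoef j) - Yd j u (qcoef i)) * u.2 (cfun c l)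
    + qcoef j u * (i == l)%:R - qcoef i u * (j == l)%:R)))); last first.
  by move=> i _; apply: eq_bigr => j _; rewrite rhat_proj.
rewrite (bilinear_expand (fun j => X u (cfun c j)) (fun j => Y u (cfun c j))
  (fun i j => rhat_coef A c G l i j u) (fun i j => Yd i u (qcoef j))
  (fun j => qcoef j u)).
have aux (P a b d f x y e : R) : P + (a * x + b * e - (d * y + f * e)) =
  P + (n%:R + 1)^-1 * ((n%:R + 1) * a * x + (n%:R + 1) * b * e
    - ((n%:R + 1) * d * y + (n%:R + 1) * f * e)) by field.
exact: aux.
Qed.

End Projective.

(** * The canonical spray of a Finsler structure *)

Lemma derive1_shift (R : realType) (F H : R -> R) (t : R) :
  (forall h, H h = F (h + t)) -> F^`()%classic t = H^`()%classic 0.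
Proof.
move=> E; rewrite /derive1.
rewrite (_ : (fun h => h^-1 *: (F (h + t) - F t)) =
  (fun h => h^-1 *: (H (h + 0) - H 0)))//.
by apply/funext => h; rewrite !E addr0 add0r.
Qed.

Section FinslerSpray.
Context (R : realType) (n : nat) (M : Type) (A : set (chart R M n)).
Hypothesis gA : good_atlas A.
Local Notation S := (slit_atlas A).
Local Notation sm := (smooth_at S).
Let gS : good_atlas S := slit_good_atlas gA.

Variable c : chart R M n.
Hypothesis Ac : A c.
Local Notation tc := (tchart A (slitTM A) c).
Local Notation xc i := (cfun tc (lshift n i)).
Local Notation yc i := (cfun tc (rshift n i)).
Local Notation Xd := (Xd A c).
Local Notation Yd := (Yd A c).
Let Sc : S tc := slit_atlas_tchart Ac.
Let oU : opn S (cdom tc). Proof. exact: (opn_cdom gS). Qed.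
Let sU : cdom tc `<=` cdom tc. Proof. by []. Qed.

Lemma Xd_vf j : vf A (cdom tc) (Xd j).
Proof.
apply: (vf_intro gA Ac oU sU) => [u cu|u i cu|u i cu]; first exact: tangent_Xd.
  apply: (sm_eq gS oU cu (f := fun=> (j == i)%:R)); last exact: (sm_cst gS).
  by move=> u' cu'; rewrite (Xd_xc gA Ac cu').
apply: (sm_eq gS oU cu (f := fun=> 0)); last exact: (sm_cst gS).
by move=> u' cu'; rewrite (Xd_yc gA Ac cu').
Qed.

Lemma Yd_vf j : vf A (cdom tc) (Yd j).
Proof.
apply: (vf_intro gA Ac oU sU) => [u cu|u i cu|u i cu]; first exact: tangent_Yd.
  apply: (sm_eq gS oU cu (f := fun=> 0)); last exact: (sm_cst gS).
  by move=> u' cu'; rewrite (Yd_xc gA Ac cu').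
apply: (sm_eq gS oU cu (f := fun=> (j == i)%:R)); last exact: (sm_cst gS).
by move=> u' cu'; rewrite (Yd_yc gA Ac cu').
Qed.

Lemma gamma_at_app u w f : cdom tc u -> tangent A u.1 w ->
  gamma_at A u w f = \sum_(i < n) w (cfun c i) * Yd i u f.
Proof.
move=> cu tw; have tg := tangent_gamma_at gA Ac cu tw.
rewrite (slit_app gA Ac cu f tg) [X in X + _]big1 => [|i _].
  by rewrite add0r; apply: eq_bigr => i _; rewrite (gamma_at_yc gA Ac cu).
by rewrite (gamma_at_xc gA Ac cu)// mul0r.
Qed.

Lemma gamma_at_derive1 u w f : sm u f ->
  gamma_at A u w f = (fun t : R => f (u.1, u.2 + t *: w))^`()%classic 0.
Proof. by move=> smf; rewrite /gamma_at; case: asboolP. Qed.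

(** For small t the point stays in the slit bundle, where the first derivative along the line is
    again a smooth function, evaluated at the moved point; differentiating it once more gives the
    vertical Hessian. *)
Lemma second_derive_vertical u w f : cdom tc u -> tangent A u.1 w ->
  (forall u, cdom tc u -> sm u f) ->
  derive1n 2 (fun t : R => f (u.1, u.2 + t *: w)) 0 =
  \sum_(j < n) w (cfun c j) * \sum_(i < n) w (cfun c i) * Yd j u (Yd i ^~ f).
Proof.
move=> cu tw smf; have [[tu u0] cx] := cu.
pose H (u' : TMT R M) := \sum_(i < n) w (cfun c i) * Yd i u' f.
have smY i : sm u (Yd i ^~ f) by apply: (sm_Yd gA Ac cu); exact: smf.
have smc i : sm u (fun=> w (cfun c i)) by exact: (sm_cst gS).
have smH : sm u H by apply: (sm_sum gS) => i; exact: smM.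
(* Vectors are operators without a norm at hand, so nonvanishing of [u.2 + t *: w] is tested on one
   function that [u.2] does not kill. *)
have [f0 uf0] : exists f0, u.2 f0 <> 0.
  apply: contrapT => uf; apply: u0; apply/funext => f0.
  by apply: contrapT => uf0; apply: uf; exists f0.
rewrite /derive1n /= derive1E.
rewrite (near_eq_derive (g := fun t : R => H (u.1, u.2 + t *: w))).
  rewrite -derive1E -gamma_at_derive1// gamma_at_app//; apply: eq_bigr => j _.
  congr (_ * _); rewrite (tan_sum gS _ (tangent_Yd Ac cu j)) => [|i]; last exact: smM.
  by apply: eq_bigr => i _; rewrite (tanZ gS _ (tangent_Yd Ac cu j)).
have ct : {for (0 : R), continuous (fun t : R => u.2 f0 + t * w f0)}.
  apply: continuousD; first exact: cst_continuous.
  apply: continuousM; last exact: cst_continuous.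
  by [].
have : \forall t \near (0 : R), u.2 f0 + t * w f0 != 0.
  have : nbhs (u.2 f0 + 0 * w f0) [set r | r != 0].
    apply: open_nbhs_nbhs; split; first exact: open_neq.
    by rewrite /= mul0r addr0; apply/eqP.
  by move=> /ct.
apply: filterS => t ut.
have cut : cdom tc (u.1, u.2 + t *: w).
  split=> //; split=> /=; first by apply: (tangentD gA) => //; exact: (tangentZ gA).
  by move=> /(congr1 (fun v => v f0)) E; move/eqP: ut; apply; exact: E.
have twt : tangent A (u.1, u.2 + t *: w).1 w by [].
rewrite /H -(gamma_at_app f cut twt) gamma_at_derive1; last exact: smf.
apply: derive1_shift => h /=.
by rewrite -addrA -scalerDl (addrC t h).
Qed.

Variable L : TMT R M -> R.
Hypothesis finL : finsler A L.
Local Notation E := (energy L).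
Variable G : field R M.
Hypothesis spL : canonical_spray A L G.

Definition eng1 (j : 'I_n) (u : TMT R M) : R := Yd j u E.
(** The components of the Finsler metric tensor. *)
Definition eng2 (j k : 'I_n) (u : TMT R M) : R := Yd k u (eng1 j).
Definition euler_op (f : TMT R M -> R) (u : TMT R M) : R :=
  \sum_(k < n) u.2 (cfun c k) * Yd k u f.

Lemma sm_energy u : cdom tc u -> sm u E.
Proof.
move=> [su _]; have [_ _ smL _ _] := finL.
have C : sm u (fun=> 2^-1) by exact: (sm_cst gS).
exact: (smM C (smM (smL u su) (smL u su))).
Qed.

Lemma sm_eng1 j u : cdom tc u -> sm u (eng1 j).
Proof. by move=> cu; apply: (sm_Yd gA Ac cu); exact: sm_energy. Qed.

Lemma sm_eng2 j k u : cdom tc u -> sm u (eng2 j k).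
Proof. by move=> cu; apply: (sm_Yd gA Ac cu); exact: sm_eng1. Qed.

Lemma eng2_sym j k u : cdom tc u -> eng2 j k u = eng2 k j u.
Proof. by move=> cu; apply: (Yd_comm gA Ac) => //; exact: sm_energy. Qed.

(** A null vector would make the second derivative of the energy in its own direction zero, against
    positivity. Below, identities for the components of [G] are proved by contracting with this
    matrix. *)
Lemma eng2_nondegenerate (w : 'I_n -> R) u : cdom tc u ->
  (forall j, \sum_(i < n) w i * eng2 i j u = 0) -> forall i, w i = 0.
Proof.
move=> cu w0; have [[tu u0] cx] := cu.
pose v : tvec R M := dvec A c (coord c u.1) (\row_i w i).
have tv : tangent A u.1 v by exact: tangent_dvec.
have vE i : v (cfun c i) = w i by rewrite /v dvec_cfun// mxE.
have [v0|v0 i] := pselect (v <> 0); last first.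
  by rewrite -vE; have -> : v = 0 by exact: contrapT.
have [_ _ _ _ posL] := finL; have := posL u v cu.1 tv v0.
rewrite second_derive_vertical//; last exact: sm_energy.
rewrite big1 ?ltxx// => j _; rewrite [X in _ * X](_ : _ = 0) ?mulr0//.
by apply: etrans (w0 j); apply: eq_bigr => i _; rewrite vE.
Qed.

Lemma euler_tan u : cdom tc u -> tangent S u (gamma A (@eta R M) u).
Proof. by move=> cu; apply: (tangent_gamma_at gA Ac cu); case: cu => -[]. Qed.

Lemma euler_opE f u : cdom tc u -> euler_op f u = gamma A (@eta R M) u f.
Proof. by move=> cu; rewrite /gamma gamma_at_app//; case: cu => -[]. Qed.

Lemma energy_euler u : cdom tc u -> euler_op E u = 2 * E u.
Proof.
move=> cu; rewrite euler_opE// /gamma gamma_at_derive1; last exact: sm_energy.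
have [_ _ _ homL _] := finL; have tu : TM A u by case: cu => -[].
rewrite derive1E (near_eq_derive (g := E u \*: ((cst 1 + id : R -> R) ^+ 2))).
  have D : is_derive (0 : R) (1 : R) (E u \*: ((cst 1 + id : R -> R) ^+ 2)) (2 * E u).
    apply: is_derive_eq.
    by change (E u * ((2 * (1 + 0) ^+ 1) * (0 + 1)) = 2 * E u); ring.
  by have [_ ->] := D.
(* Homogeneity is available for positive factors only, so 1 + t must be positive. *)
have : \forall t \near (0 : R), `|t| < 1 by exact: nbhs0_lt.
apply: filterS => t; rewrite ltr_norml => /andP[t1 _].
have t1' : 0 < 1 + t by lra.
have tE : (u.1, eta u + t *: eta u) = (u.1, (1 + t) *: u.2) by rewrite scalerDl scale1r.
rewrite /energy tE homL//.
by change (2^-1 * ((1 + t) * L u) ^+ 2 = (2^-1 * L u ^+ 2) * (1 + t) ^+ 2); ring.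
Qed.

Lemma Yd_euler j f u : cdom tc u -> sm u f ->
  Yd j u (euler_op f) = Yd j u f + euler_op (Yd j ^~ f) u.
Proof.
move=> cu smf; have tY := tangent_Yd Ac cu j.
have smy k : sm u (fun u' => u'.2 (cfun c k)) by exact: (sm_snd_cfun gA Ac).
have smY k : sm u (Yd k ^~ f) by exact: (sm_Yd gA Ac cu).
rewrite /euler_op (tan_sum gS _ tY) => [|k]; last exact: smM.
under eq_bigr => k _ do rewrite (tanM gS tY)// (Yd_y gA Ac)// (Yd_comm gA Ac j k cu smf).
by rewrite big_split/= sum_delta addrC.
Qed.

Lemma Xd_euler j f u : cdom tc u -> sm u f ->
  Xd j u (euler_op f) = euler_op (Xd j ^~ f) u.
Proof.
move=> cu smf; have tX := tangent_Xd Ac cu j.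
have smy k : sm u (fun u' => u'.2 (cfun c k)) by exact: (sm_snd_cfun gA Ac).
have smY k : sm u (Yd k ^~ f) by exact: (sm_Yd gA Ac cu).
rewrite /euler_op (tan_sum gS _ tX) => [|k]; last exact: smM.
apply: eq_bigr => k _; rewrite (tanM gS tX)// (Xd_Yd_comm gA Ac j k cu smf).
by rewrite -(ycE A) (Xd_yc gA Ac cu) mulr0 addr0.
Qed.

Lemma eng1_euler j u : cdom tc u -> euler_op (eng1 j) u = eng1 j u.
Proof.
move=> cu; have tY := tangent_Yd Ac cu j; have smE := sm_energy cu.
have := Yd_euler j cu smE.
rewrite (tan_eq gS tY oU cu energy_euler) (tanZ gS _ tY)//.
rewrite -[Yd j u E]/(eng1 j u) => H.
by apply: (addrI (eng1 j u)); rewrite -H mulr_natl.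
Qed.

Lemma eng2_euler i j u : cdom tc u -> euler_op (eng2 i j) u = 0.
Proof.
move=> cu; have tY := tangent_Yd Ac cu j.
have := Yd_euler j cu (sm_eng1 i cu).
rewrite (tan_eq gS tY oU cu (eng1_euler i)) => H.
by apply: (addrI (Yd j u (eng1 i))); rewrite addr0 -H.
Qed.

Lemma spray_vf : vf A (cdom tc) G.
Proof. by have [GV _] := spL; apply: vf_sub GV => u []. Qed.
Let GV := spray_vf.

Lemma spray_eq X u : vf A (cdom tc) X -> cdom tc u ->
  G u (fun u' => J A X u' E) - X u (fun u' => J A G u' E) - J A (lie A G X) u E
  = - X u E.
Proof.
move=> XV cu; have [_ H] := spL; apply: (H (cdom tc)) => //.
by split=> // u' [].
Qed.

(** Testing the spray equation on d/dy^j, the derivatives of the components of [G] cancel and the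
    contraction of the x-components of [G] with the metric equals dE/dy^j. By [eng1_euler] so does
    the contraction of y with the metric. *)
Lemma spray_xc u i : cdom tc u -> G u (xc i) = u.2 (cfun c i).
Proof.
move=> cu; apply/eqP; rewrite -subr_eq0; apply/eqP; move: i.
apply: (eng2_nondegenerate cu) => j.
have smE1 i : sm u (eng1 i) by exact: sm_eng1.
have tY := tangent_Yd Ac cu j.
have sma i : sm u (fun u' => G u' (xc i)).
  by apply: (vf_sm gA Ac oU sU GV cu); exact: (sm_cfun gS).
have := spray_eq (Yd_vf j) cu.
rewrite (vf_cst0 gA oU GV cu) => [|u' cu']; last first.
  rewrite (J_app gA Ac oU sU E (Yd_vf j) cu') big1// => i _.
  by rewrite (Yd_xc gA Ac cu') mul0r.
rewrite (vf_eq gA oU (Yd_vf j) cu (fun u' cu' => J_app gA Ac oU sU E GV cu')).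
rewrite (tan_sum gS _ tY) => [|i]; last exact: (smM (sma i) (smE1 i)).
rewrite (J_app gA Ac oU sU E (lie_vf gA Ac oU sU GV (Yd_vf j)) cu).
rewrite (eq_bigr (fun i => G u (xc i) * eng2 i j u + eng1 i u * Yd j u (fun u' => G u' (xc i)))); last first.
  by move=> i _; rewrite (tanM gS tY (sma i) (smE1 i)).
rewrite big_split/= [X in _ - _ - X](_ : _ =
   - \sum_(i < n) eng1 i u * Yd j u (fun u' => G u' (xc i))); last first.
  rewrite -sumrN; apply: eq_bigr => i _; rewrite lieE; last exact: (sm_cfun gS).
  rewrite (vf_cst0 gA oU GV cu) => [|u' cu']; last by rewrite (Yd_xc gA Ac cu').
  by rewrite sub0r mulNr mulrC.
rewrite sub0r opprK opprD subrK => /oppr_inj H.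
rewrite -[RHS](subrr (eng1 j u)) -[X in X - _]H -(eng1_euler j cu) /euler_op -sumrB.
apply: eq_bigr => i _; rewrite mulrBl; congr (_ - _ * _).
by rewrite -[RHS]/(eng2 j i u) eng2_sym.
Qed.

(** The Euler-Lagrange equation, obtained from the test field d/dx^j: its bracket with [G] has no
    x-components, and [J G] applied to E is 2 E. *)
Lemma spray_eng1 j u : cdom tc u -> G u (eng1 j) = Xd j u E.
Proof.
move=> cu; have tX := tangent_Xd Ac cu j; have smE := sm_energy cu.
have := spray_eq (Xd_vf j) cu.
rewrite (vf_eq gA oU (g := eng1 j) GV cu) => [|u' cu']; last first.
  rewrite (J_app gA Ac oU sU E (Xd_vf j) cu').
  under eq_bigr => i _ do rewrite (Xd_xc gA Ac cu') mulrC.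
  exact: sum_delta.
rewrite (vf_eq gA oU (g := fun u' => 2 * E u') (Xd_vf j) cu) => [|u' cu']; last first.
  rewrite (J_app gA Ac oU sU E GV cu') -energy_euler//.
  by apply: eq_bigr => i _; rewrite spray_xc.
rewrite (J_app gA Ac oU sU E (lie_vf gA Ac oU sU GV (Xd_vf j)) cu).
rewrite big1 => [|i _]; last first.
  rewrite lieE; last exact: (sm_cfun gS).
  rewrite (vf_eq gA oU (g := fun=> (j == i)%:R) GV cu) => [|u' cu']; last by rewrite (Xd_xc gA Ac cu').
  rewrite (tan_cst gS _ (vf_tan GV cu)).
  rewrite (vf_eq gA oU (g := yc i) (Xd_vf j) cu) => [|u' cu']; last by rewrite spray_xc ?ycE.
  by rewrite (Xd_yc gA Ac cu) subrr mul0r.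
rewrite (tanZ gS _ tX)// subr0 => H; apply: (addIr (- (2 * Xd j u E))).
rewrite H; ring.
Qed.

Lemma spray_yc_eng2 j u : cdom tc u ->
  \sum_(i < n) G u (yc i) * eng2 i j u =
  Xd j u E - \sum_(i < n) u.2 (cfun c i) * Xd i u (eng1 j).
Proof.
move=> cu; rewrite -spray_eng1// (slit_app gA Ac cu (eng1 j) (vf_tan GV cu)).
rewrite [X in X + _ - _](eq_bigr (fun i => u.2 (cfun c i) * Xd i u (eng1 j))); last first.
  by move=> i _; rewrite spray_xc.
rewrite [X in X - _]addrC addrK; apply: eq_bigr => i _.
by rewrite eng2_sym.
Qed.

(** The Euler operator is applied to [spray_yc_eng2]: the right-hand side has degree 2 and the
    metric degree 0, so the metric annihilates the defect in homogeneity of the y-components. *)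
Lemma spray_yc_euler i u : cdom tc u ->
  euler_op (fun u' => G u' (yc i)) u = 2 * G u (yc i).
Proof.
move=> cu; apply/eqP; rewrite -subr_eq0; apply/eqP; move: i.
apply: (eng2_nondegenerate cu) => j.
have tE := euler_tan cu; have smE := sm_energy cu.
have smG i : sm u (fun u' => G u' (yc i)).
  by apply: (vf_sm gA Ac oU sU GV cu); exact: (sm_cfun gS).
have smy k : sm u (fun u' => u'.2 (cfun c k)) by exact: (sm_snd_cfun gA Ac).
have smX i : sm u (fun u' => Xd i u' (eng1 j)) by apply: (sm_Xd gA Ac cu); exact: sm_eng1.
have smE2 i : sm u (eng2 i j) by exact: sm_eng2.
have smXE : sm u (Xd j ^~ E) by exact: (sm_Xd gA Ac cu).
have := tan_eq gS tE oU cu (spray_yc_eng2 j).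
rewrite (tan_sum gS _ tE) => [|i]; last exact: smM.
rewrite (tanB gS tE)//; last by apply: (sm_sum gS) => i; exact: smM.
rewrite (tan_sum gS _ tE) => [|i]; last exact: smM.
rewrite -euler_opE// -Xd_euler//.
rewrite (tan_eq gS (tangent_Xd Ac cu j) oU cu energy_euler) (tanZ gS _ (tangent_Xd Ac cu j))//.
rewrite (eq_bigr (fun i => euler_op (fun u' => G u' (yc i)) u * eng2 i j u)); last first.
  move=> i _; rewrite (tanM gS tE)// -!euler_opE// eng2_euler// mulr0 add0r.
  exact: mulrC.
rewrite [X in _ = _ - X](eq_bigr (fun i => 2 * (u.2 (cfun c i) * Xd i u (eng1 j)))); last first.
  move=> i _; rewrite (tanM gS tE)// -!euler_opE//.
  rewrite -(Xd_euler i cu (sm_eng1 j cu)).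
  rewrite (tan_eq gS (tangent_Xd Ac cu i) oU cu (eng1_euler j)).
  have -> : euler_op (fun u' => u'.2 (cfun c i)) u = u.2 (cfun c i).
    rewrite /euler_op; under eq_bigr => k _ do rewrite (Yd_y gA Ac)//.
    exact: sum_deltal.
  by rewrite [X in _ + X]mulrC mulr_natl.
rewrite -mulr_sumr -mulrBr -spray_yc_eng2// => H.
rewrite -[RHS](subrr (2 * \sum_(i < n) G u (yc i) * eng2 i j u)) -[X in X - _]H.
rewrite mulr_sumr -sumrB; apply: eq_bigr => i _.
by rewrite mulrBl mulrA.
Qed.

Lemma spray_coef_euler u l : cdom tc u ->
  \sum_(k < n) u.2 (cfun c k) * barthel_coef A c G l k u = 2 * spray_coef A c G l u.
Proof.
move=> cu; rewrite -[LHS]/(euler_op (spray_coef A c G l) u) euler_opE//.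
have tE := euler_tan cu.
rewrite (tanZ gS _ tE); last first.
  by apply: (vf_sm gA Ac oU sU GV cu); exact: (sm_cfun gS).
by rewrite -euler_opE// spray_yc_euler// /spray_coef mulrCA.
Qed.

End FinslerSpray.

(** * Projective flatness *)

Section Frame.
Context (R : realType) (n : nat) (M : Type) (A : set (chart R M n)).
Hypothesis gA : good_atlas A.
Local Notation S := (slit_atlas A).
Let gS : good_atlas S := slit_good_atlas gA.

Variable c : chart R M n.
Hypothesis Ac : A c.
Local Notation tc := (tchart A (slitTM A) c).
Let Sc : S tc := slit_atlas_tchart Ac.
Let oU : opn S (cdom tc). Proof. exact: (opn_cdom gS). Qed.
Let sU : cdom tc `<=` cdom tc. Proof. by []. Qed.

Lemma frame_cfun i j u : cdom tc u -> frame A c i u (cfun c j) = (i == j)%:R.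
Proof. by move=> [_ cx]; rewrite /frame dvec_cfun// mxE eqxx eq_sym. Qed.

Lemma frame_pivf i : pivf A (cdom tc) (frame A c i).
Proof.
apply: (pivf_intro gA Ac oU sU) => [u [_ cx]|u j cu]; first exact: tangent_dvec.
apply: (sm_eq gS oU cu (f := fun=> (i == j)%:R)); last exact: (sm_cst gS).
by move=> u' cu'; rewrite frame_cfun.
Qed.

Variable G : field R M.
Hypothesis GV : vf A (cdom tc) G.
Hypothesis Gx : forall u i, cdom tc u -> G u (cfun tc (lshift n i)) = u.2 (cfun c i).
Hypothesis Geuler : forall u l, cdom tc u ->
  \sum_(k < n) u.2 (cfun c k) * barthel_coef A c G l k u = 2 * spray_coef A c G l u.

Lemma Rhat_frame l i j u : cdom tc u ->
  Rhat A G (frame A c i) (frame A c j) u (cfun c l) = rhat_coef A c G l i j u.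
Proof.
move=> cu.
rewrite (Rhat_cfun gA Ac GV Gx oU sU Geuler l (frame_pivf i) (frame_pivf j) cu).
under eq_bigr => i' _.
  under eq_bigr => j' _ do rewrite !frame_cfun// -mulrA mulrCA mulrC.
  rewrite sum_delta mulrC; over.
exact: sum_delta.
Qed.

(** The vanishing of [rhat_coef] is required on the whole chart domain, since it is differentiated
    in the fibre directions. *)
Lemma Rh_cfun_eq0 W X Y Z u l : opn S W -> W `<=` cdom tc ->
  pivf A W X -> pivf A W Y -> pivf A W Z -> W u ->
  (forall i j u, cdom tc u -> rhat_coef A c G l i j u = 0) ->
  Rh A G X Y Z u (cfun c l) = 0.
Proof.
move=> oW sW XW YW ZW Wu r0; have cu := sW _ Wu.
rewrite (Rh_cfun gA Ac GV Gx oW sW)// big1// => k _.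
rewrite big1 ?mulr0// => i _; rewrite big1// => j _.
rewrite -(Yd_rhat_coef gA Ac GV)//.
have tY := tangent_Yd Ac cu k.
by rewrite (tan_eq gS tY oU cu (r0 i j)) (tan_cst gS _ tY) mulr0.
Qed.

End Frame.

Unset Implicit Arguments.

Theorem theorem5p10 (R : realType) (n : nat) (hn : (2 < n)%N)
    (M : topologicalType) (A : set (chart R M n)) (hM : smooth_manifold A)
    (L L' : TMT R M -> R) (G G' : field R M) (lam : TMT R M -> R)
    (hproj : projective_change A L L' G G' lam)
    (halpha : piform2_eq A
       (Dv1 A G (alpha A G lam))
       (fun X Y u => - (n%:R + 1)^-1 * ptr A G X Y u))
    (hQ : piform1_eq A
       (Qform A G lam)
       (fun X u => (n%:R + 1)^-1 * R1 A G X u)) :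
  (pitensor3_zero A (Phv A G') /\ pitensor3_zero A (Rh A G'))
  <->
  (pitensor2_zero A (Weyl A G) /\ pitensor3_zero A (Douglas A G)).
Proof.
have gA := smooth_manifold_good_atlas hM.
have gS := slit_good_atlas gA.
have covA x : exists2 c, A c & cdom c x by case: hM => _ _ _ + _; exact.
have [[finL finL'] [spL spL'] smlam _ GG'] := hproj.
have n1 : (n%:R + 1 : R) != 0 by rewrite gt_eqF// ltr_wpDl.
pose tc := tchart A (slitTM A).
have smlamc c u : cdom (tc c) u -> smooth_at (slit_atlas A) u lam by move=> [/smlam].
have Gproj c (Ac : A c) u i : cdom (tc c) u -> spray_coef A c G' i u =
    spray_coef A c G i u + lam u * u.2 (cfun c i).
  move=> cu; rewrite /spray_coef (GG' u cu.1).
  rewrite (_ : (G u - _) _ = G u (cfun (tc c) (rshift n i)) -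
    2 * lam u * gamma_at A u u.2 (cfun (tc c) (rshift n i)))//.
  rewrite (gamma_at_yc gA Ac cu); last by case: cu => -[].
  by field.
have Hptr W X Y u : open_slit A W -> pivf A W X -> pivf A W Y -> W u ->
    ptr A G X Y u = - (n%:R + 1) * Dv1 A G (alpha A G lam) X Y u.
  move=> oW XW YW Wu; rewrite (halpha _ _ _ oW XW YW _ Wu) mulrA mulNr mulrN opprK.
  by rewrite mulfV// mul1r.
have HR1 W X u : open_slit A W -> pivf A W X -> W u ->
    R1 A G X u = (n%:R + 1) * Qform A G lam X u.
  by move=> oW XW Wu; rewrite (hQ _ _ oW XW _ Wu) mulrA mulfV// mul1r.
(* The tensor equations are tested on arbitrary open sets; this shrinks such a set around a point
   until it lies in one chart. *)
have loc W u : open_slit A W -> W u -> exists c, exists W', [/\ A c, open_slit A W',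
    W' u, W' `<=` W & W' `<=` cdom (tc c)].
  move=> [sW oW] Wu; have [c Ac cx] := covA u.1.
  have Sc := slit_atlas_tchart Ac; exists c, (W `&` cdom (tc c)); split.
  - by [].
  - by split; [move=> ? [/sW] | apply: (opnI gS oW); exact: (opn_cdom gS)].
  - by split=> //; split=> //; exact: sW.
  - by move=> ? [].
  - by move=> ? [].
have PD c W X Y Z u l : A c -> open_slit A W -> W `<=` cdom (tc c) ->
    pivf A W X -> pivf A W Y -> pivf A W Z -> W u ->
    Phv A G' X Y Z u (cfun c l) = Douglas A G X Y Z u (cfun c l).
  move=> Ac oW sW.
  apply: (Phv_proj gA Ac (spray_vf spL) (spray_xc gA Ac finL spL)
    (spray_vf spL') (spray_xc gA Ac finL' spL') (smlamc c) (Gproj c Ac)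
    oW.2 sW) => *; exact: (Hptr W).
have RW c W X Y u l : A c -> open_slit A W -> W `<=` cdom (tc c) ->
    pivf A W X -> pivf A W Y -> W u ->
    Rhat A G' X Y u (cfun c l) = Weyl A G X Y u (cfun c l).
  move=> Ac oW sW.
  apply: (Rhat_proj gA Ac (spray_vf spL) (spray_xc gA Ac finL spL)
    (spray_vf spL') (spray_xc gA Ac finL' spL') (smlamc c) (Gproj c Ac)
    (spray_coef_euler gA Ac finL spL) (spray_coef_euler gA Ac finL' spL')
    oW.2 sW) => *; exact: (HR1 W).
(* Equal components imply equal operators only for tangent vectors, so tangency of the curvature
   values is recorded for both sprays. *)
have PT c W (H : field R M) X Y Z u : A c -> open_slit A W -> W `<=` cdom (tc c) ->
    vf A (cdom (tc c)) H ->
    (forall u i, cdom (tc c) u -> H u (cfun (tc c) (lshift n i)) = u.2 (cfun c i)) ->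
    pivf A W X -> pivf A W Y -> pivf A W Z -> W u ->
    tangent A u.1 (Phv A H X Y Z u) /\ tangent A u.1 (Rh A H X Y Z u).
  move=> Ac [_ oW] sW HV Hx XW YW ZW Wu.
  have bX := beta_vf gA Ac HV Hx oW sW XW; have bY := beta_vf gA Ac HV Hx oW sW YW.
  have gY := gamma_vf gA Ac oW sW YW.
  by split; apply: pivf_tan Wu; exact: (curv_pivf gA Ac HV Hx oW sW).
have eta_on c W : A c -> open_slit A W -> W `<=` cdom (tc c) -> pivf A W (@eta R M).
  by move=> Ac [_ oW] sW; exact: (pivf_eta gA Ac oW sW).
split=> [[P0 R0]|[W0 D0]]; split.
- move=> W X Y oW XW YW u Wu; have [c [W' [Ac oW' W'u sW cW']]] := loc W u oW Wu.
  have cx := (cW' u W'u).2.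
  have XW' := pivf_sub sW XW; have YW' := pivf_sub sW YW.
  have tX := pivf_tan XW Wu; have tY := pivf_tan YW Wu.
  have eW' := eta_on c W' Ac oW' cW'; have te := pivf_tan eW' W'u.
  have [_ tR] := PT c W' G X Y _ u Ac oW' cW' (spray_vf spL) (spray_xc gA Ac finL spL)
    XW' YW' eW' W'u.
  apply: (tangent_ext gA Ac cx _ (tangent0 gA Ac cx)) => [|l].
    apply: (tangentD gA) => //; apply: (tangentZ gA).
    by apply: (tangentB gA); apply: (tangentD gA); exact: (tangentZ gA).
  (* Here the new R vanishes, in particular on [eta], which is the new Rhat. *)
  rewrite -(RW c W')// /Rhat (R0 W' X Y _ oW' XW' YW' eW' u W'u).
  by [].
- move=> W X Y Z oW XW YW ZW u Wu; have [c [W' [Ac oW' W'u sW cW']]] := loc W u oW Wu.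
  have cx := (cW' u W'u).2.
  have XW' := pivf_sub sW XW; have YW' := pivf_sub sW YW; have ZW' := pivf_sub sW ZW.
  have tX := pivf_tan XW Wu; have tY := pivf_tan YW Wu; have tZ := pivf_tan ZW Wu.
  have eW' := eta_on c W' Ac oW' cW'; have te := pivf_tan eW' W'u.
  have [tP _] := PT c W' G X Y Z u Ac oW' cW' (spray_vf spL) (spray_xc gA Ac finL spL)
    XW' YW' ZW' W'u.
  apply: (tangent_ext gA Ac cx _ (tangent0 gA Ac cx)) => [|l].
    apply: (tangentB gA); last exact: (tangentZ gA).
    apply: (tangentB gA) => //; apply: (tangentZ gA).
    by apply: (tangentD gA); [apply: (tangentD gA)|]; exact: (tangentZ gA).
  rewrite -(PD c W')// (P0 W' X Y Z oW' XW' YW' ZW' u W'u).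
  by [].
- move=> W X Y Z oW XW YW ZW u Wu; have [c [W' [Ac oW' W'u sW cW']]] := loc W u oW Wu.
  have cx := (cW' u W'u).2.
  have XW' := pivf_sub sW XW; have YW' := pivf_sub sW YW; have ZW' := pivf_sub sW ZW.
  have [tP _] := PT c W' G' X Y Z u Ac oW' cW' (spray_vf spL') (spray_xc gA Ac finL' spL')
    XW' YW' ZW' W'u.
  apply: (tangent_ext gA Ac cx tP (tangent0 gA Ac cx)) => l.
  by rewrite (PD c W')// (D0 W' X Y Z oW' XW' YW' ZW' u W'u).
- move=> W X Y Z oW XW YW ZW u Wu; have [c [W' [Ac oW' W'u sW cW']]] := loc W u oW Wu.
  have cx := (cW' u W'u).2.
  have XW' := pivf_sub sW XW; have YW' := pivf_sub sW YW; have ZW' := pivf_sub sW ZW.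
  have GV' := spray_vf (c := c) spL'; have Gx' := spray_xc gA Ac finL' spL'.
  have [_ tR] := PT c W' G' X Y Z u Ac oW' cW' GV' Gx' XW' YW' ZW' W'u.
  apply: (tangent_ext gA Ac cx tR (tangent0 gA Ac cx)) => l.
  (* The Weyl torsion is evaluated on the coordinate frame over the full chart domain: this gives
     each [rhat_coef] as a function, whose fibre derivatives are the components of R. *)
  have oU : open_slit A (cdom (tc c)).
    by split; [move=> ? [] | apply: (opn_cdom gS); exact: slit_atlas_tchart].
  suff : Rh A G' X Y Z u (cfun c l) = 0 by [].
  apply: (Rh_cfun_eq0 gA Ac GV' Gx' oW'.2 cW' XW' YW' ZW' W'u) => i j u' cu'.
  have fi := frame_pivf gA Ac i; have fj := frame_pivf gA Ac j.
  rewrite -(Rhat_frame gA Ac GV' Gx' (spray_coef_euler gA Ac finL' spL'))//.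
  by rewrite (RW c (cdom (tc c)))// (W0 _ _ _ oU fi fj u' cu').
Qed.
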